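(* Let $d\ge 1$, let $k\ge 2$ be an integer, $\sigma\in\mathbb{R}$ and $s<0$. Norm inflation with infinite loss of regularity at general initial data holds for the multi-dimensional generalized improved Boussinesq equation $\partial_t^2 u-\Delta u-\partial_t^2\Delta u=\Delta(u^k)$ on $\mathbb{R}^d$. That is, for every $(u_0,u_1)\in H^s(\mathbb{R}^d)\times H^s(\mathbb{R}^d)$ and every $\varepsilon>0$ there exist a solution $u_\varepsilon$ of this equation and a time $t_\varepsilon\in(0,\varepsilon)$ such that $$\|(u_\varepsilon(0),\partial_tu_\varepsilon(0))-(u_0,u_1)\|_{H^s\times H^s}<\varepsilon\quad\text{and}\quad \|u_\varepsilon(t_\varepsilon)\|_{H^\sigma}>\varepsilon^{-1}.$$
   Context: $\langle\xi\rangle=(1+|\xi|^2)^{1/2}$ for $\xi\in\mathbb{R}^d$, $\|f\|_{H^s}=\|\langle\xi\rangle^s\widehat f\|_{L^2(\mathbb{R}^d)}$ ($=+\infty$ if $f\notin H^s$). $\mathcal{F}L^1(\mathbb{R}^d)$ has norm $\|\widehat f\|_{L^1(\mathbb{R}^d)}$. A solution with data $(v_0,v_1)=(u(0),\partial_tu(0))$ on a time interval $[0,T]$ (containing the times considered) means $u\in C([0,T];\mathcal{F}L^1(\mathbb{R}^d))$ satisfying the Duhamel formulation $$u(t)=\cos(tP(D))v_0+\frac{\sin(tP(D))}{P(D)}v_1-\int_0^t \sin((t-t')P(D))P(D)\,\big(u(t')^k\big)\,dt',$$ where $P(D)$ is the Fourier multiplier with symbol $\lambda(\xi)=|\xi|/\langle\xi\rangle$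 (with $\sin(t\lambda)/\lambda:=t$ at $\xi=0$; Fourier conventions such that $\Delta$ has symbol $-|\xi|^2$). *)

(* Defs.v *)
From HB Require Import structures.
From mathcomp Require Import all_boot all_order all_algebra.
From mathcomp Require Import all_classical all_reals all_analysis.
From mathcomp Require Import complex.

Set Implicit Arguments.
Unset Strict Implicit.
Unset Printing Implicit Defensive.
Import Order.TTheory GRing.Theory Num.Theory.
Import numFieldNormedType.Exports.

Local Open Scope classical_set_scope.
Local Open Scope ring_scope.
Local Open Scope complex_scope.

(* R^d, with the product (= Borel) sigma-algebra. *)
Notation Euc R d := (d.-tuple (measurableTypeR R)).

Section lebesgue_cons.
Local Open Scope ereal_scope.
Context (R : realType) (n : nat).
Variable m : {sigma_finite_measure set (Euc R n) -> \bar R}.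

Definition cons_pair (p : measurableTypeR R * Euc R n) : Euc R n.+1 :=
  [the n.+1.-tuple _ of p.1 :: p.2].

Lemma measurable_cons_pair : measurable_fun [set: _] cons_pair.
Proof. exact: measurable_cons. Qed.

(* The product of the one-dimensional Lebesgue measure with m, carried to
   R^(n+1) by (x, (y_1, ..., y_n)) |-> (x, y_1, ..., y_n). *)
Definition lebesgue_cons : set (Euc R n.+1) -> \bar R :=
  pushforward (@lebesgue_measure R \x m) cons_pair.

Let lebesgue_cons0 : lebesgue_cons set0 = 0.
Proof. by rewrite /lebesgue_cons /pushforward preimage_set0 measure0. Qed.

Let lebesgue_cons_ge0 A : 0 <= lebesgue_cons A.
Proof. by rewrite /lebesgue_cons /pushforward measure_ge0. Qed.

Let lebesgue_cons_sigma_additive : semi_sigma_additive lebesgue_cons.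
Proof.
have mf := measurable_cons_pair.
move=> F mF tF mUF; rewrite /lebesgue_cons /pushforward preimage_bigcup.
apply: measure_semi_sigma_additive.
- by move=> i; rewrite -[X in measurable X]setTI; exact: mf.
- apply/trivIsetP => /= i j _ _ ij; rewrite -preimage_setI.
  by move/trivIsetP : tF => /(_ _ _ _ _ ij) ->//; rewrite preimage_set0.
- by rewrite -preimage_bigcup -[X in measurable X]setTI; exact: mf.
Qed.

HB.instance Definition _ := isMeasure.Build _ _ _ lebesgue_cons
  lebesgue_cons0 lebesgue_cons_ge0 lebesgue_cons_sigma_additive.

Let uncons (z : Euc R n.+1) : measurableTypeR R * Euc R n :=
  (thead z, [tuple of behead z]).

Let measurable_uncons : measurable_fun [set: _] uncons.
Proof.
by apply/measurable_fun_pairP; split;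
  [exact: measurable_tnth|exact: measurable_behead].
Qed.

Let lebesgue_cons_sigma_finite : sigma_finite setT lebesgue_cons.
Proof.
have /sigma_finiteP[F [TF ndF Foo]] := sigma_finiteT (@lebesgue_measure R).
have /sigma_finiteP[G [TG ndG Goo]] := sigma_finiteT m.
exists (fun i => uncons @^-1` (F i `*` G i)).
  rewrite -preimage_bigcup -[LHS](preimage_setT uncons); congr (_ @^-1` _).
  rewrite -setXTT TF TG predeqE => -[x y]; split.
    move=> [/= [i _ Fix] [j _ Gjy]]; exists (maxn i j) => //; split.
    - by move: x Fix; exact/subsetPset/ndF/leq_maxl.
    - by move: y Gjy; exact/subsetPset/ndG/leq_maxr.
  by move=> [i _ []/= ? ?]; split; exists i.
move=> i; have [mFi Fioo] := Foo i; have [mGi Gioo] := Goo i; split.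
  by rewrite -[X in measurable X]setTI; apply: measurable_uncons => //;
    exact: measurableX.
rewrite /lebesgue_cons /pushforward -comp_preimage.
have -> : uncons \o cons_pair = id.
  apply/funext => -[x y]; rewrite /uncons /cons_pair /=; congr pair.
  exact: val_inj.
by rewrite preimage_id product_measure1E// lte_mul_pinfty// ge0_fin_numE.
Qed.

HB.instance Definition _ := Measure_isSigmaFinite.Build _ _ _ lebesgue_cons
  lebesgue_cons_sigma_finite.

End lebesgue_cons.

(* Lebesgue measure on R^d; R^0 is a point of mass 1. *)
Fixpoint lebesgue (R : realType) (d : nat) :
    {sigma_finite_measure set (Euc R d) -> \bar R} :=
  match d with
  | 0 => \d_([tuple] : Euc R 0)
  | n.+1 => lebesgue_cons (lebesgue R n)
  end.

Section complex_integral.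
Context d (T : measurableType d) (R : realType).
Variable mu : {measure set T -> \bar R}.
Implicit Types (D : set T) (f : T -> R[i]).

Definition cmeasurable D f :=
  measurable_fun D (fun x => complex.Re (f x)) /\
  measurable_fun D (fun x => complex.Im (f x)).

Definition cintegrable D f :=
  mu.-integrable D (fun x => (complex.Re (f x))%:E) /\
  mu.-integrable D (fun x => (complex.Im (f x))%:E).

Definition cintegral D f : R[i] :=
  (\int[mu]_(x in D) complex.Re (f x)) +i* (\int[mu]_(x in D) complex.Im (f x)).

End complex_integral.

Section fourier.
Context (R : realType) (d : nat).
Local Notation E := (Euc R d).
Local Notation mu := (lebesgue R d).
Local Notation C := R[i].

Definition dotp (x y : E) : R := \sum_(i < d) tnth x i * tnth y i.

Definition enorm (x : E) : R := Num.sqrt (dotp x x).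

Definition japanese (x : E) : R := Num.sqrt (1 + enorm x ^+ 2).

Definition cexpi (t : R) : C := cos t +i* sin t.

(* (F^-1 g)(x) = \int e^{i x.xi} g(xi) dxi; the corresponding Fourier transform
   is (F f)(xi) = (2 pi)^-d \int e^{-i x.xi} f(x) dx, and -|xi|^2 is the symbol
   of the Laplacian. *)
Definition inv_fourier (g : E -> C) (x : E) : C :=
  cintegral mu setT (fun xi => cexpi (dotp x xi) * g xi).

Definition shift (i : 'I_d) (h : R) (x : E) : E :=
  [tuple (if j == i then tnth x j + h else tnth x j) | j < d].

Definition pderivable (i : 'I_d) (f : E -> C) (x : E) :=
  derivable (fun h : R => complex.Re (f (shift i h x))) 0 1 /\
  derivable (fun h : R => complex.Im (f (shift i h x))) 0 1.

Definition pderive (i : 'I_d) (f : E -> C) (x : E) : C :=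
  (fun h : R => complex.Re (f (shift i h x)))^`()%classic 0 +i*
  (fun h : R => complex.Im (f (shift i h x)))^`()%classic 0.

(* The multi-index is the list of the variables of differentiation. *)
Definition pderives (a : seq 'I_d) (f : E -> C) : E -> C := foldr pderive f a.

(* Existence and boundedness of the partial derivatives of all orders makes
   them continuous, so that f is smooth. *)
Definition schwartz (f : E -> C) :=
  (forall (a : seq 'I_d) (i : 'I_d) (x : E), pderivable i (pderives a f) x) /\
  (forall (a : seq 'I_d) (N : nat), exists K : R, forall x : E,
     japanese x ^+ N * Normc.normc (pderives a f x) <= K).

(* A distribution is a functional on test functions; only its values on
   Schwartz functions are meaningful. *)
Definition distr : Type := (E -> C) -> C.

(* Linearity, and continuity for the Schwartz seminorms: M ranges over the
   upper bounds of the N-th seminorm of phi. *)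
Definition tempered (T : distr) :=
  (forall (c : C) (phi psi : E -> C), schwartz phi -> schwartz psi ->
     T (fun x => c * phi x + psi x) = c * T phi + T psi) /\
  (exists (N : nat) (K : R), forall phi : E -> C, schwartz phi ->
     forall M : R,
       (forall (a : seq 'I_d) (x : E), (size a <= N)%N ->
          japanese x ^+ N * Normc.normc (pderives a phi x) <= M) ->
     Normc.normc (T phi) <= K * M).

Definition distr_of (f : E -> C) : distr :=
  fun phi => cintegral mu setT (fun x => f x * phi x).

Definition distr_sub (S T : distr) : distr := fun phi => S phi - T phi.

(* The Fourier transform of T is the function g: the distribution F^-1 g,
   defined by transposition as phi |-> \int g (F^-1 phi), is T. *)
Definition has_fourier (T : distr) (g : E -> C) :=
  cmeasurable setT g /\
  forall phi : E -> C, schwartz phi ->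
    cintegrable mu setT (fun xi => g xi * inv_fourier phi xi) /\
    T phi = cintegral mu setT (fun xi => g xi * inv_fourier phi xi).

(* The Fourier transform is unique almost everywhere when it is a function, so
   that the infimum is over at most one value; it is +oo if there is none. *)
Definition sobolev_norm (s : R) (T : distr) : \bar R :=
  let weighted g xi := (japanese xi `^ s * Normc.normc (g xi))%:E in
  ereal_inf [set ('N[mu]_2%:E[weighted g])%E | g in has_fourier T].

Definition sobolev (s : R) (T : distr) :=
  tempered T /\ (sobolev_norm s T < +oo)%E.

(* f is the element of FL^1 with Fourier transform g. *)
Definition FL1_fourier (f g : E -> C) :=
  cintegrable mu setT g /\ forall x, f x = inv_fourier g x.

(* As for sobolev_norm, the infimum is over at most one value. *)
Definition FL1_norm (f : E -> C) : \bar R :=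
  ereal_inf [set (\int[mu]_xi (Normc.normc (g xi))%:E)%E | g in FL1_fourier f].

(* h = m(D) f in FL^1. *)
Definition is_multiplier (m : E -> R) (f h : E -> C) :=
  exists g : E -> C,
    FL1_fourier f g /\ FL1_fourier h (fun xi => (m xi)%:C * g xi).

Definition lambda (xi : E) : R := enorm xi / japanese xi.

Definition cos_symbol (t : R) (xi : E) : R := cos (t * lambda xi).

Definition sinc_symbol (t : R) (xi : E) : R :=
  if lambda xi == 0 then t else sin (t * lambda xi) / lambda xi.

Definition duhamel_symbol (t : R) (xi : E) : R :=
  sin (t * lambda xi) * lambda xi.

(* u(t) = cos(tP(D)) v0 + sin(tP(D))/P(D) v1
            - \int_0^t sin((t-t')P(D)) P(D) (u(t')^k) dt'.
   The integrand is continuous with values in FL^1 and evaluation at a point is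
   continuous on FL^1, so that its integral is computed pointwise. *)
Definition duhamel (k : nat) (T : R) (v0 v1 : E -> C) (u : R -> E -> C) :=
  forall t : R, t \in `[0, T] ->
  exists (a b : E -> C) (N : R -> E -> C),
    [/\ is_multiplier (cos_symbol t) v0 a,
        is_multiplier (sinc_symbol t) v1 b,
        forall t' : R, t' \in `[0, t] ->
          is_multiplier (duhamel_symbol (t - t')) (fun x => u t' x ^+ k) (N t') &
        forall x : E, u t x =
          a x + b x - cintegral lebesgue_measure `[0, t] (fun t' => N t' x)].

(* u is a solution on [0,T] with data v0 = u(0) and v1 = (d/dt)u(0), the latter
   being a one-sided derivative in FL^1. *)
Definition solution (k : nat) (T : R) (v0 v1 : E -> C) (u : R -> E -> C) :=
  [/\ 0 < T,
      forall t : R, t \in `[0, T] -> (FL1_norm (u t) < +oo)%E /\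
        FL1_norm (fun x => u t' x - u t x) @[t' --> within `[0, T] (nbhs t)]
          --> 0%E,
      u 0 = v0,
      FL1_norm (fun x => (h^-1)%:C * (u h x - u 0 x) - v1 x) @[h --> 0^'+]
          --> 0%E &
      duhamel k T v0 v1 u].

End fourier.

(* Main.v *)
Require Import Defs.
From HB Require Import structures.
From mathcomp Require Import all_boot all_order all_algebra.
From mathcomp Require Import all_classical all_reals all_analysis.
From mathcomp Require Import complex.
From mathcomp Require Import measurable_realfun zify ring lra.

(* The Fourier transform of a solution obeys U'' = - lambda^2 (U + U^{*k}) with
   0 <= lambda <= 1 and U^{*k} the k-fold convolution. The multiplier being
   bounded, data with bounded and integrable transforms launch a solution which
   is a power series in time on an interval depending on their size. As data
   take truncations of the transforms of u_0 and u_1, and add to the former A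
   times the indicators of two unit cubes near the frequencies N e and
   - (k - 1) N e. In H^s this perturbation is of order A N^s, hence small for N
   large. But k - 1 frequencies from the first cube and one from the second add
   up to a low frequency, so that the coefficient of t^2 has a low frequency
   part of order A^k. For A large and t small in a suitable ratio, this part
   dominates the other terms and the remainder of the series, and it is
   detected by testing the solution against a Gaussian, which bounds every
   H^sigma norm from below. *)

Set Implicit Arguments.
Unset Strict Implicit.
Unset Printing Implicit Defensive.
Import Order.TTheory GRing.Theory Num.Theory.
Import numFieldNormedType.Exports.

Local Open Scope classical_set_scope.
Local Open Scope ring_scope.
Local Open Scope complex_scope.

(** Write j = k - 1. The series lives for a time of order A^(-j/2), so t^2 A^j stays bounded; what
    inflates is the one further factor A in t^2 A^(j+1). With tau = t A^(j/2), the resonant term has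
    size A tau^2 and the third-order remainder size A tau^3: tau must be small while A tau^2 is
    large. The truncated data enter the coefficient of t^2 only in terms of order A^j or A, so
    inflation near general data costs no more than near zero. None of this involves N: lifespan and
    remainder depend only on sup and L^1 bounds, which do not change when the cubes are translated.
    Hence N is chosen last, and must make small the H^s norm of the bumps and keep their own pairing
    with the Gaussian bounded. The symbol lambda^2 vanishes at the origin, where an output would be
    lost. The cubes are therefore translates of [1, 2]^d: resonant sums fall in [k, 2k]^d, where
    lambda^2 is at least 1/2. Since the bumps are nonnegative, their convolutions cannot cancel, and
    the mass on that cube is at least A^k. *)

Local Notation cRe := complex.Re.
Local Notation cIm := complex.Im.
Local Notation measT := (measurable_fun setT).
Local Notation cmeas := (cmeasurable setT).

(** * Complex-valued functions and integrals *)

Section l1n.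
Context {R : realType}.
Implicit Types z w : R[i].

(** A substitute for the modulus: measurability and integrability then reduce to the real and
    imaginary parts, while the norm stays subadditive and submultiplicative and is comparable to
    [Normc.normc] up to a factor 2. A phase has [l1n] up to sqrt 2, bounded by 2; this is the 2 that
    accompanies [inv_fourier] in the estimates below. *)
Definition l1n z : R := `|cRe z| + `|cIm z|.

Lemma cReD z w : cRe (z + w) = cRe z + cRe w.
Proof. by case: z w => [a b] [c d]. Qed.
Lemma cImD z w : cIm (z + w) = cIm z + cIm w.
Proof. by case: z w => [a b] [c d]. Qed.
Lemma cReN z : cRe (- z) = - cRe z.
Proof. by case: z => [a b]. Qed.
Lemma cImN z : cIm (- z) = - cIm z.
Proof. by case: z => [a b]. Qed.
Lemma cReB z w : cRe (z - w) = cRe z - cRe w.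
Proof. by rewrite cReD cReN. Qed.
Lemma cImB z w : cIm (z - w) = cIm z - cIm w.
Proof. by rewrite cImD cImN. Qed.
Lemma cReM z w : cRe (z * w) =
  cRe z * cRe w - cIm z * cIm w.
Proof. by case: z w => [a b] [c d]. Qed.
Lemma cImM z w : cIm (z * w) =
  cRe z * cIm w + cIm z * cRe w.
Proof. by case: z w => [a b] [c d]. Qed.
Lemma cReMr (a : R) w : cRe (a%:C * w) = a * cRe w.
Proof. by rewrite cReM /= mul0r subr0. Qed.
Lemma cImMr (a : R) w : cIm (a%:C * w) = a * cIm w.
Proof. by rewrite cImM /= mul0r addr0. Qed.
Lemma cRe_sum I (r : seq I) (P : pred I) (F : I -> R[i]) :
  cRe (\sum_(i <- r | P i) F i) = \sum_(i <- r | P i) cRe (F i).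
Proof. by apply: (big_morph (fun z => cRe z) cReD). Qed.
Lemma cIm_sum I (r : seq I) (P : pred I) (F : I -> R[i]) :
  cIm (\sum_(i <- r | P i) F i) = \sum_(i <- r | P i) cIm (F i).
Proof. by apply: (big_morph (fun z => cIm z) cImD). Qed.

Lemma complex_ext z w : cRe z = cRe w ->
  cIm z = cIm w -> z = w.
Proof. by case: z w => [a b] [c d] /= -> ->. Qed.

Lemma l1n_ge0 z : 0 <= l1n z. Proof. exact: addr_ge0. Qed.
Lemma l1n0 : l1n 0 = 0. Proof. by rewrite /l1n /= normr0 addr0. Qed.
Lemma l1nN z : l1n (- z) = l1n z.
Proof. by rewrite /l1n cReN cImN !normrN. Qed.
Lemma l1nD z w : l1n (z + w) <= l1n z + l1n w.
Proof. by rewrite /l1n cReD cImD addrACA lerD// ler_normD. Qed.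
Lemma l1nB z w : l1n (z - w) <= l1n z + l1n w.
Proof. by rewrite (le_trans (l1nD _ _))// l1nN. Qed.
Lemma l1nBC z w : l1n (z - w) = l1n (w - z).
Proof. by rewrite -opprB l1nN. Qed.
Lemma l1nM z w : l1n (z * w) <= l1n z * l1n w.
Proof.
rewrite /l1n cReM cImM.
apply: (@le_trans _ _ (`|cRe z| * `|cRe w| +
  `|cIm z| * `|cIm w| + (`|cRe z| * `|cIm w| +
  `|cIm z| * `|cRe w|))).
  by rewrite -!normrM lerD// ?ler_normB// ler_normD.
by lra.
Qed.
Lemma l1nMr (a : R) w : l1n (a%:C * w) = `|a| * l1n w.
Proof. by rewrite /l1n cReMr cImMr !normrM mulrDr. Qed.
Lemma l1n_sum I (r : seq I) (P : pred I) (F : I -> R[i]) :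
  l1n (\sum_(i <- r | P i) F i) <= \sum_(i <- r | P i) l1n (F i).
Proof.
elim/big_rec2: _ => [|i y x _ h]; first by rewrite l1n0.
by rewrite (le_trans (l1nD _ _))// lerD2l.
Qed.
Lemma Re_le_l1n z : `|cRe z| <= l1n z. Proof. by rewrite lerDl. Qed.
Lemma Im_le_l1n z : `|cIm z| <= l1n z. Proof. by rewrite lerDr. Qed.
Lemma normc_le_l1n z : Normc.normc z <= l1n z.
Proof.
case: z => a b; rewrite /Normc.normc /l1n /=.
rewrite -[leRHS]ger0_norm ?addr_ge0// -sqrtr_sqr ler_sqrt ?sqr_ge0//.
by rewrite sqrrD !real_normK ?num_real// -addrA [_ *+ 2 + _]addrC addrA
  lerDl mulrn_wge0// mulr_ge0.
Qed.
Lemma Re_le_normc z : `|cRe z| <= Normc.normc z.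
Proof.
case: z => a b; rewrite /Normc.normc /= -sqrtr_sqr ler_sqrt ?addr_ge0 ?sqr_ge0//.
by rewrite lerDl sqr_ge0.
Qed.
Lemma Im_le_normc z : `|cIm z| <= Normc.normc z.
Proof.
case: z => a b; rewrite /Normc.normc /= -sqrtr_sqr ler_sqrt ?addr_ge0 ?sqr_ge0//.
by rewrite lerDr sqr_ge0.
Qed.
Lemma l1n_le_normc z : l1n z <= 2 * Normc.normc z.
Proof. by rewrite mulr_natl mulr2n lerD ?Re_le_normc ?Im_le_normc. Qed.
Lemma normc_ge0 z : 0 <= Normc.normc z.
Proof. exact: le_trans (Re_le_normc z). Qed.

Lemma l1n_cexpi (t : R) : l1n (cexpi t) <= 2.
Proof.
by rewrite /l1n /= (_ : 2 = 1 + 1)// lerD// ler_norml ?cos_le1 ?cos_geN1 ?sin_le1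
  ?sin_geN1.
Qed.
Lemma cexpiD (s t : R) : cexpi (s + t) = cexpi s * cexpi t.
Proof.
by apply: complex_ext; rewrite ?cReM ?cImM /= ?cosD// sinD addrC; congr (_ + _); ring.
Qed.
End l1n.

Section measurability.
Context d (T : measurableType d) {R : realType}.
Implicit Types (f g : T -> R[i]) (m : T -> R).

Lemma cmeas_cst (c : R[i]) : cmeas (fun _ : T => c).
Proof. by split; exact: measurable_cst. Qed.
Lemma cmeasD f g : cmeas f -> cmeas g -> cmeas (fun x => f x + g x).
Proof.
move=> [f1 f2] [g1 g2]; split.
  by under eq_fun do rewrite cReD; exact: measurable_funD.
by under eq_fun do rewrite cImD; exact: measurable_funD.
Qed.
Lemma cmeasN f : cmeas f -> cmeas (fun x => - f x).
Proof.
move=> [f1 f2]; split.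
  by under eq_fun do rewrite cReN; exact: measurableT_comp.
by under eq_fun do rewrite cImN; exact: measurableT_comp.
Qed.
Lemma cmeasB f g : cmeas f -> cmeas g -> cmeas (fun x => f x - g x).
Proof. by move=> mf mg; apply: cmeasD => //; exact: cmeasN. Qed.
Lemma cmeasM f g : cmeas f -> cmeas g -> cmeas (fun x => f x * g x).
Proof.
move=> [f1 f2] [g1 g2]; split.
  under eq_fun do rewrite cReM.
  by apply: measurable_funB; exact: measurable_funM.
under eq_fun do rewrite cImM.
by apply: measurable_funD; exact: measurable_funM.
Qed.
Lemma cmeas_real m : measT m -> cmeas (fun x => (m x)%:C).
Proof. by move=> mm; split => //=; exact: measurable_cst. Qed.
Lemma cmeasMr m f : measT m -> cmeas f ->
  cmeas (fun x => (m x)%:C * f x).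
Proof. by move=> mm mf; apply: cmeasM => //; exact: cmeas_real. Qed.
Lemma cmeas_sum I (r : seq I) (P : pred I) (F : I -> T -> R[i]) :
  (forall i, P i -> cmeas (F i)) -> cmeas (fun x => \sum_(i <- r | P i) F i x).
Proof.
move=> mF; elim: r => [|i r IH].
  rewrite (_ : (fun x => _) = (fun _ => 0)); first exact: cmeas_cst.
  by apply/funext => x; rewrite big_nil.
rewrite (_ : (fun x => _) = (fun x =>
  (if P i then F i x else 0) + \sum_(i <- r | P i) F i x)); last first.
  by apply/funext => x; rewrite big_cons; case: ifP => // _; rewrite add0r.
apply: cmeasD => //; case: (P i) (mF i) => [mFi|_]; [exact: mFi|exact: cmeas_cst].
Qed.
Lemma cmeas_cexpi m : measT m -> cmeas (fun x => cexpi (m x)).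
Proof.
move=> mm; split => /=.
  by apply: measurableT_comp mm; apply: continuous_measurable_fun; exact: continuous_cos.
by apply: measurableT_comp mm; apply: continuous_measurable_fun; exact: continuous_sin.
Qed.
Lemma measurable_l1n f : cmeas f -> measT (fun x => l1n (f x)).
Proof.
by move=> [f1 f2]; apply: measurable_funD; exact: measurableT_comp.
Qed.
Lemma measurable_normc f : cmeas f ->
  measT (fun x => Normc.normc (f x)).
Proof.
move=> [f1 f2]; rewrite (_ : (fun x => _) = (fun x =>
  Num.sqrt (cRe (f x) ^+ 2 + cIm (f x) ^+ 2))).
  apply: measurableT_comp => /=.
    by apply: continuous_measurable_fun; exact: sqrt_continuous.
  by apply: measurable_funD; exact: measurable_funX.
by apply/funext => x; case: (f x).
Qed.
Lemma measurable_El1n f : cmeas f ->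
  measT (fun x => (l1n (f x))%:E).
Proof. by move=> mf; apply/measurable_EFinP; exact: measurable_l1n. Qed.

End measurability.

Lemma cmeas_comp d d' (T : measurableType d) (T' : measurableType d')
  {R : realType} (h : T' -> T) (f : T -> R[i]) :
  measT h -> cmeas f -> cmeas (f \o h).
Proof. by move=> mh [f1 f2]; split; [exact: measurableT_comp f1 mh|exact: measurableT_comp f2 mh]. Qed.

Section complex_integrals.
Context d (T : measurableType d) {R : realType}.
Variable mu : {measure set T -> \bar R}.
Implicit Types (f g : T -> R[i]).
Local Notation cint := (cintegrable mu setT).

Lemma le_integral_ge0 (f g : T -> R) : measT f ->
  measT g -> (forall x, 0 <= f x) -> (forall x, f x <= g x) ->
  (\int[mu]_x (f x)%:E <= \int[mu]_x (g x)%:E)%E.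
Proof.
move=> mf mg f0 fg; apply: ge0_le_integral => //.
- by move=> x _; rewrite lee_fin.
- exact/measurable_EFinP.
- exact/measurable_EFinP.
- by move=> x _; rewrite lee_fin.
Qed.

Lemma integrable_dominated (f g : T -> R) : measT f ->
  measT g -> (forall x, `|f x| <= g x) ->
  (\int[mu]_x (g x)%:E < +oo)%E -> mu.-integrable setT (fun x => (f x)%:E).
Proof.
move=> mf mg fg gy; apply/integrableP; split; first exact/measurable_EFinP.
apply: le_lt_trans gy; rewrite (_ : (fun x => _) = (fun x => `|f x|%:E))//.
by apply: le_integral_ge0 => //; exact: measurableT_comp.
Qed.

Lemma cintegrable_l1n f : cmeas f ->
  (\int[mu]_x (l1n (f x))%:E < +oo)%E -> cint f.
Proof.
move=> mf foo; split.
  by apply: integrable_dominated foo => [||x]; [exact: mf.1|exact: measurable_l1n|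
    exact: Re_le_l1n].
by apply: integrable_dominated foo => [||x]; [exact: mf.2|exact: measurable_l1n|
  exact: Im_le_l1n].
Qed.

Lemma cint_meas f : cint f -> cmeas f.
Proof.
by move=> [/integrableP[/measurable_EFinP f1 _] /integrableP[/measurable_EFinP f2 _]].
Qed.

Lemma cint_lty f : cint f -> (\int[mu]_x (l1n (f x))%:E < +oo)%E.
Proof.
move=> cf; have [m1 m2] := cint_meas cf; have [/integrableP[_ f1] /integrableP[_ f2]] := cf.
rewrite /l1n; under eq_integral do rewrite EFinD.
rewrite ge0_integralD//; first by rewrite lte_add_pinfty.
- by apply/measurable_EFinP; exact: measurableT_comp m1.
- by apply/measurable_EFinP; exact: measurableT_comp m2.
Qed.

Lemma cintegrableP f : cmeas f ->
  (cint f <-> (\int[mu]_x (l1n (f x))%:E < +oo)%E).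
Proof. by move=> mf; split; [exact: cint_lty|exact: cintegrable_l1n]. Qed.

Lemma integral_l1nZ c f : 0 <= c -> cmeas f ->
  (\int[mu]_x (c * l1n (f x))%:E = c%:E * \int[mu]_x (l1n (f x))%:E)%E.
Proof.
move=> c0 mf; under eq_integral do rewrite EFinM.
rewrite ge0_integralZl_EFin//; last exact: measurable_El1n.
by move=> x _; rewrite lee_fin l1n_ge0.
Qed.

Lemma le_cintegrable f (g : T -> R) : cmeas f -> measT g ->
  (forall x, l1n (f x) <= g x) -> (\int[mu]_x (g x)%:E < +oo)%E -> cint f.
Proof.
move=> mf mg fg goo; rewrite cintegrableP//; apply: le_lt_trans goo.
by apply: le_integral_ge0 => // [|x]; [exact: measurable_l1n|exact: l1n_ge0].
Qed.

Lemma cintD f g : cint f -> cint g -> cint (fun x => f x + g x).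
Proof.
move=> [f1 f2] [g1 g2]; split.
  by under eq_fun do rewrite cReD EFinD; exact: integrableD.
by under eq_fun do rewrite cImD EFinD; exact: integrableD.
Qed.
Lemma cintN f : cint f -> cint (fun x => - f x).
Proof.
move=> [f1 f2]; split.
  by under eq_fun do rewrite cReN EFinN; exact: integrableN.
by under eq_fun do rewrite cImN EFinN; exact: integrableN.
Qed.
Lemma cintB f g : cint f -> cint g -> cint (fun x => f x - g x).
Proof. by move=> mf mg; apply: cintD => //; exact: cintN. Qed.
Lemma cint0 : cint (fun _ => 0).
Proof. by split => /=; exact: integrable0. Qed.
Lemma cint_sum I (r : seq I) (P : pred I) (F : I -> T -> R[i]) :
  (forall i, P i -> cint (F i)) -> cint (fun x => \sum_(i <- r | P i) F i x).
Proof.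
move=> cF; elim: r => [|i r IH].
  rewrite (_ : (fun x => _) = (fun _ => 0)); first exact: cint0.
  by apply/funext => x; rewrite big_nil.
rewrite (_ : (fun x => _) = (fun x =>
  (if P i then F i x else 0) + \sum_(i <- r | P i) F i x)); last first.
  by apply/funext => x; rewrite big_cons; case: ifP => // _; rewrite add0r.
by apply: cintD => //; case: (P i) (cF i) => [cFi|_]; [exact: cFi|exact: cint0].
Qed.

Lemma cintM_bounded f g (K : R) : cmeas f -> (forall x, l1n (f x) <= K) ->
  cint g -> cint (fun x => f x * g x).
Proof.
move=> mf fK cg; have mg := cint_meas cg.
apply: (@le_cintegrable _ (fun x => K * l1n (g x))).
- exact: cmeasM.
- by apply: measurable_funM => //; exact: measurable_l1n.
- by move=> x; rewrite (le_trans (l1nM _ _))// ler_wpM2r// l1n_ge0.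
have K0 : 0 <= K by apply: le_trans (fK point); exact: l1n_ge0.
by rewrite integral_l1nZ//; apply: lte_mul_pinfty => //; exact: cint_lty.
Qed.

Lemma eq_cintegral D f g : {in D, f =1 g} ->
  cintegral mu D f = cintegral mu D g.
Proof.
by move=> fg; rewrite /cintegral; congr (_ +i* _);
  apply: eq_Rintegral => x xD; rewrite fg.
Qed.

Lemma cintegralD f g : cint f -> cint g ->
  cintegral mu setT (fun x => f x + g x) = cintegral mu setT f + cintegral mu setT g.
Proof.
move=> [f1 f2] [g1 g2]; apply: complex_ext; rewrite ?cReD ?cImD /=.
  by rewrite -RintegralD//; apply: eq_Rintegral => x _; rewrite cReD.
by rewrite -RintegralD//; apply: eq_Rintegral => x _; rewrite cImD.
Qed.
Lemma cintegralB f g : cint f -> cint g ->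
  cintegral mu setT (fun x => f x - g x) = cintegral mu setT f - cintegral mu setT g.
Proof.
move=> [f1 f2] [g1 g2]; apply: complex_ext; rewrite ?cReB ?cImB /=.
  by rewrite -RintegralB//; apply: eq_Rintegral => x _; rewrite cReB.
by rewrite -RintegralB//; apply: eq_Rintegral => x _; rewrite cImB.
Qed.
Lemma integrableRZl (k : R) (h : T -> R) :
  mu.-integrable setT (EFin \o h) -> mu.-integrable setT (EFin \o (fun x => k * h x)).
Proof. by move=> ih; rewrite /comp; under eq_fun do rewrite EFinM; exact: integrableZl. Qed.
Lemma cintegralMl (c : R[i]) f : cint f ->
  cintegral mu setT (fun x => c * f x) = c * cintegral mu setT f.
Proof.
move=> [f1 f2]; apply: complex_ext; rewrite ?cReM ?cImM /=.
  rewrite -!RintegralZl// -RintegralB//; [|exact: integrableRZl..].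
  by apply: eq_Rintegral => x _; rewrite cReM.
rewrite -!RintegralZl// -RintegralD//; [|exact: integrableRZl..].
by apply: eq_Rintegral => x _; rewrite cImM.
Qed.
Lemma cintegralMr (c : R[i]) f : cint f ->
  cintegral mu setT (fun x => f x * c) = cintegral mu setT f * c.
Proof.
move=> cf; rewrite [RHS]mulrC -cintegralMl//.
by apply: eq_cintegral => x _; rewrite mulrC.
Qed.
Lemma cintegral0 : cintegral mu setT (fun _ => 0) = 0.
Proof.
rewrite /cintegral /=; apply: complex_ext => /=;
by rewrite /Rintegral integral0_eq.
Qed.
Lemma cintegral_sum I (r : seq I) (P : pred I) (F : I -> T -> R[i]) :
  (forall i, P i -> cint (F i)) ->
  cintegral mu setT (fun x => \sum_(i <- r | P i) F i x) =
  \sum_(i <- r | P i) cintegral mu setT (F i).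
Proof.
move=> cF; elim: r => [|i r IH].
  rewrite big_nil -[RHS]cintegral0; apply: eq_cintegral => x _.
  by rewrite big_nil.
rewrite big_cons -IH; case: ifPn => Pi.
  rewrite -cintegralD; [|exact: cF|exact: cint_sum].
  by apply: eq_cintegral => x _; rewrite big_cons Pi.
by apply: eq_cintegral => x _; rewrite big_cons (negbTE Pi).
Qed.

Lemma l1n_cintegral_le f : cmeas f ->
  ((l1n (cintegral mu setT f))%:E <= \int[mu]_x (l1n (f x))%:E)%E.
Proof.
move=> mf; have [foo|] := ltP (\int[mu]_x (l1n (f x))%:E)%E +oo%E; last first.
  by rewrite leye_eq => /eqP ->; exact: leey.
have [f1 f2] := cintegrable_l1n mf foo.
rewrite /l1n /= EFinD; under eq_integral do rewrite EFinD.
rewrite ge0_integralD//; first last.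
- by apply/measurable_EFinP; exact: measurableT_comp mf.2.
- by apply/measurable_EFinP; exact: measurableT_comp mf.1.
rewrite !EFin_normr_Rintegral//.
apply: leeD; apply: (le_trans (le_abse_integral _ _ _)) => //.
  by apply/measurable_EFinP; exact: mf.1.
by apply/measurable_EFinP; exact: mf.2.
Qed.

Lemma l1n_cintegral_bound f (K : R) : cmeas f ->
  (\int[mu]_x (l1n (f x))%:E <= K%:E)%E -> l1n (cintegral mu setT f) <= K.
Proof. by move=> mf fK; rewrite -lee_fin (le_trans (l1n_cintegral_le mf)). Qed.

End complex_integrals.

(** * Fubini for real- and complex-valued integrals *)

Section complex_fubini.
Context d1 d2 (T1 : measurableType d1) (T2 : measurableType d2) {R : realType}.
Variable m1 : {sigma_finite_measure set T1 -> \bar R}.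
Variable m2 : {sigma_finite_measure set T2 -> \bar R}.

(** The integral is the difference of those of the positive and negative parts, each measurable in
    the parameter by Tonelli, and [fine] is measurable; infinite values do no harm. *)
Lemma measurable_Rintegral1 (f : T1 * T2 -> R) : measT f ->
  measT (fun x => \int[m2]_y f (x, y)).
Proof.
move=> mf; rewrite /Rintegral.
apply: measurableT_comp => //.
rewrite (_ : (fun x => _) = (fun x => \int[m2]_y (EFin \o f)^\+ (x, y) -
   \int[m2]_y (EFin \o f)^\- (x, y))%E); last first.
  by apply/funext => x; rewrite [LHS]integralE;
    apply: (f_equal2 (fun a b => a - b)%E); apply: eq_integral => y _;
    rewrite ?funeposE ?funenegE.
have mEf : measT (EFin \o f) by exact/measurable_EFinP.
apply: emeasurable_funB.
  by apply: measurable_fun_fubini_tonelli_F => //; exact: measurable_funepos.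
by apply: measurable_fun_fubini_tonelli_F => //; exact: measurable_funeneg.
Qed.

(** [Rintegral] replaces an infinite inner integral by 0, so the real inner integrals agree with the
    extended ones only almost everywhere. This is enough for the outer integral, and Fubini for
    extended reals does the rest. *)
Lemma Rfubini (f : T1 * T2 -> R) : measT f ->
  (\int[m1]_x \int[m2]_y (`|f (x, y)|)%:E < +oo)%E ->
  \int[m1]_x (\int[m2]_y f (x, y)) = \int[m2]_y (\int[m1]_x f (x, y)).
Proof.
move=> mf foo; have mEf : measT (EFin \o f) by exact/measurable_EFinP.
have If : (m1 \x m2)%E.-integrable setT (EFin \o f).
  by apply/integrable12ltyP.
rewrite [LHS]/Rintegral [RHS]/Rintegral; congr fine.
transitivity (\int[m1]_x \int[m2]_y (f (x, y))%:E)%E.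
  apply: ae_eq_integral => //.
  - apply/measurable_EFinP; exact: measurable_Rintegral1.
  - exact: (measurable_fubini_F If).
  have /integrable_ae := integrable_fubini_F If.
  move=> /(_ measurableT); apply: filterS => x /= h _.
  by rewrite /Rintegral fineK//; exact: h.
transitivity (\int[m2]_y \int[m1]_x (f (x, y))%:E)%E; first exact: (Fubini If).
apply: ae_eq_integral => //.
- exact: (measurable_fubini_G If).
- apply/measurable_EFinP; rewrite /Rintegral; apply: measurableT_comp => //.
  exact: (measurable_fubini_G If).
have := ae_integrable2 If; apply: filterS => y /= h _.
by rewrite /Rintegral fineK//; exact: integrable_fin_num.
Qed.

Lemma cmeas_cintegral1 (f : T1 * T2 -> R[i]) : cmeas f ->
  cmeas (fun x => cintegral m2 setT (fun y => f (x, y))).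
Proof.
by move=> [f1 f2]; split => /=; [exact: (measurable_Rintegral1 f1)|
  exact: (measurable_Rintegral1 f2)].
Qed.

Lemma cfubini (f : T1 * T2 -> R[i]) : cmeas f ->
  (\int[m1]_x \int[m2]_y (l1n (f (x, y)))%:E < +oo)%E ->
  cintegral m1 setT (fun x => cintegral m2 setT (fun y => f (x, y))) =
  cintegral m2 setT (fun y => cintegral m1 setT (fun x => f (x, y))).
Proof.
move=> mf foo; have [f1 f2] := mf.
have key (h : T1 * T2 -> R) : measT h ->
    (forall z, `|h z| <= l1n (f z)) ->
    (\int[m1]_x \int[m2]_y (`|h (x, y)|)%:E < +oo)%E.
  move=> mh hf; apply: le_lt_trans foo.
  have mah : measT (fun z => (`|h z|)%:E).
    by apply/measurable_EFinP; exact: measurableT_comp.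
  have mlf : measT (fun z => (l1n (f z))%:E) by exact: measurable_El1n.
  apply: ge0_le_integral => //.
  - by move=> x _; apply: integral_ge0 => y _; rewrite lee_fin.
  - by apply: (measurable_fun_fubini_tonelli_F (fun z => (`|h z|)%:E)).
  - by apply: (measurable_fun_fubini_tonelli_F (fun z => (l1n (f z))%:E)) => // z;
      rewrite lee_fin l1n_ge0.
  move=> x _; apply: ge0_le_integral => //.
  - exact: (measurableT_comp mah (pair1_measurable x)).
  - exact: (measurableT_comp mlf (pair1_measurable x)).
  - by move=> y _; rewrite lee_fin.
rewrite /cintegral /=; congr (_ +i* _).
  by apply: (Rfubini f1); apply: (key _ f1) => z; exact: Re_le_l1n.
by apply: (Rfubini f2); apply: (key _ f2) => z; exact: Im_le_l1n.
Qed.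

Lemma cfubini_dominated (f : T1 * T2 -> R[i]) (g : T1 -> R) : cmeas f ->
  measT g -> (forall x, (\int[m2]_y (l1n (f (x, y)))%:E <= (g x)%:E)%E) ->
  (\int[m1]_x (g x)%:E < +oo)%E ->
  cintegral m1 setT (fun x => cintegral m2 setT (fun y => f (x, y))) =
  cintegral m2 setT (fun y => cintegral m1 setT (fun x => f (x, y))).
Proof.
move=> mf mg fg goo; apply: (cfubini mf); apply: le_lt_trans goo.
apply: ge0_le_integral => //.
- by move=> x _; apply: integral_ge0 => y _; rewrite lee_fin l1n_ge0.
- apply: (measurable_fun_fubini_tonelli_F (fun z => (l1n (f z))%:E)) => [|z].
    exact: measurable_El1n.
  by rewrite lee_fin l1n_ge0.
- exact/measurable_EFinP.
Qed.

End complex_fubini.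

(** * Lebesgue measure on R^d *)

Section euclidean_measurability.
Context {R : realType}.

Lemma measurable_tnth_fst d (T : measurableType d) n (i : 'I_n) :
  measT (fun z : Euc R n * T => tnth z.1 i).
Proof. exact: (measurableT_comp (measurable_tnth i) measurable_fst). Qed.
Lemma measurable_tnth_snd d (T : measurableType d) n (i : 'I_n) :
  measT (fun z : T * Euc R n => tnth z.2 i).
Proof. exact: (measurableT_comp (measurable_tnth i) measurable_snd). Qed.

Definition tadd n (x y : Euc R n) : Euc R n := [tuple tnth x i + tnth y i | i < n].
Definition tsub n (x y : Euc R n) : Euc R n := [tuple tnth x i - tnth y i | i < n].

Lemma taddK n (x y : Euc R n) : tsub (tadd x y) y = x.
Proof. by apply: eq_from_tnth => i; rewrite !tnth_mktuple addrK. Qed.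

Lemma measurable_tadd n :
  measT (fun z : Euc R n * Euc R n => tadd z.1 z.2).
Proof.
apply/measurable_fun_tnthP => i.
rewrite (_ : _ \o _ = fun z : Euc R n * Euc R n => tnth z.1 i + tnth z.2 i).
  by apply: measurable_funD; [exact: measurable_tnth_fst|exact: measurable_tnth_snd].
by apply/funext => z /=; rewrite tnth_mktuple.
Qed.
Lemma measurable_tsub n :
  measT (fun z : Euc R n * Euc R n => tsub z.1 z.2).
Proof.
apply/measurable_fun_tnthP => i.
rewrite (_ : _ \o _ = fun z : Euc R n * Euc R n => tnth z.1 i - tnth z.2 i).
  by apply: measurable_funB; [exact: measurable_tnth_fst|exact: measurable_tnth_snd].
by apply/funext => z /=; rewrite tnth_mktuple.
Qed.
Lemma measurable_taddr n (y : Euc R n) : measT (fun x => tadd x y).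
Proof. exact: (measurableT_comp (@measurable_tadd n) (pair2_measurable y)). Qed.

Lemma dotpDr n (x y z : Euc R n) : dotp x (tadd y z) = dotp x y + dotp x z.
Proof.
rewrite /dotp -big_split; apply: eq_bigr => i _ /=.
by rewrite tnth_mktuple mulrDr.
Qed.
Lemma dotpC n (x y : Euc R n) : dotp x y = dotp y x.
Proof. by apply: eq_bigr => i _; rewrite mulrC. Qed.

Lemma measurable_dotp n : measT (fun z : Euc R n * Euc R n => dotp z.1 z.2).
Proof.
apply: measurable_sum => i; apply: measurable_funM.
  exact: measurable_tnth_fst.
exact: measurable_tnth_snd.
Qed.
Lemma measurable_dotpr n (x : Euc R n) : measT (fun y => dotp x y).
Proof. exact: (measurableT_comp (@measurable_dotp n) (pair1_measurable x)). Qed.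

Lemma measurable_enorm n : measT (@enorm R n).
Proof.
apply: measurableT_comp => /=; last first.
  by apply: measurable_sum => i; apply: measurable_funM; exact: measurable_tnth.
by apply: continuous_measurable_fun; exact: sqrt_continuous.
Qed.
Lemma measurable_japanese n : measT (@japanese R n).
Proof.
apply: measurableT_comp => /=; last first.
  by apply: measurable_funD => //; apply: measurable_funX; exact: measurable_enorm.
by apply: continuous_measurable_fun; exact: sqrt_continuous.
Qed.
Lemma dotp_ge0 n (x : Euc R n) : 0 <= dotp x x.
Proof. by apply: sumr_ge0 => i _; rewrite -expr2 sqr_ge0. Qed.
Lemma enorm_ge0 n (x : Euc R n) : 0 <= enorm x. Proof. exact: sqrtr_ge0. Qed.
Lemma sqr_enorm n (x : Euc R n) : enorm x ^+ 2 = \sum_(i < n) tnth x i ^+ 2.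
Proof. by rewrite sqr_sqrtr ?dotp_ge0//; apply: eq_bigr => i _; rewrite expr2. Qed.
Lemma sqr_japanese n (x : Euc R n) : japanese x ^+ 2 = 1 + enorm x ^+ 2.
Proof. by rewrite sqr_sqrtr// addr_ge0// sqr_ge0. Qed.
Lemma japanese_ge1 n (x : Euc R n) : 1 <= japanese x.
Proof. by rewrite -[leLHS]sqrtr1 ler_sqrt ?addr_ge0 ?sqr_ge0// lerDl sqr_ge0. Qed.
Lemma japanese_gt0 n (x : Euc R n) : 0 < japanese x.
Proof. exact: lt_le_trans (japanese_ge1 x). Qed.
Lemma enorm_le_japanese n (x : Euc R n) : enorm x <= japanese x.
Proof.
rewrite -(@ler_pXn2r _ 2)// ?nnegrE ?enorm_ge0 ?(ltW (japanese_gt0 x))//.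
by rewrite sqr_japanese lerDr.
Qed.
Lemma coord_le_japanese n (x : Euc R n) (i : 'I_n) : `|tnth x i| <= japanese x.
Proof.
apply: le_trans (enorm_le_japanese x).
rewrite -(@ler_pXn2r _ 2)// ?nnegrE ?enorm_ge0// sqr_enorm real_normK ?num_real//.
by rewrite (bigD1 i)//= lerDl sumr_ge0// => j _; rewrite sqr_ge0.
Qed.
Lemma measurable_lambda n : measT (@lambda R n).
Proof.
apply: measurable_funM; first exact: measurable_enorm.
rewrite (_ : (fun x => _) = (fun x : Euc R n => japanese x `^ (-1))).
  apply: (measurableT_comp (f := fun x : R => x `^ (-1))) (measurable_japanese (n:=n)).
  exact: measurable_powR.
by apply/funext => x; rewrite powR_inv1// ltW// japanese_gt0.
Qed.
Lemma lambda_ge0 n (x : Euc R n) : 0 <= lambda x.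
Proof. by rewrite divr_ge0 ?enorm_ge0 ?(ltW (japanese_gt0 x)). Qed.
Lemma lambda_le1 n (x : Euc R n) : lambda x <= 1.
Proof. by rewrite ler_pdivrMr ?japanese_gt0// mul1r enorm_le_japanese. Qed.
End euclidean_measurability.

Section lebesgue_Rd.
Context {R : realType}.
Local Notation leb := (@lebesgue_measure R).

(** Since [lebesgue] is built by recursion on the dimension, facts about it are proved by induction:
    this lemma and its two signed versions peel off the first coordinate. *)
Lemma ge0_integral_cons n (f : Euc R n.+1 -> \bar R) : measT f ->
  (forall x, (0 <= f x)%E) ->
  (\int[lebesgue R n.+1]_z f z =
   \int[leb]_x \int[lebesgue R n]_y f (cons_pair (x, y)))%E.
Proof.
move=> mf f0.
have mc := @measurable_cons_pair R n.
transitivity (\int[pushforward (leb \x lebesgue R n)%E (@cons_pair R n)]_z f z)%E.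
  by [].
rewrite ge0_integral_pushforward//.
rewrite preimage_setT.
rewrite (fubini_tonelli1 (f \o @cons_pair R n))//; first exact: measurableT_comp.
by move=> x; exact: f0.
Qed.

Lemma Rintegral_cons n (f : Euc R n.+1 -> R) : measT f ->
  (lebesgue R n.+1).-integrable setT (fun z => (f z)%:E) ->
  \int[lebesgue R n.+1]_z f z =
  \int[leb]_x \int[lebesgue R n]_y f (cons_pair (x, y)).
Proof.
move=> mf If.
have mc := @measurable_cons_pair R n.
have mfc : measT (fun z => (f (@cons_pair R n z))%:E).
  by apply/measurable_EFinP; exact: measurableT_comp.
have Ifc : (leb \x lebesgue R n)%E.-integrable setT
    (fun z => (f (@cons_pair R n z))%:E).
  apply/integrable12ltyP => //.
  move/integrableP : If => [_].
  rewrite ge0_integral_cons//.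
  by apply: measurableT_comp => //; exact/measurable_EFinP.
rewrite /Rintegral; congr fine.
transitivity (\int[(leb \x lebesgue R n)%E]_z (f (@cons_pair R n z))%:E)%E.
  transitivity (\int[pushforward (leb \x lebesgue R n)%E (@cons_pair R n)]_z (f z)%:E)%E.
    by [].
  apply: integral_pushforward => //; first exact/measurable_EFinP.
rewrite -(integral12_prod_meas1 Ifc).
apply: ae_eq_integral => //.
- exact: (measurable_fubini_F Ifc).
- apply/measurable_EFinP; rewrite /Rintegral; apply: measurableT_comp => //.
  exact: (measurable_fubini_F Ifc).
have /integrable_ae := integrable_fubini_F Ifc.
move=> /(_ measurableT); apply: filterS => x /= h _.
by rewrite /Rintegral fineK//; exact: h.
Qed.

Lemma cintegral_cons n (f : Euc R n.+1 -> R[i]) :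
  cintegrable (lebesgue R n.+1) setT f ->
  cintegral (lebesgue R n.+1) setT f =
  cintegral leb setT (fun x => cintegral (lebesgue R n) setT
    (fun y => f (cons_pair (x, y)))).
Proof.
move=> cf; have [m1 m2] := cint_meas cf; have [i1 i2] := cf.
by rewrite /cintegral /= (Rintegral_cons m1)// (Rintegral_cons m2).
Qed.

(** By uniqueness of Lebesgue measure: the translated measure gives each interval its length. *)
Lemma lebesgue1_shift (a : R) (A : set (measurableTypeR R)) : measurable A ->
  leb ((fun x => x + a) @^-1` A) = leb A.
Proof.
move=> mA; have ms : measT (fun x : measurableTypeR R => (x + a : measurableTypeR R)).
  by apply: (@measurable_funD _ (measurableTypeR R) R) => //.
pose nu := pushforward leb (fun x : measurableTypeR R => (x + a : measurableTypeR R)).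
suff : leb A = nu A by move=> ->.
apply: lebesgue_measure_unique => //.
move=> X [[b c] _ <-].
transitivity (leb `]b - a, c - a]%classic); last first.
  rewrite /= /pushforward; congr (leb _).
  by apply/seteqP; split => x /=; rewrite !in_itv/= ltrBlDr lerBrDr.
rewrite /= !lebesgue_measure_itv/= !lte_fin ltrD2r; case: ifP => // _.
by rewrite -!EFinB opprB addrA subrK.
Qed.

Lemma ge0_integral1_shift (a : R) (f : measurableTypeR R -> \bar R) :
  measT f -> (forall x, (0 <= f x)%E) ->
  (\int[leb]_x f (x + a)%R = \int[leb]_x f x)%E.
Proof.
move=> mf f0.
have ms : measT (fun x : measurableTypeR R => (x + a : measurableTypeR R)).
  by apply: (@measurable_funD _ (measurableTypeR R) R) => //.
pose g (x : measurableTypeR R) : measurableTypeR R := x + a.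
transitivity (\int[pushforward leb g]_x f x)%E.
  rewrite ge0_integral_pushforward//.
apply: eq_measure_integral => A mA _; exact: lebesgue1_shift.
Qed.

Lemma ge0_integral_shift n (a : Euc R n) (f : Euc R n -> \bar R) :
  measT f -> (forall x, (0 <= f x)%E) ->
  (\int[lebesgue R n]_x f (tadd x a) = \int[lebesgue R n]_x f x)%E.
Proof.
elim: n a f => [|n IH] a f mf f0.
  by apply: eq_integral => x _; congr f; rewrite (tuple0 x) (tuple0 (tadd _ _)).
have mc := @measurable_cons_pair R n.
rewrite [LHS]ge0_integral_cons//; last first.
  exact: (measurableT_comp mf (measurable_taddr a)).
rewrite [RHS]ge0_integral_cons//.
pose a' : Euc R n := [tuple of behead a].
have E x y : tadd (cons_pair (x, y)) a = cons_pair (x + thead a, tadd y a').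
  apply: eq_from_tnth => i; rewrite tnth_mktuple.
  case: (unliftP ord0 i) => [j ->|->].
    by rewrite !tnthS tnth_mktuple {1}(tuple_eta a) tnthS.
  by rewrite /= !tnth0.
transitivity (\int[leb]_x \int[lebesgue R n]_y f (cons_pair ((x + thead a)%R, y)))%E.
  apply: eq_integral => x _.
  under eq_integral do rewrite E.
  apply: (IH a' (fun y => f (cons_pair ((x + thead a)%R, y)))) => //.
  by apply: (measurableT_comp mf); exact: (measurableT_comp mc (pair1_measurable _)).
apply: (@ge0_integral1_shift (thead a)
  (fun x => (\int[lebesgue R n]_y f (cons_pair (x, y)))%E)).
  apply: (measurable_fun_fubini_tonelli_F (fun z => f (@cons_pair R n z))) => //.
  exact: measurableT_comp.
by move=> x; exact: integral_ge0.
Qed.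

Lemma Rintegral_shift n (a : Euc R n) (f : Euc R n -> R) :
  measT f ->
  \int[lebesgue R n]_x f (tadd x a) = \int[lebesgue R n]_x f x.
Proof.
move=> mf; rewrite /Rintegral; congr fine.
have mEf : measT (fun x => (f x)%:E) by exact/measurable_EFinP.
rewrite integralE [RHS]integralE; congr (_ - _)%E.
  rewrite -(ge0_integral_shift a (measurable_funepos mEf)); last first.
    by move=> x; exact: funepos_ge0.
  by apply: eq_integral => x _; rewrite !funeposE.
rewrite -(ge0_integral_shift a (measurable_funeneg mEf)); last first.
  by move=> x; exact: funeneg_ge0.
by apply: eq_integral => x _; rewrite !funenegE.
Qed.

Lemma cintegral_shift n (a : Euc R n) (f : Euc R n -> R[i]) :
  cmeas f ->
  cintegral (lebesgue R n) setT (fun x => f (tadd x a)) =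
  cintegral (lebesgue R n) setT f.
Proof.
by move=> [f1 f2]; rewrite /cintegral (Rintegral_shift a f1) (Rintegral_shift a f2).
Qed.

Lemma ge0_integral_prod n (p : 'I_n -> R -> R) (m : 'I_n -> R) :
  (forall i, measT (p i)) -> (forall i x, 0 <= p i x) ->
  (forall i, \int[leb]_x (p i x)%:E = (m i)%:E)%E ->
  (\int[lebesgue R n]_x (\prod_(i < n) p i (tnth x i))%:E =
   (\prod_(i < n) m i)%:E)%E.
Proof.
elim: n p m => [|n IH] p m mp p0 pm.
  rewrite (_ : (fun x => _) = cst 1%E).
    by rewrite integral_cst//= diracT mule1 big_ord0.
  by apply/funext => x /=; rewrite big_ord0.
have mP k (q : 'I_k -> R -> R) : (forall i, measT (q i)) ->
    measT (fun x : Euc R k => (\prod_(i < k) q i (tnth x i))%:E).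
  move=> mq; apply/measurable_EFinP; apply: measurable_prod => i _.
  by apply: measurableT_comp (mq i) _; exact: measurable_tnth.
rewrite ge0_integral_cons//; [|exact: mP|by move=> x; rewrite lee_fin prodr_ge0].
have m0 i : 0 <= m i.
  by rewrite -lee_fin -pm integral_ge0// => x _; rewrite lee_fin.
transitivity (\int[leb]_x ((p ord0 x)%:E * (\prod_(i < n) m (lift ord0 i))%:E))%E.
  apply: eq_integral => x _.
  rewrite -(IH (fun i => p (lift ord0 i)))//.
  rewrite -ge0_integralZl_EFin//.
  - apply: eq_integral => y _; rewrite big_ord_recl EFinM /= tnth0.
    by congr (_ * (_)%:E)%E; apply: eq_bigr => i _; rewrite tnthS.
  - by move=> y _; rewrite lee_fin prodr_ge0.
  - exact: (mP n (fun i => p (lift ord0 i))).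
rewrite ge0_integralZr; first by rewrite pm -EFinM big_ord_recl.
all: rewrite ?lee_fin ?prodr_ge0//.
- by apply/measurable_EFinP; exact: mp.
- by move=> x _; rewrite lee_fin.
Qed.

Lemma l1n_prod n (F : 'I_n -> R[i]) : l1n (\prod_(i < n) F i) <= \prod_(i < n) l1n (F i).
Proof.
elim/big_ind2: _ => [|x1 x2 y1 y2 h1 h2|//].
  by rewrite /l1n /= normr1 normr0 addr0.
apply: le_trans (l1nM _ _) _.
by apply: ler_pM => //; exact: l1n_ge0.
Qed.

Lemma cmeas_prod n (c : 'I_n -> R -> R[i]) :
  (forall i, cmeas (c i)) ->
  cmeas (fun x : Euc R n => \prod_(i < n) c i (tnth x i)).
Proof.
move=> mc; elim: (index_enum _) => [|i s IH].
  by under eq_fun do rewrite big_nil; exact: cmeas_cst.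
under eq_fun do rewrite big_cons.
apply: cmeasM => //; apply: (cmeas_comp (h := fun x : Euc R n => tnth x i)) (mc i).
exact: measurable_tnth.
Qed.

Lemma cint_prod n (c : 'I_n -> R -> R[i]) :
  (forall i, cintegrable leb setT (c i)) ->
  cintegrable (lebesgue R n) setT (fun x => \prod_(i < n) c i (tnth x i)).
Proof.
move=> ic; have mc i := cint_meas (ic i).
have l1 i : (0 <= \int[leb]_x (l1n (c i x))%:E)%E.
  by apply: integral_ge0 => x _; rewrite lee_fin l1n_ge0.
apply: (@le_cintegrable _ _ _ _ _ (fun x : Euc R n => \prod_(i < n) l1n (c i (tnth x i)))).
- exact: cmeas_prod.
- apply: measurable_prod => i _.
  apply: (measurableT_comp (f := fun x => l1n (c i x))) (measurable_tnth i).
  exact: (measurable_l1n (mc i)).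
- by move=> x; exact: l1n_prod.
rewrite (ge0_integral_prod (p := fun i x => l1n (c i x))
  (m := fun i => fine (\int[leb]_x (l1n (c i x))%:E)%E)) ?ltry//.
- by move=> i; exact: (measurable_l1n (mc i)).
- by move=> i x; exact: l1n_ge0.
- by move=> i; rewrite fineK// ge0_fin_numE// cint_lty.
Qed.

Lemma cintegral_prod n (c : 'I_n -> R -> R[i]) :
  (forall i, cintegrable leb setT (c i)) ->
  cintegral (lebesgue R n) setT (fun x => \prod_(i < n) c i (tnth x i)) =
  \prod_(i < n) cintegral leb setT (c i).
Proof.
elim: n c => [|n IH] c ic.
  rewrite big_ord0 (_ : (fun x => _) = cst 1); last first.
    by apply/funext => x; rewrite big_ord0.
  by apply: complex_ext; rewrite /= Rintegral_cst//= ?mul0r// mul1r indicE in_setT.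
rewrite cintegral_cons; last exact: cint_prod.
rewrite big_ord_recl -IH; last by move=> i; exact: ic.
rewrite -cintegralMr//; apply: eq_cintegral => x _.
rewrite -cintegralMl; last exact: (@cint_prod _ (fun i => c (lift ord0 i))).
apply: eq_cintegral => y _; rewrite big_ord_recl /= tnth0; congr (_ * _).
by apply: eq_bigr => i _; rewrite tnthS.
Qed.

Lemma integral_oneDsqrV : (\int[leb]_x ((1 + x ^+ 2)^-1)%:E = (pi : R)%:E)%E.
Proof.
rewrite ge0_symfun_integralT//=.
- rewrite (_ : [set x | _] = `[0, +oo[%classic); last first.
    by apply/seteqP; split => x/=; rewrite in_itv/= andbT.
  under eq_integral do rewrite -[_ + _]/(oneDsqr _).
  by rewrite integral0y_oneDsqr -EFinM mulrCA divff// mulr1.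
- by move=> x; rewrite invr_ge0 addr_ge0// sqr_ge0.
- exact: continuous_oneDsqrV.
- by move=> x/=; rewrite sqrrN.
Qed.

(** An integrable weight that factors over the coordinates, of integral pi^n. It dominates
    [japanese] to the power - 2 n, since each 1 + x_i^2 is at most the square of [japanese x]: decay
    of order 2 n in [japanese] thus yields integrability without polar coordinates. *)
Definition cauchy_weight n (x : Euc R n) : R := \prod_(i < n) (1 + tnth x i ^+ 2)^-1.

Lemma cauchy_weight_ge0 n (x : Euc R n) : 0 <= cauchy_weight x.
Proof. by apply: prodr_ge0 => i _; rewrite invr_ge0 addr_ge0// sqr_ge0. Qed.

Lemma measurable_oneDsqrV : measT (fun x : R => (1 + x ^+ 2)^-1).
Proof. by apply: continuous_measurable_fun; exact: continuous_oneDsqrV. Qed.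

Lemma measurable_cauchy_weight n : measT (@cauchy_weight n).
Proof.
apply: measurable_prod => i _.
exact: (measurableT_comp measurable_oneDsqrV (measurable_tnth i)).
Qed.

Lemma integral_cauchy_weight n :
  (\int[lebesgue R n]_x (cauchy_weight x)%:E < +oo)%E.
Proof.
rewrite (ge0_integral_prod (p := fun _ x => (1 + x ^+ 2)^-1) (m := fun _ => pi)) ?ltry//.
- by move=> _; exact: measurable_oneDsqrV.
- by move=> _ x; rewrite invr_ge0 addr_ge0// sqr_ge0.
- by move=> _; exact: integral_oneDsqrV.
Qed.

Lemma japanese_cauchy_weight n (x : Euc R n) :
  1 <= japanese x ^+ (2 * n) * cauchy_weight x.
Proof.
rewrite /cauchy_weight prodfV exprM ler_pdivlMr ?mul1r; last first.
  by apply: prodr_gt0 => i _; rewrite ltr_pwDl// sqr_ge0.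
rewrite -[X in _ <= _ ^+ X]card_ord -prodr_const.
apply: ler_prod => i _; rewrite addr_ge0 ?sqr_ge0//= sqr_japanese lerD2l sqr_enorm.
by rewrite (bigD1 i)//= lerDl sumr_ge0// => j _; rewrite sqr_ge0.
Qed.
End lebesgue_Rd.

(** * Series and convolutions of bounded integrable functions *)

Section complex_series.
Context {R : realType}.
Implicit Types (c : nat -> R[i]) (K : nat -> R).

Definition sums_to c (l : R[i]) :=
  (fun n => l1n (\sum_(i < n) c i - l)) @ \oo --> (0 : R).

(** Total because [limn] is; the value means something only together with [sums_to]. *)
Definition csum c : R[i] :=
  limn (series (fun i => cRe (c i))) +i*
  limn (series (fun i => cIm (c i))).

Definition summable_le K (S : R) := forall N, \sum_(i < N) K i <= S.

Lemma l1n_squeeze0 (u : nat -> R[i]) (l : R[i]) (b : nat -> R) :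
  (forall n, l1n (u n - l) <= b n) -> b @ \oo --> (0 : R) ->
  (fun n => l1n (u n - l)) @ \oo --> (0 : R).
Proof.
move=> ub b0; apply: (@squeeze_cvgr _ _ _ _ (cst 0) b) => //; last exact: cvg_cst.
by apply: nearW => n; rewrite /= l1n_ge0 ub.
Qed.

Lemma sums_to_ReIm c l : sums_to c l ->
  series (fun i => cRe (c i)) @ \oo --> cRe l /\
  series (fun i => cIm (c i)) @ \oo --> cIm l.
Proof.
move=> cl.
have key (u : nat -> R) (a : R) :
    (forall n, `|\sum_(i < n) u i - a| <= l1n (\sum_(i < n) c i - l)) ->
    series u @ \oo --> a.
  move=> ul; apply/subr_cvg0; apply/norm_cvg0P.
  apply: (@squeeze_cvgr _ _ _ _ (cst 0) (fun n => l1n (\sum_(i < n) c i - l))) => //;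
    last exact: cvg_cst.
  by apply: nearW => n; rewrite /= normr_ge0/= /series/= big_mkord.
split; apply: key => n; first by rewrite -cRe_sum -cReB Re_le_l1n.
by rewrite -cIm_sum -cImB Im_le_l1n.
Qed.

Lemma ReIm_sums_to c l :
  series (fun i => cRe (c i)) @ \oo --> cRe l ->
  series (fun i => cIm (c i)) @ \oo --> cIm l -> sums_to c l.
Proof.
move=> h1 h2; rewrite /sums_to /l1n -[X in _ --> X](addr0 0).
apply: cvgD.
  under eq_fun do rewrite cReB cRe_sum -(big_mkord xpredT (fun i => cRe (c i))).
  by apply/norm_cvg0P; apply/subr_cvg0.
under eq_fun do rewrite cImB cIm_sum -(big_mkord xpredT (fun i => cIm (c i))).
by apply/norm_cvg0P; apply/subr_cvg0.
Qed.

Lemma sums_to_csum c l : sums_to c l -> csum c = l.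
Proof.
move=> /sums_to_ReIm[h1 h2]; apply: complex_ext => /=; exact: cvg_lim.
Qed.

Lemma sums_to_unique c l m : sums_to c l -> sums_to c m -> l = m.
Proof. by move=> /sums_to_csum <- /sums_to_csum. Qed.

Lemma real_series_cvg (u : nat -> R) K S : (forall n, `|u n| <= K n) ->
  summable_le K S -> cvgn (series u).
Proof.
move=> uK KS; have K0 n : 0 <= K n := le_trans (normr_ge0 (u n)) (uK n).
apply: normed_cvg; apply: (@series_le_cvg _ (fun n => `|u n|) K) => //.
apply: nondecreasing_is_cvgn.
  by apply: nondecreasing_series => i _ _.
by exists S => _ [n _ <-]; rewrite /series/= big_mkord; exact: KS.
Qed.

Lemma sums_to_dominated c K S : (forall n, l1n (c n) <= K n) ->
  summable_le K S -> sums_to c (csum c).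
Proof.
move=> cK KS; apply: ReIm_sums_to.
  apply: (@real_series_cvg _ K S) => // n; exact: le_trans (Re_le_l1n _) (cK n).
by apply: (@real_series_cvg _ K S) => // n; exact: le_trans (Im_le_l1n _) (cK n).
Qed.

Lemma sums_to_shift c l N : sums_to c l ->
  sums_to (fun i => c (N + i)%N) (l - \sum_(i < N) c i).
Proof.
move=> cl; rewrite /sums_to.
rewrite (_ : (fun n => _) = (fun n => l1n (\sum_(i < n + N) c i - l))).
  by rewrite (cvg_shiftn N (fun n => l1n (\sum_(i < n) c i - l)) (nbhs (0 : R))).
by apply/funext => n; rewrite addnC big_split_ord/= opprB addrA [X in X - l]addrC.
Qed.

Lemma sums_to_le c l K S : (forall n, l1n (c n) <= K n) ->
  summable_le K S -> sums_to c l -> l1n l <= S.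
Proof.
move=> cK KS cl; apply/ler_addgt0Pr => e e0.
move/cvgrPdist_lt : cl => /(_ e e0)[n _ /(_ n (leqnn n))].
rewrite sub0r normrN ger0_norm ?l1n_ge0// => h.
rewrite -(subKr (\sum_(i < n) c i) l) (le_trans (l1nB _ _))// lerD ?(ltW h)//.
by rewrite (le_trans (l1n_sum _ _ _))// (le_trans _ (KS n))// ler_sum.
Qed.

Lemma sums_to_tail c l K S N : (forall n, l1n (c n) <= K n) ->
  summable_le (fun i => K (N + i)%N) S -> sums_to c l ->
  l1n (l - \sum_(i < N) c i) <= S.
Proof.
move=> cK KS cl.
by apply: (@sums_to_le (fun i => c (N + i)%N) _ (fun i => K (N + i)%N)) => //;
  exact: sums_to_shift.
Qed.

Lemma sums_toD c c' l l' : sums_to c l -> sums_to c' l' ->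
  sums_to (fun i => c i + c' i) (l + l').
Proof.
move=> cl cl'.
apply: (@l1n_squeeze0 _ _ (fun n => l1n (\sum_(i < n) c i - l) + l1n (\sum_(i < n) c' i - l'))).
  move=> n; rewrite big_split/= opprD addrACA; exact: l1nD.
by rewrite -[X in _ --> X](addr0 0); exact: cvgD.
Qed.

Lemma sums_toMl (a : R[i]) c l : sums_to c l -> sums_to (fun i => a * c i) (a * l).
Proof.
move=> cl.
apply: (@l1n_squeeze0 _ _ (fun n => l1n a * l1n (\sum_(i < n) c i - l))).
  by move=> n; rewrite -mulr_sumr -mulrBr; exact: l1nM.
by rewrite -[X in _ --> X](mulr0 (l1n a)); apply: cvgM => //; exact: cvg_cst.
Qed.

Lemma sums_toB c c' l l' : sums_to c l -> sums_to c' l' ->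
  sums_to (fun i => c i - c' i) (l - l').
Proof.
move=> cl cl'; apply: sums_toD => //; rewrite -mulN1r.
rewrite (_ : (fun i => - c' i) = (fun i => -1 * c' i)); first exact: sums_toMl.
by apply/funext => i; rewrite mulN1r.
Qed.

Lemma sums_to_finite c N : (forall n, (N <= n)%N -> c n = 0) ->
  sums_to c (\sum_(i < N) c i).
Proof.
move=> c0; apply: cvg_near_cst; exists N => // n /= Nn.
rewrite -!(big_mkord xpredT c) (big_cat_nat (n := N))//= [X in _ + X - _]big1_seq ?addr0 ?subrr ?l1n0//.
by move=> i /andP[_]; rewrite mem_index_iota => /andP[/c0].
Qed.

(* Geometric majorants of ratio [1/4]: this ratio leaves room for the factor
   [N] in the remainder of a Cauchy product. *)
Definition q4 : R := 4^-1.

Lemma q4X n : 0 <= q4 ^+ n. Proof. by rewrite exprn_ge0// invr_ge0. Qed.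

Lemma summable_q4 (K : R) N : 0 <= K -> summable_le (fun i => K * q4 ^+ (N + i)) (2 * K * q4 ^+ N).
Proof.
move=> K0 M; rewrite -mulr_sumr mulrAC [leRHS]mulrC mulrCA [leLHS]mulrC.
suff : \sum_(i < M) q4 ^+ (N + i) <= 2 * q4 ^+ N.
  by move=> h; rewrite mulrC [leRHS]mulrCA [leRHS]mulrC mulrC ler_wpM2r// mulrC.
(* Subtracting 2 q4^M makes the bound inductive: the new term q4^M is at most 2 q4^M - 2 q4^(M+1),
   the ratio being below 1/2. *)
suff : \sum_(i < M) q4 ^+ i <= 2 - 2 * q4 ^+ M.
  move=> h; under eq_bigr do rewrite exprD.
  by rewrite -mulr_sumr mulrC ler_wpM2r ?q4X// (le_trans h)// lerBlDr lerDl mulr_ge0 ?q4X.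
elim: M => [|M IH]; first by rewrite big_ord0 expr0 mulr1 subrr.
rewrite big_ord_recr/= exprS; have := q4X M; rewrite /q4 in IH *; lra.
Qed.

Lemma natX4 n : n%:R * q4 ^+ n <= 2^-1 ^+ n :> R.
Proof.
have -> : q4 = 2^-1 * 2^-1 by rewrite /q4; lra.
rewrite exprMn mulrA ler_piMl ?exprn_ge0 ?invr_ge0//.
rewrite exprVn ler_pdivrMr ?exprn_gt0// mul1r -natrX ler_nat ltnW// ltn_expl//.
Qed.

Lemma cvg_half_expr (K : R) : (fun n => K * 2^-1 ^+ n) @ \oo --> (0 : R).
Proof. by apply: cvg_geometric; rewrite gtr0_norm ?invr_gt0// invf_lt1 ?ltr1n. Qed.

Lemma cvg_q4 (K : R) : (fun n => K * q4 ^+ n) @ \oo --> (0 : R).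
Proof. by apply: cvg_geometric; rewrite gtr0_norm ?invr_gt0// invf_lt1 ?ltr1n. Qed.

Lemma cauchy_product_partial c c' N :
  \sum_(n < N) \sum_(m < n.+1) c m * c' (n - m)%N =
  \sum_(i < N) c i * \sum_(j < N - i) c' j.
Proof.
elim: N => [|N IH]; first by rewrite !big_ord0.
rewrite big_ord_recr IH /= [RHS]big_ord_recr /= [X in _ + X]big_ord_recr/=.
rewrite subSnn big_ord1 subnn addrA; congr (_ + _).
rewrite -big_split/=; apply: eq_bigr => i _.
by rewrite subSn ?(ltnW (ltn_ord i))// big_ord_recr/= mulrDr.
Qed.

(** The n-th partial sum runs over a triangle. Its row i misses from [c i * l'] a tail of size
    q4^(n-i), and the factor [c i] contributes q4^i, so every row errs by O(q4^n). The n rows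
    together err by n q4^n, at most 2^-n. *)
Lemma cauchy_product c c' l l' (K K' : R) :
  (forall n, l1n (c n) <= K * q4 ^+ n) -> (forall n, l1n (c' n) <= K' * q4 ^+ n) ->
  sums_to c l -> sums_to c' l' ->
  sums_to (fun n => \sum_(m < n.+1) c m * c' (n - m)%N) (l * l').
Proof.
move=> cK cK' cl cl'.
have K0 : 0 <= K by have := cK 0%N; rewrite expr0 mulr1; apply: le_trans (l1n_ge0 _).
have K'0 : 0 <= K' by have := cK' 0%N; rewrite expr0 mulr1; apply: le_trans (l1n_ge0 _).
apply: (@l1n_squeeze0 _ _ (fun n => 2 * K * K' * 2^-1 ^+ n +
    l1n (\sum_(i < n) c i - l) * l1n l')); last first.
  rewrite -[X in _ --> X](addr0 0); apply: cvgD; first exact: cvg_half_expr.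
  by rewrite -[X in _ --> X](mul0r (l1n l')); apply: cvgM => //; exact: cvg_cst.
move=> n; rewrite cauchy_product_partial.
rewrite -(subrK ((\sum_(i < n) c i) * l') (\sum_(i < n) _)) -addrA -mulrBl.
apply: le_trans (l1nD _ _) _; apply: lerD; last exact: l1nM.
rewrite mulr_suml -sumrB.
apply: le_trans (l1n_sum _ _ _) _.
apply: (@le_trans _ _ (\sum_(i < n) 2 * K * K' * q4 ^+ n)).
  apply: ler_sum => i _; rewrite -mulrBr.
  apply: le_trans (l1nM _ _) _; rewrite [X in _ * X]l1nBC.
  apply: (@le_trans _ _ ((K * q4 ^+ i) * (2 * K' * q4 ^+ (n - i)))).
    apply: ler_pM; rewrite ?l1n_ge0//.
    by apply: (@sums_to_tail _ _ (fun n => K' * q4 ^+ n)) => //; exact: summable_q4.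
  rewrite le_eqVlt; apply/orP; left; apply/eqP.
  by rewrite -[in RHS](subnKC (ltnW (ltn_ord i))) exprD; ring.
rewrite sumr_const card_ord -[leLHS]mulr_natl mulrCA ler_wpM2l ?mulr_ge0//.
exact: natX4.
Qed.
End complex_series.

Lemma cmeas_sums_to d (T : measurableType d) (R : realType) (f : nat -> T -> R[i])
    (g : T -> R[i]) : (forall n, cmeas (f n)) ->
  (forall x, sums_to (fun n => f n x) (g x)) -> cmeas g.
Proof.
move=> mf fg.
have ms n : cmeas (fun x => \sum_(i < n) f i x) by exact: cmeas_sum.
split.
  apply: (measurable_fun_cvg (fun n => (ms n).1)) => x _.
  have [h _] := sums_to_ReIm (fg x).
  rewrite (_ : (fun n => _) = series (fun i => cRe (f i x)))//.
  by apply/funext => n; rewrite cRe_sum /series/= big_mkord.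
apply: (measurable_fun_cvg (fun n => (ms n).2)) => x _.
have [_ h] := sums_to_ReIm (fg x).
rewrite (_ : (fun n => _) = series (fun i => cIm (f i x)))//.
by apply/funext => n; rewrite cIm_sum /series/= big_mkord.
Qed.

(** * Bounded integrable functions under convolution, inverse Fourier transform and summation *)

Section nice_functions.
Context {R : realType} {d : nat}.
Local Notation E := (Euc R d).
Local Notation mu := (lebesgue R d).
Implicit Types (f g : E -> R[i]) (K L : R).

(* Bounded and integrable functions: each convolution and each power series in
   time then converges at every frequency, not only almost everywhere. *)
Definition nice K f := [/\ cmeas f, forall x, l1n (f x) <= K &
  (\int[mu]_x (l1n (f x))%:E <= K%:E)%E].

Lemma nice_meas K f : nice K f -> cmeas f. Proof. by case. Qed.
Lemma nice_sup K f : nice K f -> forall x, l1n (f x) <= K. Proof. by case. Qed.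
Lemma nice_L1 K f : nice K f -> (\int[mu]_x (l1n (f x))%:E <= K%:E)%E.
Proof. by case. Qed.
Lemma nice_ge0 K f : nice K f -> 0 <= K.
Proof. by case=> _ + _ => /(_ point); apply: le_trans; exact: l1n_ge0. Qed.
Lemma nice_int K f : nice K f -> cintegrable mu setT f.
Proof.
by move=> [mf _ f1]; apply: cintegrable_l1n => //; rewrite (le_lt_trans f1)// ltry.
Qed.

Lemma nice_dominated K (g : E -> R) f : cmeas f -> measT g ->
  (forall x, l1n (f x) <= g x) -> (forall x, g x <= K) ->
  (\int[mu]_x (g x)%:E <= K%:E)%E -> nice K f.
Proof.
move=> mf mg fg gK gK1; split => //.
  by move=> x; rewrite (le_trans (fg x)).
apply: le_trans gK1; apply: le_integral_ge0 => //; first exact: measurable_l1n.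
by move=> x; exact: l1n_ge0.
Qed.

Lemma nice_le K L f : nice K f -> K <= L -> nice L f.
Proof.
move=> [mf f0 f1] KL; split => //; first by move=> x; exact: le_trans KL.
by apply: le_trans f1 _; rewrite lee_fin.
Qed.

Lemma eq_nice K f g : (forall x, f x = g x) -> nice K f -> nice K g.
Proof. by move=> /funext ->. Qed.

Lemma nice0 : nice 0 (fun _ => 0).
Proof.
split; [exact: cmeas_cst|by move=> x; rewrite l1n0|].
by under eq_integral do rewrite l1n0; rewrite integral0.
Qed.

Lemma niceD K L f g : nice K f -> nice L g -> nice (K + L) (fun x => f x + g x).
Proof.
move=> [mf f0 f1] [mg g0 g1].
apply: (@nice_dominated _ (fun x => l1n (f x) + l1n (g x))).
- exact: cmeasD.
- by apply: measurable_funD; exact: measurable_l1n.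
- by move=> x; exact: l1nD.
- by move=> x; exact: lerD.
under eq_integral do rewrite EFinD.
rewrite ge0_integralD//.
- by rewrite EFinD leeD.
- by move=> x _; rewrite lee_fin l1n_ge0.
- exact: measurable_El1n.
- by move=> x _; rewrite lee_fin l1n_ge0.
- exact: measurable_El1n.
Qed.

Lemma niceN K f : nice K f -> nice K (fun x => - f x).
Proof.
move=> [mf f0 f1]; split; first exact: cmeasN.
  by move=> x; rewrite l1nN.
by under eq_integral do rewrite l1nN.
Qed.

Lemma niceB K L f g : nice K f -> nice L g -> nice (K + L) (fun x => f x - g x).
Proof. by move=> nf ng; apply: niceD => //; exact: niceN. Qed.

Lemma nice_sum I (r : seq I) (P : pred I) (K : I -> R) (F : I -> E -> R[i]) :
  (forall i, P i -> nice (K i) (F i)) ->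
  nice (\sum_(i <- r | P i) K i) (fun x => \sum_(i <- r | P i) F i x).
Proof.
move=> nF; elim: r => [|i r IH].
  by rewrite big_nil; apply: eq_nice nice0 => x; rewrite big_nil.
rewrite big_cons; case: ifPn => Pi; last first.
  by apply: eq_nice IH => x; rewrite big_cons (negbTE Pi).
apply: (@eq_nice _ (fun x => F i x + \sum_(i <- r | P i) F i x)).
  by move=> x; rewrite big_cons Pi.
by apply: niceD => //; exact: nF.
Qed.

Lemma niceMc (h : E -> R[i]) c K f : cmeas h -> (forall x, l1n (h x) <= c) ->
  nice K f -> nice (c * K) (fun x => h x * f x).
Proof.
move=> mh hc [mf f0 f1].
have c0 : 0 <= c by apply: le_trans (hc point); exact: l1n_ge0.
apply: (@nice_dominated _ (fun x => c * l1n (f x))).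
- exact: cmeasM.
- by apply: measurable_funM => //; exact: measurable_l1n.
- by move=> x; apply: le_trans (l1nM _ _) _; rewrite ler_wpM2r// l1n_ge0.
- by move=> x; exact: ler_wpM2l.
by rewrite integral_l1nZ// EFinM lee_wpmul2l// lee_fin.
Qed.

Lemma niceMr (m : E -> R) c K f : measT m -> (forall x, `|m x| <= c) ->
  nice K f -> nice (c * K) (fun x => (m x)%:C * f x).
Proof.
move=> mm mc; apply: niceMc; first exact: cmeas_real.
by move=> x; rewrite /l1n /= normr0 addr0.
Qed.

Lemma niceZ (a : R) K f : nice K f -> nice (`|a| * K) (fun x => a%:C * f x).
Proof. by apply: (@niceMr (fun _ => a)) => //; exact: measurable_cst. Qed.

Definition fconv f g (xi : E) : R[i] :=
  cintegral mu setT (fun eta => f (tsub xi eta) * g eta).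

Lemma cmeas_conv_kernel f g : cmeas f -> cmeas g ->
  cmeas (fun z : E * E => f (tsub z.1 z.2) * g z.2).
Proof.
move=> mf mg; apply: cmeasM.
  exact: (cmeas_comp (@measurable_tsub R d) mf).
exact: (cmeas_comp measurable_snd mg).
Qed.

Lemma measurable_conv_kernel f g : cmeas f -> cmeas g ->
  measT (fun z : E * E => l1n (f (tsub z.1 z.2)) * l1n (g z.2)).
Proof.
move=> mf mg; apply: measurable_funM.
  apply: (measurable_l1n (f := fun z : E * E => f (tsub z.1 z.2))).
  exact: (cmeas_comp (@measurable_tsub R d) mf).
apply: (measurable_l1n (f := fun z : E * E => g z.2)).
exact: (cmeas_comp measurable_snd mg).
Qed.

Lemma cmeas_conv f g : cmeas f -> cmeas g ->
  cmeas (fconv f g).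
Proof.
by move=> mf mg; have := cmeas_cintegral1 mu (cmeas_conv_kernel mf mg).
Qed.

Lemma cmeas_shift f (xi : E) : cmeas f ->
  cmeas (fun eta => f (tsub xi eta)).
Proof.
move=> mf; apply: (cmeas_comp (h := fun eta => tsub xi eta)) mf.
exact: (measurableT_comp (@measurable_tsub R d) (pair1_measurable xi)).
Qed.

Lemma cint_conv K L f g (xi : E) : nice K f -> nice L g ->
  cintegrable mu setT (fun eta => f (tsub xi eta) * g eta).
Proof.
move=> nf ng; apply: (@cintM_bounded _ _ _ _ _ _ K).
- exact: cmeas_shift (nice_meas nf).
- by move=> x; exact: nice_sup nf _.
- exact: nice_int ng.
Qed.

Lemma ge0_integral_tsub (h : E -> \bar R) (eta : E) : measT h ->
  (forall x, (0 <= h x)%E) ->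
  (\int[mu]_x h (tsub x eta) = \int[mu]_x h x)%E.
Proof.
move=> mh h0; rewrite -(ge0_integral_shift eta (f := fun x => h (tsub x eta)))//.
  by apply: eq_integral => x _; rewrite taddK.
apply: (measurableT_comp mh).
exact: (measurableT_comp (@measurable_tsub R d) (pair2_measurable eta)).
Qed.

Lemma integral_conv_kernel K L f g : nice K f -> nice L g ->
  (\int[mu]_xi \int[mu]_eta (l1n (f (tsub xi eta)) * l1n (g eta))%:E <= (K * L)%:E)%E.
Proof.
move=> nf ng; have [mf f0 f1] := nf; have [mg g0 g1] := ng.
have mk : measT (fun z : E * E => (l1n (f (tsub z.1 z.2)) * l1n (g z.2))%:E).
  by apply/measurable_EFinP; exact: measurable_conv_kernel.
rewrite (fubini_tonelli (fun z : E * E => (l1n (f (tsub z.1 z.2)) * l1n (g z.2))%:E))//; last first.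
  by move=> z; rewrite lee_fin mulr_ge0 ?l1n_ge0.
rewrite /=.
have K0 := nice_ge0 nf.
apply: (@le_trans _ _ (\int[mu]_eta (K * l1n (g eta))%:E)%E).
  apply: ge0_le_integral => //.
  - by move=> eta _; apply: integral_ge0 => x _; rewrite lee_fin mulr_ge0 ?l1n_ge0.
  - apply: (measurable_fun_fubini_tonelli_G
      (fun z : E * E => (l1n (f (tsub z.1 z.2)) * l1n (g z.2))%:E)) => //.
    by move=> z; rewrite lee_fin mulr_ge0 ?l1n_ge0.
  - by apply/measurable_EFinP; apply: measurable_funM => //; exact: measurable_l1n.
  move=> eta _; under eq_integral do rewrite EFinM.
  rewrite ge0_integralZr//.
  - rewrite (ge0_integral_tsub (h := fun x => (l1n (f x))%:E))//.
    + by rewrite EFinM lee_wpmul2r// lee_fin l1n_ge0.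
    + exact: measurable_El1n.
    + by move=> x; rewrite lee_fin l1n_ge0.
  - apply: (measurable_El1n (f := fun x => f (tsub x eta))).
    apply: (cmeas_comp (h := fun x => tsub x eta)) mf.
    exact: (measurableT_comp (@measurable_tsub R d) (pair2_measurable eta)).
  - by move=> x _; rewrite lee_fin l1n_ge0.
  - by rewrite lee_fin l1n_ge0.
by rewrite integral_l1nZ// EFinM lee_wpmul2l// lee_fin.
Qed.

(** The sup bound pairs the sup of [f] with the integral of [g]; the integral bound is Young's
    inequality, by Tonelli. Having one constant for both norms makes these constants multiply under
    convolution. *)
Lemma nice_conv K L f g : nice K f -> nice L g -> nice (K * L) (fconv f g).
Proof.
move=> nf ng; have [mf f0 f1] := nf; have [mg g0 g1] := ng.
have K0 := nice_ge0 nf.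
have mk xi : measT (fun eta => (l1n (f (tsub xi eta)) * l1n (g eta))%:E).
  apply/measurable_EFinP; apply: measurable_funM; last exact: measurable_l1n.
  exact: (measurable_l1n (cmeas_shift xi mf)).
have bnd xi : ((l1n (fconv f g xi))%:E <=
    \int[mu]_eta (l1n (f (tsub xi eta)) * l1n (g eta))%:E)%E.
  apply: le_trans (l1n_cintegral_le _ _) _.
    by apply: cmeasM => //; exact: cmeas_shift.
  apply: le_integral_ge0.
  - by apply: measurable_l1n; apply: cmeasM => //; exact: cmeas_shift.
  - by apply/measurable_EFinP; exact: (mk xi).
  - by move=> x; exact: l1n_ge0.
  - by move=> x; exact: l1nM.
split; first exact: cmeas_conv.
  move=> xi; rewrite -lee_fin; apply: le_trans (bnd xi) _.
  apply: (@le_trans _ _ (\int[mu]_eta (K * l1n (g eta))%:E)%E).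
    apply: le_integral_ge0.
    - by apply/measurable_EFinP; exact: (mk xi).
    - by apply: measurable_funM => //; exact: measurable_l1n.
    - by move=> x; rewrite mulr_ge0 ?l1n_ge0.
    - by move=> x; rewrite ler_wpM2r ?l1n_ge0.
  by rewrite integral_l1nZ// EFinM lee_wpmul2l// lee_fin.
apply: le_trans (integral_conv_kernel nf ng).
apply: ge0_le_integral => //.
- by move=> x _; rewrite lee_fin l1n_ge0.
- by apply: measurable_El1n; exact: cmeas_conv.
- apply: (measurable_fun_fubini_tonelli_F
      (fun z : E * E => (l1n (f (tsub z.1 z.2)) * l1n (g z.2))%:E)) => //.
    by apply/measurable_EFinP; exact: measurable_conv_kernel.
  by move=> z; rewrite lee_fin mulr_ge0 ?l1n_ge0.
Qed.

Lemma fconvBl K K' L f f' g : nice K f -> nice K' f' -> nice L g ->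
  forall xi, fconv (fun x => f x - f' x) g xi = fconv f g xi - fconv f' g xi.
Proof.
move=> nf nf' ng xi; rewrite /fconv -cintegralB.
- by apply: eq_cintegral => x _; rewrite mulrBl.
- exact: cint_conv nf ng.
- exact: cint_conv nf' ng.
Qed.
Lemma fconvBr K L L' f g g' : nice K f -> nice L g -> nice L' g' ->
  forall xi, fconv f (fun x => g x - g' x) xi = fconv f g xi - fconv f g' xi.
Proof.
move=> nf ng ng' xi; rewrite /fconv -cintegralB.
- by apply: eq_cintegral => x _; rewrite mulrBr.
- exact: cint_conv nf ng.
- exact: cint_conv nf ng'.
Qed.

Lemma cmeas_wave (x : E) : cmeas (fun xi => cexpi (dotp x xi)).
Proof. by apply: cmeas_cexpi; exact: measurable_dotpr. Qed.

Lemma cint_wave (x : E) f : cintegrable mu setT f ->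
  cintegrable mu setT (fun xi => cexpi (dotp x xi) * f xi).
Proof.
move=> cf; apply: (@cintM_bounded _ _ _ _ _ _ 2) => //; first exact: cmeas_wave.
by move=> xi; exact: l1n_cexpi.
Qed.

Lemma inv_fourierD f g x : cintegrable mu setT f -> cintegrable mu setT g ->
  inv_fourier (fun xi => f xi + g xi) x = inv_fourier f x + inv_fourier g x.
Proof.
move=> cf cg; rewrite /inv_fourier -cintegralD; [|exact: cint_wave..].
by apply: eq_cintegral => xi _; rewrite mulrDr.
Qed.
Lemma inv_fourierB f g x : cintegrable mu setT f -> cintegrable mu setT g ->
  inv_fourier (fun xi => f xi - g xi) x = inv_fourier f x - inv_fourier g x.
Proof.
move=> cf cg; rewrite /inv_fourier -cintegralB; [|exact: cint_wave..].
by apply: eq_cintegral => xi _; rewrite mulrBr.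
Qed.
Lemma inv_fourierZ (a : R[i]) f x : cintegrable mu setT f ->
  inv_fourier (fun xi => a * f xi) x = a * inv_fourier f x.
Proof.
move=> cf; rewrite /inv_fourier -cintegralMl; last exact: cint_wave.
by apply: eq_cintegral => xi _; rewrite mulrCA.
Qed.
Lemma inv_fourier_sum I (r : seq I) (P : pred I) (F : I -> E -> R[i]) x :
  (forall i, P i -> cintegrable mu setT (F i)) ->
  inv_fourier (fun xi => \sum_(i <- r | P i) F i xi) x =
  \sum_(i <- r | P i) inv_fourier (F i) x.
Proof.
move=> cF; rewrite /inv_fourier -cintegral_sum; last first.
  by move=> i Pi; apply: cint_wave; exact: cF.
by apply: eq_cintegral => xi _; rewrite mulr_sumr.
Qed.

Lemma l1n_inv_fourier K f x : nice K f -> l1n (inv_fourier f x) <= 2 * K.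
Proof.
move=> nf; have := niceMc (cmeas_wave x) (fun xi => l1n_cexpi (dotp x xi)) nf.
by case=> mh _; exact: l1n_cintegral_bound.
Qed.

(** Translate xi by eta and split the exponential of the sum. As [inv_fourier] carries no
    normalising factor, no power of 2 pi appears. *)
Lemma inv_fourier_conv K L f g x : nice K f -> nice L g ->
  inv_fourier (fconv f g) x = inv_fourier f x * inv_fourier g x.
Proof.
move=> nf ng; have [mf f0 f1] := nf; have [mg _ _] := ng.
pose k (z : E * E) := cexpi (dotp x z.1) * (f (tsub z.1 z.2) * g z.2).
have mk : cmeas k.
  apply: cmeasM; last exact: cmeas_conv_kernel.
  exact: (cmeas_comp measurable_fst (cmeas_wave x)).
transitivity (cintegral mu setT (fun xi => cintegral mu setT (fun eta => k (xi, eta)))).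
  apply: eq_cintegral => xi _; rewrite /k -cintegralMl//.
  exact: cint_conv nf ng.
(* Fubini is used with the variables swapped: integrating in xi first leaves a multiple of
   [l1n (g eta)], which is integrable. *)
rewrite -(cfubini_dominated (f := fun z => k (z.2, z.1)) (g := fun eta => 2 * K * l1n (g eta))).
- transitivity (cintegral mu setT (fun eta => inv_fourier f x * (cexpi (dotp x eta) * g eta))).
    apply: eq_cintegral => eta _.
    rewrite -(cintegral_shift eta); last exact: (cmeas_comp (pair2_measurable eta) mk).
    rewrite -cintegralMr; last by apply: cint_wave; exact: nice_int nf.
    apply: eq_cintegral => xi _.
    by rewrite /k /= taddK dotpDr cexpiD; ring.
  by rewrite cintegralMl//; apply: cint_wave; exact: nice_int ng.
- by apply: (cmeas_comp (h := fun z : E * E => (z.2, z.1)) _ mk); exact: measurable_swap.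
- by apply: measurable_funM => //; exact: measurable_l1n.
- move=> eta; rewrite /=.
  have nfs : nice K (fun xi => f (tsub xi eta)).
    have mfs := cmeas_comp (measurableT_comp (@measurable_tsub R d) (pair2_measurable eta)) mf.
    split => //; rewrite (ge0_integral_tsub (h := fun x => (l1n (f x))%:E))//.
      exact: measurable_El1n.
    by move=> x'; rewrite lee_fin l1n_ge0.
  have ngf := niceMc (cmeas_cst _ (g eta)) (fun=> lexx _) nfs.
  rewrite mulrAC -mulrA.
  apply: le_trans (nice_L1 (niceMc (cmeas_wave x) (fun xi => l1n_cexpi (dotp x xi)) ngf)).
  by under [leRHS]eq_integral do rewrite [g eta * _]mulrC.
have K20 : 0 <= 2 * K by rewrite mulr_ge0// (nice_ge0 nf).
rewrite integral_l1nZ//; apply: lte_mul_pinfty; rewrite ?lee_fin//.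
exact: cint_lty (nice_int ng).
Qed.

(** The sum converges at every frequency because the sup bounds are summable. The integral bound is
    the pointwise triangle inequality followed by monotone convergence. *)
Lemma nice_csum (K : nat -> R) S (f : nat -> E -> R[i]) :
  (forall n, nice (K n) (f n)) -> summable_le K S ->
  nice S (fun xi => csum (fun n => f n xi)).
Proof.
move=> nf KS.
have sums xi : sums_to (fun n => f n xi) (csum (fun n => f n xi)).
  by apply: (@sums_to_dominated _ _ K S) => // n; exact: nice_sup (nf n) _.
have ms : cmeas (fun xi => csum (fun n => f n xi)).
  by apply: cmeas_sums_to sums => n; exact: nice_meas (nf n).
split => //.
  by move=> xi; apply: (sums_to_le _ KS) (sums xi) => n; exact: nice_sup (nf n) _.
have mf n : measT (fun xi => (l1n (f n xi))%:E).
  by apply: measurable_El1n; exact: nice_meas (nf n).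
have f0 n xi : (0 <= (l1n (f n xi))%:E)%E by rewrite lee_fin l1n_ge0.
apply: (@le_trans _ _ (\int[mu]_xi \sum_(n <oo) (l1n (f n xi))%:E)%E).
  apply: ge0_le_integral => //.
  - by move=> xi _; rewrite lee_fin l1n_ge0.
  - exact: measurable_El1n.
  - exact: ge0_emeasurable_sum.
  move=> xi _.
  have [E0|] := eqVneq (\sum_(n <oo) (l1n (f n xi))%:E)%E +oo%E; first by rewrite E0 leey.
  move=> Efin.
  have h0 : (0 <= \sum_(n <oo) (l1n (f n xi))%:E)%E by exact: nneseries_ge0.
  have Ef : (\sum_(n <oo) (l1n (f n xi))%:E)%E \is a fin_num.
    by rewrite ge0_fin_numE// ltey.
  rewrite -(fineK Ef) lee_fin.
  apply: (@sums_to_le _ _ _ (fun n => l1n (f n xi))) (sums xi) => // N.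
  rewrite -lee_fin fineK// -sumEFin.
  rewrite -(big_mkord xpredT (fun n => (l1n (f n xi))%:E)).
  exact: nneseries_lim_ge.
rewrite integral_nneseries//.
apply: lime_le.
  by apply: is_cvg_nneseries => n _ _; exact: integral_ge0.
apply: nearW => N; rewrite big_mkord.
apply: (@le_trans _ _ (\sum_(i < N) (K i)%:E)%E).
  by apply: lee_sum => i _; exact: nice_L1 (nf i).
by rewrite sumEFin lee_fin.
Qed.

Lemma nice_csum_tail (K : nat -> R) S S' N (f : nat -> E -> R[i]) :
  (forall n, nice (K n) (f n)) -> summable_le K S ->
  summable_le (fun i => K (N + i)%N) S' ->
  nice S' (fun xi => csum (fun n => f n xi) - \sum_(i < N) f i xi).
Proof.
move=> nf KS KS'.
have nt := @nice_csum (fun i => K (N + i)%N) S' (fun i => f (N + i)%N)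
  (fun i => nf (N + i)%N) KS'.
apply: eq_nice nt => xi; apply: sums_to_csum.
apply: (@sums_to_shift _ (fun n => f n xi)).
by apply: (@sums_to_dominated _ _ K S) => // n; exact: nice_sup (nf n) _.
Qed.

Lemma inv_fourier_csum (K : R) (f : nat -> E -> R[i]) x :
  (forall n, nice (K * q4 ^+ n) (f n)) ->
  sums_to (fun n => inv_fourier (f n) x) (inv_fourier (fun xi => csum (fun n => f n xi)) x).
Proof.
move=> nf.
have K0 : 0 <= K by have := nice_ge0 (nf 0%N); rewrite expr0 mulr1.
have S0 : summable_le (fun n => K * q4 ^+ n) (2 * K).
  by move=> N; have := summable_q4 0 K0 N; rewrite expr0 mulr1.
have nF := nice_csum nf S0.
apply: (@l1n_squeeze0 _ _ _ (fun N => 2 * (2 * K) * q4 ^+ N)); last exact: cvg_q4.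
move=> N; rewrite l1nBC -inv_fourier_sum; last by move=> i _; exact: nice_int (nf i).
rewrite -inv_fourierB; [|exact: nice_int nF|].
  rewrite -mulrA; apply: l1n_inv_fourier.
  exact: (nice_csum_tail nf S0 (summable_q4 N K0)).
by apply: cint_sum => i _; exact: nice_int (nf i).
Qed.

End nice_functions.

(** * Solutions as power series in time *)

Section weights.
Context {R : realType}.

(** This weight is stable under discrete convolution up to the factor 8, so Cauchy products of
    coefficients bounded by rho^n [wt n] obey the same kind of bound instead of losing a factor n +
    1 each time. It also pays for two derivatives in time. *)
Definition wt (n : nat) : R := (n.+1%:R ^+ 2)^-1.

Lemma wt_gt0 n : 0 < wt n. Proof. by rewrite invr_gt0 exprn_gt0. Qed.
Lemma wt_ge0 n : 0 <= wt n. Proof. exact: ltW (wt_gt0 n). Qed.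
Lemma wt_le1 n : wt n <= 1.
Proof. by rewrite invf_le1 ?exprn_gt0// exprn_ege1// ler1n. Qed.

Lemma sum_wt n : \sum_(i < n) wt i <= 2.
Proof.
case: n => [|n]; first by rewrite big_ord0.
(* Telescoping: with x = n + 1, 1 / (x + 1)^2 is at most 1 / x - 1 / (x + 1). *)
suff : \sum_(i < n.+1) wt i <= 2 - n.+1%:R^-1.
  by move/le_trans; apply; rewrite lerBlDr lerDl.
elim: n => [|n IH]; first by rewrite big_ord1 /wt expr1n invr1; lra.
rewrite big_ord_recr/=; apply: le_trans (lerD IH (lexx _)) _.
have n0 : (0 : R) < n.+1%:R by [].
rewrite /wt -[n.+2%:R]natr1; move: (n.+1%:R) n0 => x x0.
suff : ((x + 1) ^+ 2)^-1 <= x^-1 - (x + 1)^-1 by lra.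
rewrite (_ : x^-1 - (x + 1)^-1 = (x * (x + 1))^-1); last by field; lra.
by rewrite lef_pV2 ?posrE ?mulr_gt0 ?exprn_gt0//; nra.
Qed.

(** With a + b = n + 2, the inequality (a + b)^2 <= 2 (a^2 + b^2) bounds 1 / (a^2 b^2) by 2 / (n +
    2)^2 times 1 / a^2 + 1 / b^2. Each of the two resulting sums is at most 2, whence 8 = 2 (2 +
    2). *)
Lemma wt_conv n : \sum_(m < n.+1) wt m * wt (n - m)%N <= 8 * wt n.
Proof.
apply: (@le_trans _ _ (\sum_(m < n.+1) 2 * wt n.+1 * (wt m + wt (n - m)%N))).
  apply: ler_sum => m _.
  have : (m.+1%:R + (n - m).+1%:R = n.+2%:R :> R).
    by rewrite -natrD addSn addnS subnKC// -ltnS.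
  have : (0 : R) < m.+1%:R by [].
  have : (0 : R) < (n - m).+1%:R by [].
  rewrite /wt; move: (m.+1%:R) ((n - m).+1%:R) => a b b0 a0 <-.
  rewrite (_ : _ * (_ + _) = 2 * (a ^+ 2 + b ^+ 2) / (a + b) ^+ 2 * ((a ^+ 2)^-1 * (b ^+ 2)^-1)); last first.
    by field; lra.
  rewrite ler_peMl ?mulr_ge0 ?invr_ge0 ?sqr_ge0//.
  rewrite ler_pdivlMr ?exprn_gt0 ?addr_gt0//.
  have := sqr_ge0 (a - b); nra.
rewrite -mulr_sumr big_split/= (reindex_inj rev_ord_inj)/=.
under eq_bigr => i _ do rewrite subSS.
rewrite -mulr2n -[_ *+ 2]mulr_natl.
have S2 : \sum_(i < n.+1) wt (n - i)%N <= 2.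
  have := sum_wt n.+1; rewrite (reindex_inj rev_ord_inj)/=.
  by under eq_bigr => i _ do rewrite subSS.
have w1 : wt n.+1 <= wt n.
  by rewrite lef_pV2 ?posrE ?exprn_gt0// lerXn2r ?nnegrE// ler_nat.
have := wt_ge0 n.+1; move: (\sum_(i < n.+1) wt (n - i)%N) S2 => S S2; nra.
Qed.

End weights.

(** * The Duhamel formula at one frequency *)

Section scalar_duhamel.
Context {R : realType}.
Implicit Types (p q : nat -> R).

Lemma lim_pseries0 (c : nat -> R) : limn (pseries c 0) = c 0%N.
Proof.
apply/cvg_lim => //; apply: cvg_near_cst; exists 1%N => // n /= n1.
rewrite /pseries /series/= -(subnK n1) addnC big_mkord big_split_ord/=.
rewrite [X in _ + X]big1 ?addr0; last by move=> i _; rewrite add1n expr0n mulr0.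
by rewrite big_ord_recl big_ord0 /= expr0 mulr1 addr0.
Qed.

Lemma is_cvg_pseries_q4 (c : nat -> R) (B rho : R) : 0 < rho ->
  (forall n, `|c n| <= B * rho ^+ n) -> cvgn (pseries c ((4 * rho)^-1)).
Proof.
move=> rho0 cB; have B0 : 0 <= B by have := cB 0%N; rewrite expr0 mulr1; apply: le_trans.
apply: (@real_series_cvg _ _ (fun n => B * q4 ^+ n) (2 * B)).
  move=> n; rewrite normrM normrX [X in _ * X ^+ _ <= _]gtr0_norm ?invr_gt0 ?mulr_gt0//.
  rewrite (_ : B * q4 ^+ n = B * rho ^+ n * (4 * rho)^-1 ^+ n).
    by rewrite ler_wpM2r// exprn_ge0// invr_ge0 mulr_ge0// ltW.
  rewrite -mulrA -exprMn; congr (_ * _ ^+ _); rewrite /q4; field; lra.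
by move=> N; have := summable_q4 0 B0 N; rewrite expr0 mulr1.
Qed.

(** Formal differentiation costs the factors n + 1 and then (n + 1)(n + 2); the weights at n + 1 and
    n + 2 absorb them, so the ratio rho does not deteriorate. *)
Lemma pseries_diffs_bound (c : nat -> R) (B rho : R) : 0 < rho -> 0 <= B ->
  (forall n, `|c n| <= B * rho ^+ n * wt n) ->
  [/\ forall n, `|c n| <= B * rho ^+ n,
      forall n, `|pseries_diffs c n| <= B * rho * rho ^+ n &
      forall n, `|pseries_diffs (pseries_diffs c) n| <= B * rho ^+ 2 * rho ^+ n].
Proof.
move=> rho0 B0 cB; have r0 n : 0 <= rho ^+ n by rewrite exprn_ge0// ltW.
split=> n.
- by apply: le_trans (cB n) _; rewrite ler_piMr ?mulr_ge0// wt_le1.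
- rewrite /pseries_diffs normrM normr_nat.
  apply: (@le_trans _ _ (n.+1%:R * (B * rho ^+ n.+1 * wt n.+1))); first by rewrite ler_wpM2l.
  rewrite mulrCA exprS [B * (_ * _)]mulrA ler_piMr ?mulr_ge0// ?(ltW rho0)//.
  rewrite /wt ler_pdivrMr ?exprn_gt0// mul1r -natrX ler_nat.
  by rewrite (leq_trans (leqnSn _))// leq_pmulr.
- rewrite /pseries_diffs mulrA normrM -natrM normr_nat.
  apply: (@le_trans _ _ ((n.+1 * n.+2)%:R * (B * rho ^+ n.+2 * wt n.+2))); first by rewrite ler_wpM2l.
  rewrite mulrCA (_ : B * rho ^+ n.+2 = B * rho ^+ 2 * rho ^+ n); last by rewrite -mulrA -exprD.
  rewrite ler_piMr ?mulr_ge0// ?(ltW rho0)// /wt ler_pdivrMr ?exprn_gt0// mul1r -natrX ler_nat.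
  by rewrite -mulnn; apply: leq_mul; [exact: leqW (leqnSn _)|exact: leqnSn].
Qed.

Lemma is_derive_pseries (c : nat -> R) (B rho x : R) : 0 < rho -> 0 <= B ->
  (forall n, `|c n| <= B * rho ^+ n * wt n) -> `|x| < (4 * rho)^-1 ->
  is_derive x (1 : R) (fun x : R => limn (pseries c x)) (limn (pseries (pseries_diffs c) x)).
Proof.
move=> rho0 B0 cB xr; have [c0 c1 c2] := pseries_diffs_bound rho0 B0 cB.
apply: (@pseries_snd_diffs _ _ (4 * rho)^-1).
- exact: is_cvg_pseries_q4 c0.
- exact: is_cvg_pseries_q4 c1.
- exact: is_cvg_pseries_q4 c2.
- by rewrite [ltRHS]gtr0_norm// invr_gt0 mulr_gt0.
Qed.

(* [pseries_snd_diffs] consumes a third formal derivative, for which the weight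
   [wt] does not pay: the radius is halved instead. *)
Lemma is_derive_pseries_diffs (c : nat -> R) (B rho x : R) : 0 < rho -> 0 <= B ->
  (forall n, `|c n| <= B * rho ^+ n * wt n) -> `|x| < (8 * rho)^-1 ->
  is_derive x (1 : R) (fun x : R => limn (pseries (pseries_diffs c) x))
    (limn (pseries (pseries_diffs (pseries_diffs c)) x)).
Proof.
move=> rho0 B0 cB xr; have [_ _ c2] := pseries_diffs_bound rho0 B0 cB.
have r20 : 0 < 2 * rho by rewrite mulr_gt0.
have [_ c1 _] := pseries_diffs_bound rho0 B0 cB.
have n2 n : n.+1%:R <= 2 ^+ n :> R by rewrite -natrX ler_nat ltn_expl.
have E4 : 8 * rho = 4 * (2 * rho) by rewrite mulrA -natrM.
have r1 n : rho ^+ n <= (2 * rho) ^+ n.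
  by rewrite lerXn2r ?nnegrE ?(ltW rho0) ?(ltW r20)// ler_peMl ?(ltW rho0)// ler1n.
rewrite E4 in xr.
apply: (@pseries_snd_diffs _ _ (4 * (2 * rho))^-1).
- apply: (@is_cvg_pseries_q4 _ (B * rho)) => // n; apply: le_trans (c1 n) _.
  by rewrite ler_wpM2l// mulr_ge0// ltW.
- apply: (@is_cvg_pseries_q4 _ (B * rho ^+ 2)) => // n; apply: le_trans (c2 n) _.
  by rewrite ler_wpM2l// mulr_ge0// sqr_ge0.
- apply: (@is_cvg_pseries_q4 _ (B * rho ^+ 3)) => // n.
  rewrite {1}/pseries_diffs normrM normr_nat.
  apply: (@le_trans _ _ (n.+1%:R * (B * rho ^+ 2 * rho ^+ n.+1))); first by rewrite ler_wpM2l.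
  rewrite [rho ^+ n.+1]exprS [(2 * rho) ^+ n]exprMn.
  apply: (@le_trans _ _ (B * rho ^+ 3 * (n.+1%:R * rho ^+ n))).
    by lra.
  rewrite ler_wpM2l//; first by rewrite mulr_ge0// exprn_ge0// ltW.
  by rewrite ler_wpM2r// exprn_ge0// ltW.
- by rewrite [ltRHS]gtr0_norm// invr_gt0 mulr_gt0.
Qed.

(* Variation of constants for a scalar oscillator whose solution is a power
   series; the recurrence says P'' + L^2 P = - L^2 Q. *)
Lemma scalar_duhamel p q (L B rho t : R) : 0 <= L -> 0 < rho -> 0 <= B ->
  0 <= t -> t < (8 * rho)^-1 ->
  (forall n, `|p n| <= B * rho ^+ n * wt n) ->
  (forall n, `|q n| <= B * rho ^+ n * wt n) ->
  (forall n, (n.+1%:R * n.+2%:R) * p n.+2 = - L ^+ 2 * (p n + q n)) ->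
  \int[@lebesgue_measure R]_(x in `[0, t])
     (sin ((t - x) * L) * L * limn (pseries q x)) =
  cos (t * L) * p 0%N + (if L == 0 then t else sin (t * L) / L) * p 1%N
   - limn (pseries p t).
Proof.
move=> L0 rho0 B0 t0 tr pB qB rec.
have r4 (x : R) : 0 <= x -> x <= t -> `|x| < (8 * rho)^-1.
  by move=> x0 xt; rewrite ger0_norm// (le_lt_trans xt).
have r8 (x : R) : `|x| < (8 * rho)^-1 -> `|x| < (4 * rho)^-1.
  move=> h; apply: lt_le_trans h _; rewrite lef_pV2 ?posrE ?mulr_gt0//; lra.
have [p0 p1 p2] := pseries_diffs_bound rho0 B0 pB.
have [q0 _ _] := pseries_diffs_bound rho0 B0 qB.
(* At zero frequency the kernel vanishes and the recurrence kills every coefficient from order 2 on: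
   the series is p 0 + t p 1, in agreement with the value t of the sinc symbol there. *)
case: eqVneq => [L00|LN0].
  rewrite (@eq_Rintegral _ _ _ _ _ (fun=> 0)); last by move=> x _; rewrite L00 mulr0 mul0r.
  rewrite /Rintegral integral0_eq//= L00 mulr0 cos0 mul1r.
  suff -> : limn (pseries p t) = p 0%N + t * p 1%N by rewrite subrr.
  have pz n : p n.+2 = 0.
    have := rec n; rewrite L00 expr0n/= oppr0 mul0r => /eqP.
    by rewrite mulf_eq0 -natrM pnatr_eq0/= => /eqP.
  apply/cvg_lim => //; apply: cvg_near_cst; exists 2%N => // n /= n2.
  rewrite /pseries /series/= -(subnK n2) addnC big_mkord big_split_ord/=.
  rewrite [X in _ + X]big1 ?addr0; last by move=> i _; rewrite pz mul0r.
  by rewrite !big_ord_recl big_ord0 /= expr0 expr1 mulr1 addr0 mulrC [t * _]mulrC.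
have [->|tN0] := eqVneq t 0.
  rewrite set_itv1 Rintegral_set1 mul0r cos0 sin0 !mul0r mul1r addr0.
  by rewrite lim_pseries0 subrr.
have tp : 0 < t by rewrite lt_neqAle eq_sym tN0.
pose P (x : R) : R := limn (pseries p x); pose Q (x : R) : R := limn (pseries q x).
pose P1 (x : R) : R := limn (pseries (pseries_diffs p) x).
pose P2 (x : R) : R := limn (pseries (pseries_diffs (pseries_diffs p)) x).
have dP (x : R) : `|x| < (8 * rho)^-1 -> is_derive x 1 P (P1 x).
  by move=> xr; apply: (is_derive_pseries rho0 B0 pB); exact: r8.
have dQ (x : R) : `|x| < (8 * rho)^-1 -> is_derive x 1 Q (limn (pseries (pseries_diffs q) x)).
  by move=> xr; apply: (is_derive_pseries rho0 B0 qB); exact: r8.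
have dP1 (x : R) : `|x| < (8 * rho)^-1 -> is_derive x 1 P1 (P2 x).
  by move=> xr; apply: (is_derive_pseries_diffs rho0 B0 pB).
have cin (c : nat -> R) (B' x : R) : (forall n, `|c n| <= B' * rho ^+ n) ->
    `|x| < (8 * rho)^-1 -> cvgn (pseries c x).
  move=> cB xr; apply: (@is_cvg_pseries_inside _ _ (4 * rho)^-1).
    exact: is_cvg_pseries_q4 cB.
  by rewrite [ltRHS]gtr0_norm ?invr_gt0 ?mulr_gt0//; exact: r8.
have ode (x : R) : `|x| < (8 * rho)^-1 -> P2 x = - L ^+ 2 * (P x + Q x).
  move=> xr; apply/cvg_lim => //.
  rewrite (_ : pseries _ x = (fun n => - L ^+ 2 * (pseries p x n + pseries q x n))).
    apply: cvgM; first exact: cvg_cst.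
    by apply: cvgD; [exact: (cin _ _ _ p0 xr)|exact: (cin _ _ _ q0 xr)].
  apply/funext => n; rewrite /pseries /series/= -big_split/= mulr_sumr.
  apply: eq_bigr => i _; rewrite -mulrDl mulrA -rec.
  by rewrite /pseries_diffs !mulrA.
(* [H x] is the free oscillator run for the remaining time t - x from the state (P, P') at time x.
   It joins the free solution, at x = 0, to [P t], at x = t, and by the equation its derivative [f]
   contains the forcing [Q] alone. *)
pose H (x : R) : R := cos ((t - x) * L) * P x + (sin ((t - x) * L) / L) * P1 x.
pose f (x : R) : R := - (sin ((t - x) * L) * L * Q x).
have dlin (x : R) : is_derive x (1 : R) (fun x : R => (t - x) * L) (- L).
  have h := is_deriveM (is_deriveB (is_derive_cst t x 1) (is_derive_id x 1)) (is_derive_cst L x 1).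
  by apply: (is_derive_eq h); rewrite scaler0 add0r sub0r scalerN /GRing.scale/= mulr1.
have dcos (x : R) : is_derive x (1 : R) (fun x : R => cos ((t - x) * L)) (sin ((t - x) * L) * L).
  have := @is_derive1_comp _ cos (fun x : R => (t - x) * L) x _ _ (is_derive_cos _) (dlin x).
  by rewrite mulrNN.
have dsin (x : R) : is_derive x (1 : R) (fun x : R => sin ((t - x) * L)) (- (cos ((t - x) * L) * L)).
  have := @is_derive1_comp _ sin (fun x : R => (t - x) * L) x _ _ (is_derive_sin _) (dlin x).
  by rewrite mulrN.
have dH (x : R) : `|x| < (8 * rho)^-1 -> is_derive x 1 H (f x).
  move=> xr; have h1 := dP x xr; have h2 := dP1 x xr; have h3 := dcos x; have h4 := dsin x.
  have h5 : is_derive x 1 (fun x => sin ((t - x) * L) / L) (- cos ((t - x) * L)).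
    have h := is_deriveM h4 (is_derive_cst L^-1 x 1).
    apply: (is_derive_eq h); rewrite scaler0 add0r /GRing.scale/=; by field.
  have h := is_deriveD (is_deriveM h3 h1) (is_deriveM h5 h2).
  apply: (is_derive_eq h); rewrite /GRing.scale/= ode// /f.
  by field.
have cf (x : R) : `|x| < (8 * rho)^-1 -> {for x, continuous f}.
  move=> xr; apply: (@differentiable_continuous _ _ _ _ f).
  apply/derivable1_diffP.
  have h1 := dQ x xr; have h4 := dsin x.
  have := is_deriveN (is_deriveM (is_deriveM h4 (is_derive_cst L x 1)) h1).
  by move=> h; apply: ex_derive.
have cH (x : R) : `|x| < (8 * rho)^-1 -> {for x, continuous H}.
  move=> xr; apply: (@differentiable_continuous _ _ _ _ H).
  by apply/derivable1_diffP; have h := dH x xr; apply: ex_derive.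
have := @continuous_FTC2 R f H 0 t tp.
have -> : \int[lebesgue_measure]_(x in `[0, t]) (sin ((t - x) * L) * L * limn (pseries q x)) =
    - \int[lebesgue_measure]_(x in `[0, t]) f x.
  have If : lebesgue_measure.-integrable `[0, t] (EFin \o f).
    apply: continuous_compact_integrable; first exact: segment_compact.
    apply: continuous_in_subspaceT => x; rewrite inE/= in_itv/= => /andP[x0 xt].
    by apply: cf; exact: r4.
  rewrite -mulN1r -RintegralZl//; apply: eq_Rintegral => x _.
  by rewrite mulN1r opprK.
move=> FTC.
have {}FTC : \int[lebesgue_measure]_(x in `[0, t]) f x = H t - H 0.
  rewrite /Rintegral FTC//.
  - apply: continuous_in_subspaceT => x; rewrite inE/= in_itv/= => /andP[x0 xt].
    by apply: cf; exact: r4.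
  - split.
    + move=> x; rewrite in_itv/= => /andP[x0 xt].
      by have h := dH x (r4 x (ltW x0) (ltW xt)); apply: ex_derive.
    + by apply: cvg_at_right_filter; apply: cH; exact: r4.
    + by apply: cvg_at_left_filter; apply: cH; exact: r4.
  - move=> x; rewrite in_itv/= => /andP[x0 xt].
    by have h := dH x (r4 x (ltW x0) (ltW xt)); rewrite derive1E derive_val.
rewrite FTC /H subrr mul0r cos0 sin0 mul0r mul0r mul1r addr0 subr0 opprB.
by rewrite /P /P1 !lim_pseries0 /pseries_diffs mul1r.
Qed.

End scalar_duhamel.

(** * Multiplier symbols and the space FL^1 *)

Section multiplier_symbols.
Context {R : realType} {d : nat}.
Local Notation E := (Euc R d).

Lemma sin_le_norm (x : R) : `|sin x| <= `|x|.
Proof.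
wlog x0 : x / 0 <= x.
  move=> h; have [/h//|/ltW x0] := leP 0 x.
  by rewrite -normrN -sinN -[leRHS]normrN h// oppr_ge0.
have [c _] := @MVT_segment R sin cos 0 x x0 (fun y _ => is_derive_sin y)
  (continuous_subspaceT (@continuous_sin R)).
rewrite sin0 !subr0 => ->; rewrite normrM ler_piMl//.
by rewrite ler_norml cos_geN1 cos_le1.
Qed.

Lemma measurable_cosR : measT (@cos R).
Proof. by apply: continuous_measurable_fun; exact: continuous_cos. Qed.
Lemma measurable_sinR : measT (@sin R).
Proof. by apply: continuous_measurable_fun; exact: continuous_sin. Qed.

Lemma measurable_cos_symbol (t : R) : measT (@cos_symbol R d t).
Proof.
apply: (measurableT_comp measurable_cosR).
by apply: measurable_funM => //; exact: measurable_lambda.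
Qed.
Lemma cos_symbol_le (t : R) (xi : E) : `|cos_symbol t xi| <= 1.
Proof. by rewrite ler_norml cos_geN1 cos_le1. Qed.

Lemma measurable_inv_lambda : measT (fun xi : E => (lambda xi)^-1).
Proof.
rewrite (_ : (fun xi => _) = (fun xi : E => lambda xi `^ (-1))).
  apply: (measurableT_comp (f := fun x : R => x `^ (-1))) (@measurable_lambda R d).
  exact: measurable_powR.
by apply/funext => x; rewrite powR_inv1// lambda_ge0.
Qed.

Lemma measurable_sinc_symbol (t : R) : measT (@sinc_symbol R d t).
Proof.
apply: measurable_fun_ifT => //.
  by apply: measurable_fun_eqr => //; exact: measurable_lambda.
apply: measurable_funM; last exact: measurable_inv_lambda.
apply: (measurableT_comp measurable_sinR).
by apply: measurable_funM => //; exact: measurable_lambda.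
Qed.
Lemma sinc_symbol_le (t : R) (xi : E) : `|sinc_symbol t xi| <= `|t|.
Proof.
rewrite /sinc_symbol; case: eqVneq => // l0.
rewrite normrM normfV ler_pdivrMr ?normr_gt0// -normrM.
exact: sin_le_norm.
Qed.

Lemma measurable_duhamel_symbol (t : R) : measT (@duhamel_symbol R d t).
Proof.
apply: measurable_funM; last exact: measurable_lambda.
apply: (measurableT_comp measurable_sinR).
by apply: measurable_funM => //; exact: measurable_lambda.
Qed.
Lemma duhamel_symbol_le (t : R) (xi : E) : `|duhamel_symbol t xi| <= 1.
Proof.
rewrite normrM -[leRHS]mulr1 ler_pM// ?sin_max//.
by rewrite ger0_norm ?lambda_ge0// lambda_le1.
Qed.

End multiplier_symbols.

Section fourier_lebesgue.
Context {R : realType} {d : nat}.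
Local Notation E := (Euc R d).
Local Notation mu := (lebesgue R d).

Lemma nice_FL1_fourier K (g : E -> R[i]) : nice K g -> FL1_fourier (inv_fourier g) g.
Proof. by move=> ng; split=> //; exact: nice_int ng. Qed.

Lemma FL1_norm_ge0 (f : E -> R[i]) : (0 <= FL1_norm f)%E.
Proof.
apply: le_ereal_inf_tmp => _ [g _ <-]; apply: integral_ge0 => x _.
by rewrite lee_fin normc_ge0.
Qed.

Lemma FL1_norm_le K (f g : E -> R[i]) : nice K g ->
  (forall x, f x = inv_fourier g x) -> (FL1_norm f <= K%:E)%E.
Proof.
move=> ng fg; have [mg _ gK] := ng.
apply: le_trans gK.
apply: (@le_trans _ _ (\int[mu]_x (Normc.normc (g x))%:E)%E).
  by apply: ereal_inf_lbound; exists g => //; split => //; exact: nice_int ng.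
apply: le_integral_ge0.
- exact: measurable_normc.
- exact: measurable_l1n.
- by move=> x; exact: normc_ge0.
- by move=> x; exact: normc_le_l1n.
Qed.

Lemma ereal_squeeze0 {T : Type} {F : set_system T} {FF : Filter F} (f : T -> \bar R) (g : T -> R) :
  (\forall x \near F, (0 <= f x)%E) -> (\forall x \near F, (f x <= (g x)%:E)%E) ->
  g x @[x --> F] --> (0 : R) -> f x @[x --> F] --> 0%E.
Proof.
move=> f0 fg g0; apply: (@squeeze_cvge _ _ _ _ (cst 0%E) _ (fun x => (g x)%:E)).
- by near=> x; apply/andP; split; near: x.
- exact: cvg_cst.
- by apply: cvg_EFin; [exact: nearW|exact: g0].
Unshelve. all: by end_near.
Qed.

Lemma cintegral_mkcond (nu : {measure set (measurableTypeR R) -> \bar R}) (D : set (measurableTypeR R))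
    (f : measurableTypeR R -> R[i]) :
  cintegral nu D f = cintegral nu setT (fun x => (\1_D x)%:C * f x).
Proof.
rewrite /cintegral; congr (_ +i* _); rewrite Rintegral_mkcond;
  apply: eq_Rintegral => x _; rewrite patchE indicE.
  by case: (x \in D); rewrite cReMr ?mul1r ?mul0r.
by case: (x \in D); rewrite cImMr ?mul1r ?mul0r.
Qed.

End fourier_lebesgue.

Section power_series_solution.
Context {R : realType} {d : nat}.
Local Notation E := (Euc R d).
Local Notation mu := (lebesgue R d).
Implicit Types (A B : nat -> E -> R[i]).

(* [cauchy_pow j A] holds the coefficients of the convolution power of order
   [j.+1] of the power series with coefficients [A]. *)
Fixpoint cauchy_pow (j : nat) A (n : nat) : E -> R[i] :=
  match j with
  | 0 => A n
  | j'.+1 => fun xi => \sum_(m < n.+1) fconv (cauchy_pow j' A m) (A (n - m)%N) xi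
  end.

Lemma eq_cauchy_pow j A B n : (forall m, (m <= n)%N -> A m = B m) ->
  cauchy_pow j A n = cauchy_pow j B n.
Proof.
elim: j n => [|j IH] n AB /=; first exact: AB.
apply/funext => xi; apply: eq_bigr => m _.
rewrite IH; last by move=> i im; rewrite AB// (leq_trans im)// -ltnS.
by rewrite AB// leq_subr.
Qed.

Variables (j : nat) (v0 v1 : E -> R[i]).

(* The equation reads u'' = - lambda^2 (u + u^k) on the Fourier side, with
   k = j.+1, which determines the Taylor coefficients in time. *)
Definition taylor_step A (n : nat) : E -> R[i] :=
  match n with
  | 0 => v0
  | 1 => v1
  | m.+2 => fun xi => (- (lambda xi ^+ 2 / (m.+1%:R * m.+2%:R)))%:C *
                      (A m xi + cauchy_pow j A m xi)
  end.

(** Each coefficient depends on all the earlier ones through [cauchy_pow], which is no structural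
    recursion. Instead the step acts on whole sequences: n + 1 iterations from an arbitrary start
    fix the coefficients up to order n, and later ones leave them unchanged ([taylor_stable]). *)
Definition taylor (n : nat) : E -> R[i] := iter n.+1 taylor_step (fun _ _ => 0) n.

Lemma eq_taylor_step A B n : (forall m, (m < n)%N -> A m = B m) ->
  taylor_step A n = taylor_step B n.
Proof.
case: n => [//|[//|n]] AB /=; apply/funext => xi.
by rewrite AB// (@eq_cauchy_pow _ A B)// => m mn; rewrite AB// ltnS ltnW.
Qed.

Lemma taylor_stable n p1 p2 : (n < p1)%N -> (n < p2)%N ->
  iter p1 taylor_step (fun _ _ => 0) n = iter p2 taylor_step (fun _ _ => 0) n.
Proof.
elim/ltn_ind: n p1 p2 => n IH [//|p1] [//|p2] np1 np2 /=.
by apply: eq_taylor_step => m mn; apply: IH => //; exact: leq_trans mn _.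
Qed.

Lemma taylorE n : taylor n = taylor_step taylor n.
Proof.
rewrite {1}/taylor /=; apply: eq_taylor_step => m mn.
exact: taylor_stable.
Qed.

(** [rho] is the growth rate of the coefficients; its square appears because the recurrence advances
    by two. In the condition, 8 M is the price of one convolution with [wt], 1 + (8 M)^j adds the
    linear and nonlinear terms, and 5 comes from the change of weight over two orders. The bound 4
    <= rho compensates [wt 1] = 1/4 in the estimate of [v1]. *)
Variables (M rho : R).
Hypotheses (nv0 : nice M v0) (nv1 : nice M v1) (rho4 : 4 <= rho)
  (rhoM : 5 * (1 + (8 * M) ^+ j) <= rho ^+ 2).

Let rho0 : 0 < rho. Proof. by apply: lt_le_trans rho4. Qed.
Let rho_ge0 n : 0 <= rho ^+ n. Proof. by rewrite exprn_ge0// ltW. Qed.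
Let M0 : 0 <= M. Proof. exact: nice_ge0 nv0. Qed.

Lemma nice_cauchy_pow i A n :
  (forall m, (m <= n)%N -> nice (M * rho ^+ m * wt m) (A m)) ->
  nice (M * (8 * M) ^+ i * rho ^+ n * wt n) (cauchy_pow i A n).
Proof.
elim: i n => [|i IH] n nA /=; first by rewrite expr0 mulr1; exact: nA.
apply: (@nice_le _ _ (\sum_(m < n.+1) (M * (8 * M) ^+ i * rho ^+ m * wt m) *
    (M * rho ^+ (n - m) * wt (n - m)%N))).
  apply: nice_sum => m _; apply: nice_conv.
    apply: IH => l lm; apply: nA; apply: leq_trans lm _; by rewrite -ltnS.
  by apply: nA; exact: leq_subr.
rewrite (eq_bigr (fun m : 'I_n.+1 => M * (8 * M) ^+ i * M * rho ^+ n * (wt m * wt (n - m)%N))); last first.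
  move=> m _; have mn : (m <= n)%N by rewrite -ltnS.
  have -> : rho ^+ n = rho ^+ m * rho ^+ (n - m) by rewrite -exprD subnKC.
  by ring.
rewrite -mulr_sumr; apply: (@le_trans _ _ (M * (8 * M) ^+ i * M * rho ^+ n * (8 * wt n))).
  by rewrite ler_wpM2l ?wt_conv// !mulr_ge0// exprn_ge0// mulr_ge0.
by rewrite exprS le_eqVlt; apply/orP; left; apply/eqP; ring.
Qed.

(** With x = n the claim reduces to (x + 3)^2 <= 5 (x + 1)^3 (x + 2). The case n = 0 is the tight
    one and reads 9 <= 10: this is the origin of the 5. *)
Lemma taylor_step_weight n :
  (1 + (8 * M) ^+ j) * wt n / (n.+1%:R * n.+2%:R) <= rho ^+ 2 * wt n.+2.
Proof.
apply: (@le_trans _ _ (5 * (1 + (8 * M) ^+ j) * wt n.+2)); last first.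
  by rewrite ler_wpM2r ?wt_ge0.
have c0 : 0 <= 1 + (8 * M) ^+ j by rewrite addr_ge0// exprn_ge0// mulr_ge0.
rewrite -mulrA [5 * _]mulrC -[leRHS]mulrA ler_wpM2l//.
have n0 : (0 : R) <= n%:R by [].
rewrite /wt -[n.+3%:R]natr1 -[n.+2%:R]natr1 -[n.+1%:R]natr1.
move: (n%:R) n0 => x x0.
rewrite -invfM ler_pdivlMr ?exprn_gt0//; last by lra.
rewrite mulrC ler_pdivrMr; last by rewrite !mulr_gt0// ?exprn_gt0//; lra.
have h1 : (x + 1 + 1 + 1) ^+ 2 <= 9 * (x + 1) ^+ 2 by nra.
have h2 : 2 <= (x + 1) * (x + 1 + 1) by nra.
have : 9 * (x + 1) ^+ 2 <= 5 * ((x + 1) ^+ 2 * ((x + 1) * (x + 1 + 1))).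
  have := sqr_ge0 (x + 1); nra.
by move=> h3; exact: le_trans h1 h3.
Qed.

Lemma nice_taylor n : nice (M * rho ^+ n * wt n) (taylor n).
Proof.
elim/ltn_ind: n => n IH; rewrite taylorE; case: n IH => [|[|n]] IH /=.
- by apply: nice_le nv0 _; rewrite expr0 /wt expr1n invr1 !mulr1.
- apply: nice_le nv1 _; rewrite expr1 /wt -mulrA ler_peMr//.
  rewrite ler_pdivlMr ?exprn_gt0// mul1r; apply: le_trans rho4.
  by rewrite -natrX.
have n0 : (0 : R) < n.+1%:R * n.+2%:R by rewrite mulr_gt0.
apply: (@nice_le _ _ ((n.+1%:R * n.+2%:R)^-1 * (M * rho ^+ n * wt n +
    M * (8 * M) ^+ j * rho ^+ n * wt n))).
  apply: niceMr.
  - apply: measurable_funN; apply: measurable_funM => //.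
    by apply: measurable_funX; exact: measurable_lambda.
  - move=> xi; rewrite normrN normrM normfV [X in _ / X]gtr0_norm//.
    rewrite ler_pdivrMr// mulVf ?gt_eqF// ger0_norm ?sqr_ge0//.
    by rewrite exprn_ile1 ?lambda_ge0// lambda_le1.
  apply: niceD; first by apply: IH; rewrite ltnS ltnW.
  by apply: nice_cauchy_pow => m mn; apply: IH; rewrite ltnS ltnW// ltnS.
apply: (@le_trans _ _ (M * rho ^+ n * ((1 + (8 * M) ^+ j) * wt n / (n.+1%:R * n.+2%:R)))).
  rewrite le_eqVlt; apply/orP; left; apply/eqP.
  by move: ((n.+1%:R * n.+2%:R)^-1) ((8 * M) ^+ j) (rho ^+ n) (wt n) => a P r w; ring.
rewrite (_ : M * rho ^+ n.+2 * wt n.+2 = M * rho ^+ n * (rho ^+ 2 * wt n.+2)); last first.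
  by rewrite -addn2 exprD -!mulrA.
by rewrite ler_wpM2l ?mulr_ge0//; exact: taylor_step_weight.
Qed.

Lemma nice_taylor_pow n : nice (M * (8 * M) ^+ j * rho ^+ n * wt n) (cauchy_pow j taylor n).
Proof. by apply: nice_cauchy_pow => m _; exact: nice_taylor. Qed.

Section fixed_time.
Variable t : R.
(** 1/16 lies below the ratio 1/4 of the geometric majorants and strictly below the 1/8 demanded by
    [scalar_duhamel]. *)
Hypotheses (t0 : 0 <= t) (trho : t * rho <= 16^-1).

Let trho4 n : (t * rho) ^+ n <= q4 ^+ n.
Proof.
rewrite lerXn2r ?nnegrE ?mulr_ge0 ?(ltW rho0)//; first by rewrite invr_ge0.
by apply: le_trans trho _; rewrite /q4 lef_pV2 ?posrE//; lra.
Qed.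

Lemma nice_time_coef (C : R) n (f : E -> R[i]) : 0 <= C ->
  nice (C * rho ^+ n * wt n) f -> nice (C * (t * rho) ^+ n) (fun xi => (t ^+ n)%:C * f xi).
Proof.
move=> C0 nf; apply: nice_le (niceZ (t ^+ n) nf) _.
rewrite ger0_norm ?exprn_ge0// exprMn.
rewrite [leLHS](_ : _ = C * (t ^+ n * rho ^+ n) * wt n); last by ring.
by rewrite ler_piMr ?wt_le1// !mulr_ge0// exprn_ge0.
Qed.

Lemma nice_time_coef_q4 (C : R) n (f : E -> R[i]) : 0 <= C ->
  nice (C * rho ^+ n * wt n) f -> nice (C * q4 ^+ n) (fun xi => (t ^+ n)%:C * f xi).
Proof.
by move=> C0 nf; apply: nice_le (nice_time_coef C0 nf) _; rewrite ler_wpM2l.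
Qed.

Definition evolution (xi : E) : R[i] := csum (fun n => (t ^+ n)%:C * taylor n xi).
Definition evolution_pow (xi : E) : R[i] :=
  csum (fun n => (t ^+ n)%:C * cauchy_pow j taylor n xi).

Lemma summable_trho (C : R) N : 0 <= C ->
  summable_le (fun i => C * (t * rho) ^+ (N + i)) (2 * C * (t * rho) ^+ N).
Proof.
move=> C0 m; have tr0 : 0 <= t * rho by rewrite mulr_ge0// ltW.
apply: (@le_trans _ _ (\sum_(i < m) C * (t * rho) ^+ N * q4 ^+ (0 + i))).
  apply: ler_sum => i _; rewrite exprD mulrA ler_wpM2l//.
  by rewrite mulr_ge0// exprn_ge0.
have C1 : 0 <= C * (t * rho) ^+ N by rewrite mulr_ge0// exprn_ge0.
by have := summable_q4 0 C1 m; rewrite expr0 mulr1 mulrA.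
Qed.

Lemma nice_evolution_tail N :
  nice (2 * M * (t * rho) ^+ N)
    (fun xi => evolution xi - \sum_(i < N) (t ^+ i)%:C * taylor i xi).
Proof.
apply: (@nice_csum_tail _ _ (fun n => M * (t * rho) ^+ n) (2 * M * (t * rho) ^+ 0)).
- by move=> n; apply: nice_time_coef => //; exact: nice_taylor.
- by have := @summable_trho M 0 M0.
- exact: summable_trho.
Qed.

Lemma nice_evolution : nice (2 * M) evolution.
Proof.
have := nice_evolution_tail 0; rewrite expr0 mulr1; apply: eq_nice => xi.
by rewrite big_ord0 subr0.
Qed.

Lemma nice_evolution_pow : nice (2 * (M * (8 * M) ^+ j)) evolution_pow.
Proof.
have C0 : 0 <= M * (8 * M) ^+ j by rewrite mulr_ge0// exprn_ge0// mulr_ge0.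
apply: (@nice_csum _ _ (fun n => M * (8 * M) ^+ j * (t * rho) ^+ n)).
  by move=> n; apply: nice_time_coef => //; exact: nice_taylor_pow.
by have := @summable_trho _ 0 C0; rewrite expr0 mulr1.
Qed.

Lemma sums_evolution xi :
  sums_to (fun n => (t ^+ n)%:C * taylor n xi) (evolution xi).
Proof.
apply: (@sums_to_dominated _ _ (fun n => M * (t * rho) ^+ n) (2 * M * (t * rho) ^+ 0)).
  by move=> n; exact: (nice_sup (nice_time_coef M0 (nice_taylor n))).
by have := @summable_trho M 0 M0.
Qed.

Lemma sums_evolution_pow xi :
  sums_to (fun n => (t ^+ n)%:C * cauchy_pow j taylor n xi) (evolution_pow xi).
Proof.
have C0 : 0 <= M * (8 * M) ^+ j by rewrite mulr_ge0// exprn_ge0// mulr_ge0.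
apply: (@sums_to_dominated _ _ (fun n => M * (8 * M) ^+ j * (t * rho) ^+ n)
   (2 * (M * (8 * M) ^+ j) * (t * rho) ^+ 0)).
  by move=> n; exact: (nice_sup (nice_time_coef C0 (nice_taylor_pow n))).
by have := @summable_trho _ 0 C0.
Qed.

(** At a fixed x, [inv_fourier] turns the convolutions inside [cauchy_pow] into products of complex
    numbers, so the induction on the power is the Cauchy product of two numerical series. *)
Lemma inv_fourier_cauchy_pow i x :
  sums_to (fun n => inv_fourier (fun xi => (t ^+ n)%:C * cauchy_pow i taylor n xi) x)
    (inv_fourier evolution x ^+ i.+1).
Proof.
elim: i => [|i IH].
  rewrite expr1; apply: (@inv_fourier_csum _ _ M) => n.
  by apply: nice_time_coef_q4 => //; exact: nice_taylor.
have C0 : 0 <= M * (8 * M) ^+ i by rewrite mulr_ge0// exprn_ge0// mulr_ge0.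
have npow l n : nice (M * (8 * M) ^+ l * rho ^+ n * wt n) (cauchy_pow l taylor n).
  by apply: nice_cauchy_pow => m _; exact: nice_taylor.
rewrite exprSr.
have base : sums_to (fun n => inv_fourier (fun xi => (t ^+ n)%:C * taylor n xi) x)
    (inv_fourier evolution x).
  apply: (@inv_fourier_csum _ _ M) => n.
  by apply: nice_time_coef_q4 => //; exact: nice_taylor.
have := @cauchy_product _ _ _ _ _ (2 * (M * (8 * M) ^+ i)) (2 * M) _ _ IH base.
rewrite (_ : (fun n => \sum_(m < n.+1) _) =
   (fun n => inv_fourier (fun xi => (t ^+ n)%:C * cauchy_pow i.+1 taylor n xi) x)).
  apply.
    move=> n; rewrite -mulrA; apply: l1n_inv_fourier.
    by apply: nice_time_coef_q4 => //; exact: npow.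
  move=> n; rewrite -mulrA; apply: l1n_inv_fourier.
  by apply: nice_time_coef_q4 => //; exact: nice_taylor.
apply/funext => n /=.
have ni m := nice_int (npow i m); have nt m := nice_int (nice_taylor m).
have nc (m : 'I_n.+1) := nice_conv (npow i m) (nice_taylor (n - m)%N).
rewrite inv_fourierZ; last by apply: cint_sum => m _; exact: nice_int (nc m).
rewrite inv_fourier_sum; last by move=> m _; exact: nice_int (nc m).
rewrite mulr_sumr; apply: eq_bigr => m _.
rewrite !inv_fourierZ// (inv_fourier_conv x (npow i m) (nice_taylor (n - m)%N)).
have mn : (m <= n)%N by rewrite -ltnS.
have -> : t ^+ n = t ^+ m * t ^+ (n - m) by rewrite -exprD subnKC.
by rewrite rmorphM/=; ring.
Qed.

Lemma evolution_powE x :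
  inv_fourier evolution x ^+ j.+1 = inv_fourier evolution_pow x.
Proof.
apply: sums_to_unique (inv_fourier_cauchy_pow j x) _.
have C0 : 0 <= M * (8 * M) ^+ j by rewrite mulr_ge0// exprn_ge0// mulr_ge0.
apply: (@inv_fourier_csum _ _ (M * (8 * M) ^+ j)) => n.
by apply: nice_time_coef_q4 => //; exact: nice_taylor_pow.
Qed.

End fixed_time.
End power_series_solution.

(** * The power series is a solution *)

Section solution_of_power_series.
Context {R : realType} {d : nat}.
Local Notation E := (Euc R d).
Local Notation mu := (lebesgue R d).
Local Notation leb := (@lebesgue_measure R).
Variables (j : nat) (v0 v1 : E -> R[i]) (M rho : R).
Hypotheses (nv0 : nice M v0) (nv1 : nice M v1) (rho4 : 4 <= rho)
  (rhoM : 5 * (1 + (8 * M) ^+ j) <= rho ^+ 2).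
Local Notation taylor := (taylor j v0 v1).
Local Notation evol := (evolution j v0 v1).
Local Notation evol_pow := (evolution_pow j v0 v1).

Let rho0 : 0 < rho. Proof. by apply: lt_le_trans rho4. Qed.
Let M0 : 0 <= M. Proof. exact: nice_ge0 nv0. Qed.
Let MP0 : 0 <= M * (8 * M) ^+ j. Proof. by rewrite mulr_ge0// exprn_ge0// mulr_ge0. Qed.

Lemma evolution0 : evol 0 = v0.
Proof.
apply/funext => xi; apply: sums_to_csum.
have := @sums_to_finite _ (fun n => (0 ^+ n)%:C * taylor n xi) 1.
rewrite big_ord1 expr0 mul1r taylorE; apply => n n0.
by rewrite expr0n gtn_eqF// mul0r.
Qed.

(** The difference of n-th powers is at most n T^(n-1) times [|s - t|], and [wt n] pays for the n.
    The constant 4 M rho, rather than M rho, makes up for the exponent n - 1 in the geometric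
    majorant q4^n. *)
Lemma nice_evolutionB (T s t : R) : 0 <= s -> s <= T -> 0 <= t -> t <= T ->
  T * rho <= 16^-1 ->
  nice (8 * M * rho * `|s - t|) (fun xi => evol s xi - evol t xi).
Proof.
move=> s0 sT t0 tT Tr.
have T0 : 0 <= T by exact: le_trans sT.
have sr : s * rho <= 16^-1 by apply: le_trans Tr; rewrite ler_wpM2r// ltW.
have tr : t * rho <= 16^-1 by apply: le_trans Tr; rewrite ler_wpM2r// ltW.
have Trq n : (T * rho) ^+ n <= q4 ^+ n.
  rewrite lerXn2r ?nnegrE ?mulr_ge0 ?(ltW rho0)//; first by rewrite invr_ge0.
  by apply: le_trans Tr _; rewrite /q4 lef_pV2 ?posrE//; lra.
have C0 : 0 <= 4 * M * rho * `|s - t| by rewrite !mulr_ge0// ltW.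
have nn := @nice_csum _ _ (fun n => 4 * M * rho * `|s - t| * q4 ^+ n) _
  (fun n xi => (s ^+ n - t ^+ n)%:C * taylor n xi).
have := nn (2 * (4 * M * rho * `|s - t|)) _ _.
rewrite (_ : 2 * (4 * M * rho * `|s - t|) = 8 * M * rho * `|s - t|); last by ring.
move=> h; apply: eq_nice (h _ _) => [xi|n|].
- apply: sums_to_csum.
  have := sums_toB (sums_evolution nv0 nv1 rho4 rhoM s0 sr xi)
    (sums_evolution nv0 nv1 rho4 rhoM t0 tr xi).
  by under [X in sums_to X]eq_fun do rewrite -mulrBl -rmorphB.
- apply: nice_le (niceZ (s ^+ n - t ^+ n) (nice_taylor nv0 nv1 rho4 rhoM n)) _.
  case: n => [|n]; first by rewrite !expr0 subrr normr0 mul0r mulr1.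
  rewrite subrXX normrM.
  apply: (@le_trans _ _ (`|s - t| * (n.+1%:R * T ^+ n) * (M * rho ^+ n.+1 * wt n.+1))).
    rewrite ler_wpM2r//; first by rewrite !mulr_ge0 ?wt_ge0// exprn_ge0// ltW.
    rewrite ler_wpM2l//; apply: le_trans (ler_norm_sum _ _ _) _.
    rewrite -[X in X%:R](card_ord n.+1) mulr_natl -sumr_const; apply: ler_sum => i _.
    have i_n : (i <= n)%N by rewrite -ltnS.
    rewrite normrM !normrX !ger0_norm//=.
    have -> : T ^+ n = T ^+ (n - i) * T ^+ i by rewrite -exprD subnK.
    by apply: ler_pM; rewrite ?exprn_ge0// lerXn2r ?nnegrE.
  have w1 : n.+1%:R * wt n.+1 <= 1 :> R.
    rewrite /wt ler_pdivrMr ?exprn_gt0// mul1r -natrX ler_nat.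
    by rewrite (leq_trans (leqnSn _))// leq_pmulr.
  apply: (@le_trans _ _ (M * rho * `|s - t| * (T * rho) ^+ n * (n.+1%:R * wt n.+1))).
    by rewrite exprS exprMn le_eqVlt; apply/orP; left; apply/eqP;
      move: (n.+1%:R) (wt n.+1) (T ^+ n) (rho ^+ n) `|s - t| => a b c e f; ring.
  have X0 : 0 <= M * rho * `|s - t| by rewrite !mulr_ge0// ltW.
  apply: (@le_trans _ _ (M * rho * `|s - t| * (T * rho) ^+ n)).
    by rewrite ler_piMr// mulr_ge0// exprn_ge0// mulr_ge0// ltW.
  apply: (@le_trans _ _ (M * rho * `|s - t| * q4 ^+ n)); first by rewrite ler_wpM2l.
  rewrite exprS /q4 le_eqVlt; apply/orP; left; apply/eqP.
  by move: `|s - t| (4^-1 ^+ n) => a b; field.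
- move=> N; apply: le_trans (summable_q4 0 C0 N) _.
  by rewrite expr0 mulr1 le_eqVlt; apply/orP; left; apply/eqP; ring.
Qed.

Lemma inv_fourier_evolutionB (s t : R) x : 0 <= s -> 0 <= t ->
  s * rho <= 16^-1 -> t * rho <= 16^-1 ->
  inv_fourier (evol s) x - inv_fourier (evol t) x =
  inv_fourier (fun xi => evol s xi - evol t xi) x.
Proof.
move=> s0 t0 sr tr; rewrite inv_fourierB//.
  exact: nice_int (nice_evolution nv0 nv1 rho4 rhoM s0 sr).
exact: nice_int (nice_evolution nv0 nv1 rho4 rhoM t0 tr).
Qed.

Section duhamel_at.
Variables (t : R) (x : E).
Hypotheses (t0 : 0 <= t) (tr : t * rho <= 16^-1).

(* Off [0, t] the power series may diverge, hence the truncation of time. *)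
Let clamp (s : R) : R := Num.max 0 (Num.min s t).

Let clamp_ge0 s : 0 <= clamp s. Proof. by rewrite le_max lexx. Qed.
Let clamp_le s : clamp s <= t. Proof. by rewrite ge_max t0 ge_min lexx orbT. Qed.
Let clamp_id s : 0 <= s -> s <= t -> clamp s = s.
Proof. by move=> s0 st; rewrite /clamp min_l// max_r. Qed.
Let clamp_rho s : clamp s * rho <= 16^-1.
Proof. by apply: le_trans tr; rewrite ler_wpM2r ?clamp_le// ltW. Qed.
Let measurable_clamp : measT (fun s : R => clamp s).
Proof.
apply: measurable_maxr => //; exact: measurable_minr.
Qed.

Let kernel (z : R * E) : R[i] :=
  (duhamel_symbol (t - z.1) z.2)%:C * evol_pow (clamp z.1) z.2.

Let cmeas_kernel : cmeas (kernel : measurableTypeR R * E -> R[i]).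
Proof.
apply: cmeasMr.
  have ml : measT (fun z : measurableTypeR R * E => lambda z.2).
    exact: (measurableT_comp (@measurable_lambda R d) measurable_snd).
  apply: measurable_funM => //.
  apply: (measurableT_comp measurable_sinR); apply: measurable_funM => //.
  by apply: measurable_funB => //; exact: measurable_fst.
apply: (cmeas_sums_to (f := fun n z => (clamp z.1 ^+ n)%:C * cauchy_pow j taylor n z.2)).
  move=> n; apply: cmeasMr.
    apply: measurable_funX.
    exact: (measurableT_comp measurable_clamp measurable_fst).
  apply: (cmeas_comp measurable_snd).
  exact: nice_meas (nice_taylor_pow nv0 nv1 rho4 rhoM n).
by move=> z; exact: (sums_evolution_pow nv0 nv1 rho4 rhoM (clamp_ge0 z.1) (clamp_rho z.1) z.2).
Qed.

Let nice_kernel s : nice (2 * (M * (8 * M) ^+ j)) (fun xi => kernel (s, xi)).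
Proof.
rewrite -[X in nice X _]mul1r.
exact: (niceMr (measurable_duhamel_symbol (t - s)) (duhamel_symbol_le (t - s))
  (nice_evolution_pow nv0 nv1 rho4 rhoM (clamp_ge0 s) (clamp_rho s))).
Qed.

Let duhamel_integral (xi : E) : R[i] :=
  cintegral leb setT (fun s => (\1_`[0, t] s)%:C * kernel (s, xi)).

Let duhamel_integralE xi : duhamel_integral xi =
  (cos_symbol t xi)%:C * v0 xi + (sinc_symbol t xi)%:C * v1 xi - evol t xi.
Proof.
have tr8 : t < (8 * rho)^-1.
  rewrite invfM ltr_pdivlMr//; apply: le_lt_trans tr _.
  by rewrite ltf_pV2 ?posrE//; lra.
(* The scalar formula is real. A projection [pr] that is real-linear, bounded by [l1n] and
   compatible with [csum] treats the real and imaginary parts in one argument. *)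
have part (pr : R[i] -> R) : (forall a z, pr (a%:C * z) = a * pr z) ->
    (forall z w, pr (z + w) = pr z + pr w) -> (forall z, `|pr z| <= l1n z) ->
    (forall F : nat -> R[i], pr (csum F) = limn (series (fun n => pr (F n)))) ->
    \int[leb]_(s in `[0, t]) pr (kernel (s, xi)) =
    pr ((cos_symbol t xi)%:C * v0 xi + (sinc_symbol t xi)%:C * v1 xi - evol t xi).
  move=> prZ prD prle prS.
  have prB z w : pr (z - w) = pr z - pr w.
    by rewrite prD -mulN1r (_ : -1 = (-1)%:C) ?prZ ?mulN1r// rmorphN1.
  have prP (a : nat -> E -> R[i]) s : pr (csum (fun n => (s ^+ n)%:C * a n xi)) =
      limn (pseries (fun n => pr (a n xi)) s).
    rewrite prS; congr (limn _); apply/funext => n.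
    by rewrite /pseries /series/=; apply: eq_bigr => i _; rewrite prZ mulrC.
  rewrite prB prD !prZ prP -(@scalar_duhamel _ (fun n => pr (taylor n xi))
    (fun n => pr (cauchy_pow j taylor n xi)) (lambda xi) (M + M * (8 * M) ^+ j) rho t)
    ?lambda_ge0// ?addr_ge0//.
  - apply: eq_Rintegral => s; rewrite inE/= in_itv/= => /andP[s0 st].
    by rewrite /kernel prZ /= clamp_id// prP.
  - move=> n; apply: le_trans (prle _) _; apply: le_trans (nice_sup (nice_taylor nv0 nv1 rho4 rhoM n) xi) _.
    by rewrite ler_wpM2r ?wt_ge0// ler_wpM2r ?exprn_ge0 ?(ltW rho0)// lerDl.
  - move=> n; apply: le_trans (prle _) _; apply: le_trans (nice_sup (nice_taylor_pow nv0 nv1 rho4 rhoM n) xi) _.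
    by rewrite ler_wpM2r ?wt_ge0// ler_wpM2r ?exprn_ge0 ?(ltW rho0)// lerDr.
  - move=> n; rewrite [taylor n.+2]taylorE /= prZ prD mulrA mulrN; congr (- _ * _).
    by rewrite mulrC divfK// mulf_neq0// pnatr_eq0.
rewrite /duhamel_integral -(cintegral_mkcond leb `[0, t] (fun s => kernel (s, xi))).
apply: complex_ext.
  exact: (part _ cReMr cReD Re_le_l1n).
exact: (part _ cImMr cImD Im_le_l1n).
Qed.

(** Fubini exchanges the time integral with the inverse Fourier transform; the identity is then the
    scalar Duhamel formula at each frequency. *)
Lemma duhamel_formula :
  inv_fourier (evol t) x =
  inv_fourier (fun xi => (cos_symbol t xi)%:C * v0 xi) x +
  inv_fourier (fun xi => (sinc_symbol t xi)%:C * v1 xi) x -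
  cintegral leb `[0, t] (fun s =>
    inv_fourier (fun xi => (duhamel_symbol (t - s) xi)%:C * evol_pow s xi) x).
Proof.
have nc := niceMr (measurable_cos_symbol t) (cos_symbol_le t) nv0.
have ns := niceMr (measurable_sinc_symbol t) (sinc_symbol_le t) nv1.
have ne := nice_evolution nv0 nv1 rho4 rhoM t0 tr.
suff -> : cintegral leb `[0, t] (fun s =>
    inv_fourier (fun xi => (duhamel_symbol (t - s) xi)%:C * evol_pow s xi) x) =
  inv_fourier duhamel_integral x.
  rewrite (_ : duhamel_integral = (fun xi => (cos_symbol t xi)%:C * v0 xi +
     (sinc_symbol t xi)%:C * v1 xi - evol t xi)); last first.
    by apply/funext => xi; exact: duhamel_integralE.
  rewrite inv_fourierB; [|exact: nice_int (niceD nc ns)|exact: nice_int ne].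
  rewrite inv_fourierD; [|exact: nice_int nc|exact: nice_int ns].
  by rewrite opprB addrC subrK.
transitivity (cintegral leb `[0, t] (fun s => inv_fourier (fun xi => kernel (s, xi)) x)).
  apply: eq_cintegral => s; rewrite inE/= in_itv/= => /andP[s0 st].
  by rewrite /kernel /= clamp_id.
rewrite cintegral_mkcond.
(* The indicator of [0, t] extends the time integral to the whole line, with a constant multiple of
   that indicator as integrable majorant. *)
pose k2 (z : measurableTypeR R * E) := (\1_`[0, t] z.1)%:C * (cexpi (dotp x z.2) * kernel z).
have mi : measT (fun s : measurableTypeR R => (\1_`[0, t] s : R)).
  exact: measurable_indic.
have m1 : measT (fun z : measurableTypeR R * E => (\1_`[0, t] z.1 : R)).
  exact: (measurableT_comp mi measurable_fst).
have mk2 : cmeas k2.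
  apply: cmeasMr => //; apply: cmeasM => //.
  exact: (cmeas_comp measurable_snd (cmeas_wave x)).
transitivity (cintegral leb setT (fun s => cintegral mu setT (fun xi => k2 (s, xi)))).
  apply: eq_cintegral => s _; rewrite /k2 /inv_fourier -cintegralMl//.
  by apply: cint_wave; exact: nice_int (nice_kernel s).
have Iind : (\int[leb]_s (\1_`[0, t] s)%:E = t%:E)%E.
  rewrite integral_indic// ?setIT ?setTI /= lebesgue_measure_itv/= lte_fin.
  by case: ltP => [_|t1]; rewrite ?sube0//; congr (_%:E); apply/eqP; rewrite eq_le t0.
set C := 2 * (M * (8 * M) ^+ j).
have nk s : nice (2 * C) (fun xi => cexpi (dotp x xi) * kernel (s, xi)).
  exact: niceMc (cmeas_wave x) (fun xi => l1n_cexpi (dotp x xi)) (nice_kernel s).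
have C0 : 0 <= C by rewrite mulr_ge0.
have Iind0 c : 0 <= c -> (\int[leb]_s (c * \1_`[0, t] s)%:E < +oo)%E.
  move=> c0; under eq_integral do rewrite EFinM.
  rewrite ge0_integralZl_EFin//; first by rewrite Iind -EFinM ltry.
  by apply/measurable_EFinP; exact: measurable_indic.
have mIc c : measT (fun s : measurableTypeR R => c * \1_`[0, t] s : R).
  by apply: measurable_funM => //; exact: measurable_indic.
have C20 : 0 <= 2 * C by rewrite mulr_ge0.
rewrite (cfubini_dominated (g := fun s : measurableTypeR R => 2 * C * \1_`[0, t] s)) ?(Iind0 _ C20)//.
  apply: eq_cintegral => xi _; rewrite /k2 /duhamel_integral -cintegralMl.
    by apply: eq_cintegral => s _; rewrite mulrCA.
  have mks : cmeas (fun s : measurableTypeR R => kernel (s, xi)).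
    exact: (cmeas_comp (pair2_measurable xi) cmeas_kernel).
  apply: (@le_cintegrable _ _ _ _ _ (fun s : measurableTypeR R => C * \1_`[0, t] s)) => //.
  - by apply: cmeasMr mks; exact: measurable_indic.
  - move=> s; rewrite l1nMr mulrC ger0_norm; last by rewrite indicE.
    by rewrite ler_wpM2r ?indicE//; exact: nice_sup (nice_kernel s) _.
  - exact: Iind0.
move=> s; apply: le_trans (nice_L1 (niceZ (\1_`[0, t] s) (nk s))) _.
by rewrite lee_fin mulrC ger0_norm// indicE.
Qed.

End duhamel_at.

Lemma evolution_duhamel (T : R) : T * rho <= 16^-1 ->
  duhamel j.+1 T (inv_fourier v0) (inv_fourier v1) (fun t => inv_fourier (evol t)).
Proof.
move=> Tr t; rewrite in_itv/= => /andP[t0 tT].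
have tr s : s <= T -> s * rho <= 16^-1.
  by move=> sT; apply: le_trans Tr; rewrite ler_wpM2r// ltW.
exists (inv_fourier (fun xi => (cos_symbol t xi)%:C * v0 xi)).
exists (inv_fourier (fun xi => (sinc_symbol t xi)%:C * v1 xi)).
exists (fun s => inv_fourier (fun xi => (duhamel_symbol (t - s) xi)%:C * evol_pow s xi)).
split.
- exists v0; split; first exact: nice_FL1_fourier nv0.
  exact: nice_FL1_fourier (niceMr (measurable_cos_symbol t) (cos_symbol_le t) nv0).
- exists v1; split; first exact: nice_FL1_fourier nv1.
  exact: nice_FL1_fourier (niceMr (measurable_sinc_symbol t) (sinc_symbol_le t) nv1).
- move=> s; rewrite in_itv/= => /andP[s0 st]; have sr := tr s (le_trans st tT).
  exists (evol_pow s).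
  have np := nice_evolution_pow nv0 nv1 rho4 rhoM s0 sr.
  split.
    split; first exact: nice_int np.
    by move=> x; rewrite (evolution_powE nv0 nv1 rho4 rhoM s0 sr).
  exact: nice_FL1_fourier (niceMr (measurable_duhamel_symbol (t - s)) (duhamel_symbol_le (t - s)) np).
- by move=> x; apply: duhamel_formula => //; exact: tr.
Qed.

Theorem evolution_solution (T : R) : 0 < T -> T * rho <= 16^-1 ->
  solution j.+1 T (inv_fourier v0) (inv_fourier v1) (fun t => inv_fourier (evol t)).
Proof.
move=> T0 Tr.
have tr s : s <= T -> s * rho <= 16^-1.
  by move=> sT; apply: le_trans Tr; rewrite ler_wpM2r// ltW.
split => //; last exact: evolution_duhamel.
- move=> t; rewrite in_itv/= => /andP[t0 tT]; split.
    apply: le_lt_trans (ltry (2 * M)).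
    by apply: FL1_norm_le (nice_evolution nv0 nv1 rho4 rhoM t0 (tr _ tT)) _.
  apply: (@ereal_squeeze0 _ _ _ _ _ (fun s => 8 * M * rho * `|s - t|)).
  + by apply: nearW => s; exact: FL1_norm_ge0.
  + rewrite near_withinE; apply: nearW => s; rewrite /= in_itv/= => /andP[s0 sT].
    apply: FL1_norm_le (nice_evolutionB s0 sT t0 tT Tr) _ => x.
    by apply: inv_fourier_evolutionB => //; exact: tr.
  + rewrite -[X in _ --> X](mulr0 (8 * M * rho)).
    apply: cvgM; first exact: cvg_cst.
    apply: cvg_within_filter.
    have : `|s - t| @[s --> t] --> `|t - t|.
      by apply: cvg_norm; apply: cvgB; [exact: cvg_id|exact: cvg_cst].
    by rewrite subrr normr0.
- by rewrite evolution0.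
- apply: (@ereal_squeeze0 _ _ _ _ _ (fun h => 2 * M * rho ^+ 2 * h)).
  + by apply: nearW => s; exact: FL1_norm_ge0.
  + near=> h.
    have h0 : 0 < h by near: h; exact: nbhs_right_gt.
    have hT : h <= T by near: h; exact: nbhs_right_le.
    (* The difference quotient minus [v1] is 1/h times the tail of order 2 of the series, hence
       O(h). *)
    have nt := nice_evolution_tail nv0 nv1 rho4 rhoM (ltW h0) (tr _ hT) 2.
    have := niceZ h^-1 nt.
    rewrite (_ : `|h^-1| * _ = 2 * M * rho ^+ 2 * h); last first.
      by rewrite gtr0_norm ?invr_gt0// exprMn expr2; field; rewrite gt_eqF.
    move=> nq; apply: FL1_norm_le nq _ => x.
    have ne := nice_evolution nv0 nv1 rho4 rhoM (ltW h0) (tr _ hT).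
    rewrite evolution0 -inv_fourierB; [|exact: nice_int ne|exact: nice_int nv0].
    rewrite -inv_fourierZ; last exact: nice_int (niceB ne nv0).
    rewrite -inv_fourierB; [|exact: nice_int (niceZ _ (niceB ne nv0))|exact: nice_int nv1].
    congr (inv_fourier _ x); apply/funext => xi.
    have hh : (h^-1)%:C * (h%:C * v1 xi) = v1 xi.
      by rewrite mulrA -rmorphM mulVf ?gt_eqF// mul1r.
    rewrite big_ord_recl big_ord1 !taylorE /= expr0 expr1 mul1r -[in LHS]hh.
    by ring.
  + rewrite -[X in _ --> X](mulr0 (2 * M * rho ^+ 2)).
    apply: cvgM; first exact: cvg_cst.
    exact: cvg_at_right_filter.
Unshelve. all: by end_near.
Qed.

End solution_of_power_series.

(** * Schwartz functions and the Gaussian *)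

Section lipschitz_measurable.
Context {R : realType} {d : nat}.
Local Notation E := (Euc R d).
Variables (f : E -> R) (K : R).
Hypotheses (K0 : 0 <= K)
  (fK : forall x y : E, `|f x - f y| <= K * \sum_(i < d) `|tnth x i - tnth y i|).

Let node (n : nat) : E :=
  if unpickle n is Some q then [tuple ratr (tnth (q : d.-tuple rat) i) | i < d]
  else [tuple 0 | i < d].

Let upper (n : nat) (x : E) : R :=
  f (node n) + K * \sum_(i < d) `|tnth x i - tnth (node n) i|.

Let measurable_upper n : measT (upper n).
Proof.
apply: measurable_funD => //; apply: measurable_funM => //.
apply: measurable_sum => i.
apply: (measurableT_comp (@normr_measurable R setT)).
by apply: measurable_funB => //; exact: measurable_tnth.
Qed.

Let upper_ge n x : f x <= upper n x.
Proof.
by rewrite /upper -lerBlDl; apply: le_trans (ler_norm _) _; exact: fK.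
Qed.

Let node_dense (x : E) (e : R) : 0 < e ->
  exists n, forall i, `|tnth x i - tnth (node n) i| <= e.
Proof.
move=> e0.
have q i : {q : rat | `|tnth x i - ratr q| <= e}.
  apply: cid.
  have [q] := @rat_in_itvoo R (tnth x i) (tnth x i + e) (ltac:(by rewrite ltrDl)).
  rewrite in_itv/= => /andP[q1 q2]; exists q.
  by rewrite ler0_norm ?subr_le0 ?(ltW q1)// opprB lerBlDl ltW.
exists (pickle [tuple sval (q i) | i < d]) => i.
by rewrite /node pickleK !tnth_mktuple; exact: (svalP (q i)).
Qed.

(* McShane extension from a countable dense set: f is a countable infimum of
   measurable functions. *)
Lemma lipschitz_measurable : measT f.
Proof.
rewrite (_ : f = fun x => infs (upper ^~ x) 0%N).
  apply: measurable_fun_infs => // x _.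
  by exists (f x) => _ [n _ <-]; exact: upper_ge.
apply/funext => x.
have nz : [set upper n x | n in [set: nat]] !=set0 by exists (upper 0 x); exists 0%N.
have -> : infs (upper ^~ x) 0%N = inf [set upper n x | n in [set: nat]].
  by congr inf; apply/seteqP; split => _ [n _ <-]; exists n.
apply/eqP; rewrite eq_le; apply/andP; split.
  by apply: lb_le_inf => // _ [n _ <-]; exact: upper_ge.
apply/ler_addgt0Pr => e e0.
(* At a node within c of x in each coordinate, [upper] exceeds f by at most 2 K d c, and this c
   makes it at most e; the 1 keeps the denominator positive. *)
have c0 : 0 < e / (2 * K * d%:R + 1).
  by rewrite divr_gt0// ltr_wpDl// !mulr_ge0.
have [n nx] := node_dense x c0.
apply: (@le_trans _ _ (upper n x)).
  apply: ge_inf; last by exists n.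
  by exists (f x) => _ [m _ <-]; exact: upper_ge.
rewrite /upper.
have S : \sum_(i < d) `|tnth x i - tnth (node n) i| <= d%:R * (e / (2 * K * d%:R + 1)).
  move: (e / _) nx => c nx.
  by rewrite -[X in X%:R](card_ord d) mulr_natl -sumr_const; apply: ler_sum => i _; exact: nx.
have := fK (node n) x; rewrite ler_norml => /andP[_].
rewrite (eq_bigr (fun i => `|tnth x i - tnth (node n) i|)); last by move=> i _; rewrite distrC.
move: (\sum_(i < d) _) S => S Sle h.
have KS : K * S <= K * (d%:R * (e / (2 * K * d%:R + 1))) by rewrite ler_wpM2l.
suff : 2 * (K * (d%:R * (e / (2 * K * d%:R + 1)))) <= e by lra.
rewrite !mulrA ler_pdivrMr; last by rewrite ltr_wpDl// !mulr_ge0.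
have : 0 <= K * d%:R by rewrite mulr_ge0.
by move: (K * d%:R) (d%:R : R) => a b a0; lra.
Qed.

End lipschitz_measurable.

(** * Schwartz functions are measurable, bounded and integrable *)

Section schwartz_functions.
Context {R : realType} {d : nat}.
Local Notation E := (Euc R d).
Local Notation mu := (lebesgue R d).
Implicit Types (phi : E -> R[i]).

Lemma tnth_coord_shift (i k : 'I_d) (h : R) (x : E) :
  tnth (Defs.shift i h x) k = if k == i then tnth x k + h else tnth x k.
Proof. by rewrite tnth_mktuple. Qed.

Lemma coord_shiftD (i : 'I_d) (h h' : R) (x : E) :
  Defs.shift i (h + h') x = Defs.shift i h' (Defs.shift i h x).
Proof.
apply: eq_from_tnth => k; rewrite !tnth_coord_shift; case: ifP => // _.
by rewrite addrA.
Qed.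

Lemma coord_shift0 (i : 'I_d) (x : E) : Defs.shift i 0 x = x.
Proof. by apply: eq_from_tnth => k; rewrite tnth_coord_shift addr0 if_same. Qed.

(** The derivative at 0 is known from every base point, hence along the whole line through x by
    moving the base point; the mean value theorem applies. *)
Lemma partial_lipschitz (i : 'I_d) (f f' : E -> R) (K : R) :
  (forall x, is_derive 0 (1 : R) (fun h : R => f (Defs.shift i h x)) (f' x)) ->
  (forall x, `|f' x| <= K) ->
  forall x h, `|f (Defs.shift i h x) - f x| <= K * `|h|.
Proof.
move=> df fK x h.
have dF (y : R) : is_derive y (1 : R) (fun h : R => f (Defs.shift i h x)) (f' (Defs.shift i y x)).
  have dg : is_derive y (1 : R) (fun h : R => h - y) 1.
    have h1 := is_deriveB (is_derive_id y (1 : R)) (is_derive_cst y y 1).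
    by apply: (is_derive_eq h1); rewrite subr0.
  have dG : is_derive (y - y) (1 : R) (fun h : R => f (Defs.shift i h (Defs.shift i y x)))
      (f' (Defs.shift i y x)) by rewrite subrr; exact: df.
  have := @is_derive1_comp _ (fun h : R => f (Defs.shift i h (Defs.shift i y x)))
    (fun h : R => h - y) y _ _ dG dg; rewrite mulr1.
  rewrite (_ : _ \o _ = (fun h : R => f (Defs.shift i h x)))//.
  by apply/funext => z /=; rewrite -coord_shiftD addrC subrK.
have cF y : {for y, continuous (fun h : R => f (Defs.shift i h x))}.
  apply: (@differentiable_continuous _ _ _ _ (fun h : R => f (Defs.shift i h x))).
  by apply/derivable1_diffP; have := dF y => ?; apply: ex_derive.
have K0 : 0 <= K := le_trans (normr_ge0 _) (fK x).
rewrite -{2}[x](coord_shift0 i).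
have [h0|h0] := leP 0 h.
  have [c _ ->] := @MVT_segment R _ _ 0 h h0 (fun y _ => dF y) (continuous_subspaceT cF).
  by rewrite subr0 normrM ler_wpM2r.
have [c _] := @MVT_segment R _ _ h 0 (ltW h0) (fun y _ => dF y) (continuous_subspaceT cF).
by rewrite distrC => ->; rewrite sub0r normrM normrN ler_wpM2r.
Qed.

Lemma lipschitz_of_partials (f : E -> R) (K : 'I_d -> R) :
  (forall i x h, `|f (Defs.shift i h x) - f x| <= K i * `|h|) ->
  forall x y, `|f x - f y| <= (\sum_(i < d) `|K i|) * \sum_(i < d) `|tnth x i - tnth y i|.
Proof.
move=> fK x y.
(* A path from y to x that replaces one coordinate at a time: [z m] takes its first m coordinates
   from x and the others from y. *)
pose z m : E := [tuple (if (i < m)%N then tnth x i else tnth y i) | i < d].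
have z0 : z 0%N = y by apply: eq_from_tnth => i; rewrite tnth_mktuple.
have zd : z d = x by apply: eq_from_tnth => i; rewrite tnth_mktuple ltn_ord.
have zS (m : 'I_d) : z m.+1 = Defs.shift m (tnth x m - tnth y m) (z m).
  apply: eq_from_tnth => i; rewrite tnth_coord_shift !tnth_mktuple ltnS leq_eqVlt.
  case: (eqVneq i m) => [->|im]; first by rewrite eqxx ltnn addrC subrK.
  by rewrite -val_eqE in im; rewrite (negbTE im).
have -> : f x - f y = \sum_(i < d) (f (z i.+1) - f (z i)).
  by rewrite -(big_mkord xpredT (fun i => f (z i.+1) - f (z i))) telescope_sumr// z0 zd.
apply: le_trans (ler_norm_sum _ _ _) _; rewrite mulr_sumr; apply: ler_sum => i _.
rewrite zS; apply: le_trans (fK _ _ _) _; rewrite ler_wpM2r//.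
apply: le_trans (ler_norm _) _.
by rewrite (bigD1 i)//= lerDl sumr_ge0.
Qed.

(** [schwartz] only speaks of derivatives along the axes. Bounded first partial derivatives make the
    real and imaginary parts Lipschitz, and Lipschitz functions are measurable. *)
Lemma schwartz_cmeas phi : schwartz phi -> cmeas phi.
Proof.
move=> [phi1 phi2].
have /choice[K HK] : forall i : 'I_d, exists K : R, forall x, Normc.normc (pderives [:: i] phi x) <= K.
  move=> i; have [K HK] := phi2 [:: i] 0%N; exists K => x.
  by have := HK x; rewrite expr0 mul1r.
have key (pr : R[i] -> R) : (forall z, `|pr z| <= Normc.normc z) ->
    (forall i x, is_derive 0 (1 : R) (fun h : R => pr (phi (Defs.shift i h x)))
      (pr (pderive i phi x))) -> measT (fun x => pr (phi x)).
  move=> prle dpr.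
  apply: (@lipschitz_measurable _ _ _ (\sum_(i < d) `|K i|)); first exact: sumr_ge0.
  apply: lipschitz_of_partials => i; apply: partial_lipschitz (dpr i) _ => x.
  exact: le_trans (prle _) (HK i x).
split; [apply: (key _ Re_le_normc)|apply: (key _ Im_le_normc)] => i x;
  have [h1 h2] := phi1 [::] i x; by apply: DeriveDef => //; rewrite /= derive1E.
Qed.

Lemma rapid_decay_nice phi (K0 K : R) : cmeas phi ->
  (forall x, Normc.normc (phi x) <= K0) ->
  (forall x, japanese x ^+ (2 * d) * Normc.normc (phi x) <= K) ->
  exists L, nice L phi.
Proof.
move=> mphi b0 b1.
have cw x : l1n (phi x) <= 2 * K * cauchy_weight x.
  apply: le_trans (l1n_le_normc _) _; rewrite -mulrA ler_wpM2l//.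
  apply: (@le_trans _ _ (Normc.normc (phi x) * (japanese x ^+ (2 * d) * cauchy_weight x))).
    by rewrite ler_peMr ?normc_ge0//; exact: japanese_cauchy_weight.
  by rewrite mulrA ler_wpM2r ?cauchy_weight_ge0// mulrC.
have K0' : 0 <= K.
  apply: le_trans (b1 point); rewrite mulr_ge0 ?normc_ge0// exprn_ge0//.
  exact: ltW (japanese_gt0 _).
have : (\int[mu]_x (l1n (phi x))%:E < +oo)%E.
  apply: (@le_lt_trans _ _ (\int[mu]_x (2 * K * cauchy_weight x)%:E)%E).
    apply: le_integral_ge0 => //.
    - exact: measurable_l1n.
    - by apply: measurable_funM => //; exact: measurable_cauchy_weight.
    - by move=> x; exact: l1n_ge0.
  under eq_integral do rewrite EFinM.
  rewrite ge0_integralZl_EFin//.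
  - by apply: lte_mul_pinfty; rewrite ?lee_fin ?mulr_ge0//; exact: integral_cauchy_weight.
  - by move=> x _; rewrite lee_fin cauchy_weight_ge0.
  - by apply/measurable_EFinP; exact: measurable_cauchy_weight.
  - by rewrite mulr_ge0.
move=> foo.
have f0 : (0 <= \int[mu]_x (l1n (phi x))%:E)%E.
  by apply: integral_ge0 => x _; rewrite lee_fin l1n_ge0.
exists (2 * K0 + fine (\int[mu]_x (l1n (phi x))%:E)%E); split => //.
  move=> x; apply: le_trans (l1n_le_normc _) _.
  by rewrite -[leLHS]addr0 lerD ?fine_ge0// ler_wpM2l.
have K00 : 0 <= K0 := le_trans (normc_ge0 _) (b0 point).
by rewrite EFinD fineK ?ge0_fin_numE// leeDr// lee_fin mulr_ge0.
Qed.

Lemma schwartz_nice phi : schwartz phi -> exists K, nice K phi.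
Proof.
move=> sphi; have mphi := schwartz_cmeas sphi; have [_ phi2] := sphi.
have [K0 H0] := phi2 [::] 0%N; have [K H] := phi2 [::] (2 * d)%N.
apply: rapid_decay_nice mphi _ H => x.
by have := H0 x; rewrite expr0 mul1r; exact.
Qed.

Lemma cmeas_inv_fourier phi : cmeas phi -> cmeas (inv_fourier phi).
Proof.
move=> mphi.
have mk : cmeas (fun z : E * E => cexpi (dotp z.1 z.2) * phi z.2).
  apply: cmeasM; last exact: (cmeas_comp measurable_snd mphi).
  by apply: cmeas_cexpi; exact: measurable_dotp.
exact: (cmeas_cintegral1 mu mk).
Qed.

Lemma cint_mul_inv_fourier (g phi : E -> R[i]) K : cintegrable mu setT g -> nice K phi ->
  cintegrable mu setT (fun xi => g xi * inv_fourier phi xi).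
Proof.
move=> cg nphi.
under eq_fun do rewrite mulrC.
apply: (@cintM_bounded _ _ _ _ _ _ (2 * K)) => //.
  by apply: cmeas_inv_fourier; exact: nice_meas nphi.
by move=> x; exact: l1n_inv_fourier.
Qed.

(** Fubini, the kernel being symmetric in x and xi. It says that the distribution given by the
    function [inv_fourier g] has Fourier transform g in the sense of [has_fourier]. *)
Lemma cintegral_inv_fourierC (g phi : E -> R[i]) K L : nice K g -> nice L phi ->
  cintegral mu setT (fun x => inv_fourier g x * phi x) =
  cintegral mu setT (fun xi => g xi * inv_fourier phi xi).
Proof.
move=> ng nphi; have [mg _ g1] := ng; have [mphi _ _] := nphi.
pose k (z : E * E) := cexpi (dotp z.1 z.2) * g z.2 * phi z.1.
have mk : cmeas k.
  apply: cmeasM; last exact: (cmeas_comp measurable_fst mphi).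
  apply: cmeasM; last exact: (cmeas_comp measurable_snd mg).
  by apply: cmeas_cexpi; exact: measurable_dotp.
transitivity (cintegral mu setT (fun x => cintegral mu setT (fun xi => k (x, xi)))).
  apply: eq_cintegral => x _; rewrite /inv_fourier -cintegralMr//.
  by apply: cint_wave; exact: nice_int ng.
rewrite (cfubini_dominated (g := fun x => 2 * K * l1n (phi x)) mk).
- apply: eq_cintegral => xi _; rewrite /inv_fourier -cintegralMl.
    by apply: eq_cintegral => x _; rewrite /k /= dotpC; ring.
  by apply: cint_wave; exact: nice_int nphi.
- by apply: measurable_funM => //; exact: measurable_l1n.
- move=> x; rewrite mulrC.
  have nw := niceMc (cmeas_wave x) (fun xi => l1n_cexpi (dotp x xi)) ng.
  apply: le_trans (nice_L1 (niceMc (cmeas_cst _ (phi x)) (fun=> lexx _) nw)).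
  by under [leRHS]eq_integral do rewrite mulrC.
have K20 : 0 <= 2 * K by rewrite mulr_ge0// (nice_ge0 ng).
rewrite integral_l1nZ//; apply: lte_mul_pinfty; rewrite ?lee_fin//.
exact: cint_lty (nice_int nphi).
Qed.

Lemma has_fourier_inv_fourier (g : E -> R[i]) K : nice K g ->
  has_fourier (distr_of (inv_fourier g)) g.
Proof.
move=> ng; split; first exact: nice_meas ng.
move=> phi /schwartz_nice[L nphi]; split.
  exact: cint_mul_inv_fourier (nice_int ng) nphi.
exact: cintegral_inv_fourierC ng nphi.
Qed.

Lemma has_fourier_sub (g g0 : E -> R[i]) (T : distr R d) K : nice K g ->
  has_fourier T g0 ->
  has_fourier (distr_sub (distr_of (inv_fourier g)) T) (fun xi => g xi - g0 xi).
Proof.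
move=> ng [mg0 Tg0]; have [mg Tg] := has_fourier_inv_fourier ng.
split; first exact: cmeasB.
move=> phi sphi; have [i1 e1] := Tg phi sphi; have [i0 e0] := Tg0 phi sphi.
rewrite (_ : (fun xi => _) = (fun xi => g xi * inv_fourier phi xi - g0 xi * inv_fourier phi xi)).
  by split; [exact: cintB|rewrite /distr_sub e1 e0 cintegralB].
by apply/funext => xi; rewrite mulrBl.
Qed.

End schwartz_functions.

(** * The Fourier transform of the one-dimensional Gaussian *)

Section gaussian1.
Context {R : realType}.
Local Notation leb := (@lebesgue_measure R).
Local Notation g := (@gauss_fun R).

(** From 1 + y^2 / 2 <= e^y at y = x^2. It makes [|x| * g x] integrable, the majorant for
    differentiating under the integral. *)
Lemma gauss_coord_le (x : R) : `|x| * g x <= 2 * (1 + x ^+ 2)^-1.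
Proof.
rewrite /gauss_fun expRN.
have h : 1 + (x ^+ 2) ^+ 2 / 2 <= expR (x ^+ 2).
  exact: (@expR_ge1Dxn R (x ^+ 2) 1 (sqr_ge0 x)).
rewrite ler_pdivrMr ?expR_gt0// mulrAC ler_pdivlMr; last by rewrite ltr_pwDl// sqr_ge0.
apply: (@le_trans _ _ (2 * (1 + (x ^+ 2) ^+ 2 / 2))); last by rewrite ler_wpM2l.
rewrite -(real_normK (num_real x)); move: `|x| (normr_ge0 x) => y y0.
have := sqr_ge0 (y - 1); have := sqr_ge0 (y ^+ 2 - 1); nra.
Qed.

Lemma integral_Rexhaust (f : R -> R) : leb.-integrable setT (EFin \o f) ->
  \int[leb]_(x in `[- n%:R, n%:R]) f x @[n --> \oo] --> \int[leb]_x f x.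
Proof.
move=> If; have mf : measT f.
  by move/integrableP : If => [/measurable_EFinP].
pose D n : set R := `[- n%:R, n%:R]%classic.
have mfn n : measT (fun x => (\1_(D n) x * f x)%:E).
  by apply/measurable_EFinP; apply: measurable_funM => //; apply: measurable_indic; exact: measurable_itv.
have [||||_ _] := @dominated_convergence _ _ R leb setT measurableT
  (fun n x => (\1_(D n) x * f x)%:E) (EFin \o f) (fun x => `|f x|%:E) mfn.
- exact/measurable_EFinP.
- apply: aeW => x _; apply: cvg_near_cst.
  have [N HN] : exists N : nat, `|x| <= N%:R.
    by exists (Num.truncn `|x|).+1; rewrite ltW// truncnS_gt.
  exists N => // n /= Nn.
  by rewrite indicE mem_set ?mul1r//= /D/= in_itv/= -ler_norml (le_trans HN)// ler_nat.
- exact: integrable_norm.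
- apply: aeW => x n _; rewrite /= lee_fin normrM ler_piMl//.
  by rewrite indicE; case: (x \in _); rewrite ?normr1 ?normr0.
move=> h; rewrite [X in X @ _ --> _](_ : _ = fun n => fine (\int[leb]_x (\1_(D n) x * f x)%:E)%E).
  apply: fine_cvg; rewrite /Rintegral fineK//.
  exact: (@integrable_fin_num _ _ _ leb).
apply/funext => n; rewrite Rintegral_mkcond /Rintegral; congr fine.
apply: eq_integral => x _; rewrite patchE indicE.
by case: (x \in _); rewrite ?mul1r ?mul0r.
Qed.

Lemma integrable_coord_gauss : leb.-integrable setT (fun x : R => (`|x| * g x)%:E).
Proof.
apply: (@integrable_dominated _ (measurableTypeR R) _ leb _ (fun x : R => 2 * (1 + x ^+ 2)^-1)).
- by apply: measurable_funM; [exact: normr_measurable|exact: measurable_gauss_fun].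
- by apply: measurable_funM => //; exact: measurable_oneDsqrV.
- move=> x; rewrite ger0_norm; last by rewrite mulr_ge0// gauss_fun_ge0.
  exact: gauss_coord_le.
- under eq_integral do rewrite EFinM.
  rewrite ge0_integralZl_EFin//; last 2 first.
  + by move=> x _; rewrite lee_fin invr_ge0 addr_ge0// sqr_ge0.
  + by apply/measurable_EFinP; exact: measurable_oneDsqrV.
  by rewrite integral_oneDsqrV -EFinM ltry.
Qed.

(* The phase [a] treats the cosine ([a = 0]) and the sine ([a = - pi / 2])
   transforms at once. *)
Definition gauss_cos (a xi : R) : R := \int[leb]_x (cos (xi * x + a) * g x).

Lemma measurable_cos_affine (a xi : R) : measT (fun x : R => cos (xi * x + a)).
Proof.
apply: (measurableT_comp measurable_cosR).
by apply: measurable_funD => //; exact: measurable_funM.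
Qed.
Lemma measurable_sin_affine (a xi : R) : measT (fun x : R => sin (xi * x + a)).
Proof.
apply: (measurableT_comp measurable_sinR).
by apply: measurable_funD => //; exact: measurable_funM.
Qed.

Lemma integrable_cos_gauss (a xi : R) :
  leb.-integrable setT (fun x : R => (cos (xi * x + a) * g x)%:E).
Proof.
apply: (@integrable_dominated _ (measurableTypeR R) _ leb _ g).
- by apply: measurable_funM; [exact: measurable_cos_affine|exact: measurable_gauss_fun].
- exact: measurable_gauss_fun.
- move=> x; rewrite normrM [X in _ * X <= _]ger0_norm ?gauss_fun_ge0//.
  by rewrite ler_piMl ?gauss_fun_ge0// ler_norml cos_geN1 cos_le1.
- by rewrite integralT_gauss ltry.
Qed.

Lemma integrable_sin_gauss (a xi : R) :
  leb.-integrable setT (fun x : R => (x * sin (xi * x + a) * g x)%:E).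
Proof.
apply: le_integrable integrable_coord_gauss => //.
  apply/measurable_EFinP; apply: measurable_funM; last exact: measurable_gauss_fun.
  by apply: measurable_funM => //; exact: measurable_sin_affine.
move=> x _; rewrite /= lee_fin normrM normrM -mulrA [in leRHS]normrM normr_id.
rewrite ler_wpM2l// ler_piMl// sin_max//.
Qed.

Lemma is_derive_affine (a xi x : R) : is_derive x (1 : R) (fun x : R => xi * x + a) xi.
Proof.
have h := is_deriveD (is_deriveM (is_derive_cst xi x 1) (is_derive_id x (1 : R))) (is_derive_cst a x 1).
by apply: (is_derive_eq h); rewrite scaler0 !addr0 /GRing.scale/= mulr1.
Qed.

Lemma is_derive_gauss (x : R) : is_derive x (1 : R) g (- (2 * x * g x)).
Proof.
have h := is_deriveN (is_deriveX 2 (is_derive_id x (1 : R))).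
have := @is_derive1_comp _ expR _ x _ _ (is_derive_expR _) h.
rewrite (_ : _ \o _ = g)//.
  move=> h2; apply: (is_derive_eq h2).
  by rewrite /gauss_fun /GRing.scale/= expr1; ring.
Qed.

(** Integration by parts: the derivative of sin(xi x + a) g(x) has integral 0 over the line because
    g vanishes at infinity. *)
Lemma gauss_parts (a xi : R) :
  \int[leb]_x (x * sin (xi * x + a) * g x) = xi / 2 * gauss_cos a xi.
Proof.
pose H (x : R) : R := sin (xi * x + a) * g x.
pose h (x : R) : R := xi * (cos (xi * x + a) * g x) - 2 * (x * sin (xi * x + a) * g x).
have dsin x : is_derive x (1 : R) (fun x : R => sin (xi * x + a)) (cos (xi * x + a) * xi).
  exact: (@is_derive1_comp _ sin (fun x : R => xi * x + a) x _ _ (is_derive_sin _) (is_derive_affine a xi x)).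
have dH x : is_derive x (1 : R) H (h x).
  have h1 := is_deriveM (dsin x) (is_derive_gauss x).
  by apply: (is_derive_eq h1); rewrite /h /GRing.scale/=; ring.
have Ic := integrable_cos_gauss a xi; have Is := integrable_sin_gauss a xi.
have Ih : leb.-integrable setT (EFin \o h).
  rewrite /h; under [X in integrable _ _ X]eq_fun do rewrite /= EFinB !EFinM.
  by apply: integrableB => //; exact: integrableZl.
have ch : continuous h.
  move=> x; have dcos : is_derive x (1 : R) (fun x : R => cos (xi * x + a)) (- sin (xi * x + a) * xi).
    exact: (@is_derive1_comp _ cos (fun x : R => xi * x + a) x _ _ (is_derive_cos _) (is_derive_affine a xi x)).
  have i1 := is_deriveM (is_derive_cst xi x 1) (is_deriveM dcos (is_derive_gauss x)).
  have i2 := is_deriveM (is_derive_cst (2 : R) x 1)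
     (is_deriveM (is_deriveM (is_derive_id x (1 : R)) (dsin x)) (is_derive_gauss x)).
  have := is_deriveB i1 i2 => i3.
  apply: (@differentiable_continuous _ _ _ _ h).
  by apply/derivable1_diffP; have [] := i3.
have H0 : \int[leb]_x h x = 0.
  have E n : \int[leb]_(x in `[- n.+1%:R, n.+1%:R]) h x = H n.+1%:R - H (- n.+1%:R).
    rewrite /Rintegral (@continuous_FTC2 R h H)//.
    - by rewrite -subr_gt0 opprK addr_gt0.
    - by apply: continuous_subspaceT => x; exact: ch.
    - have cH x : {for x, continuous H}.
        apply: (@differentiable_continuous _ _ _ _ H).
        by apply/derivable1_diffP; have [] := dH x.
      split.
      + by move=> x _; have [] := dH x.
      + by apply: cvg_at_right_filter; exact: cH.
      + by apply: cvg_at_left_filter; exact: cH.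
    - by move=> x _; rewrite derive1E; have [_ ->] := dH x.
  have c1 : \int[leb]_(x in `[- n.+1%:R, n.+1%:R]) h x @[n --> \oo] --> \int[leb]_x h x.
    by have := integral_Rexhaust Ih; rewrite -(cvg_shiftS (fun n => \int[leb]_(x in `[- n%:R, n%:R]) h x)).
  have c2 : \int[leb]_(x in `[- n.+1%:R, n.+1%:R]) h x @[n --> \oo] --> (0 : R).
    apply/norm_cvg0P.
    apply: (@squeeze_cvgr _ _ _ _ (cst 0) (fun n => 2 * g n.+1%:R)); last 2 first.
    - exact: cvg_cst.
    - rewrite -[X in _ --> X](mulr0 2); apply: cvgM; first exact: cvg_cst.
      rewrite (cvg_shiftS (fun n => g n%:R)).
      exact: (cvg_comp _ _ (@cvgr_idn R) (@cvg_gauss_fun R)).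
    apply: nearW => n; rewrite normr_ge0/= E.
    apply: le_trans (ler_normB _ _) _.
    have HB x : `|H x| <= g x.
      rewrite normrM [X in _ * X <= _]ger0_norm ?gauss_fun_ge0//.
      by rewrite ler_piMl ?gauss_fun_ge0// sin_max.
    have gN x : g (- x) = g x by rewrite /gauss_fun sqrrN.
    by rewrite mulr_natl mulr2n lerD// -gN.
  exact: (cvg_unique _ c1 c2).
have := H0; rewrite /h RintegralB//; last 2 first.
- by rewrite /comp; under eq_fun do rewrite EFinM; exact: integrableZl.
- by rewrite /comp; under eq_fun do rewrite EFinM; exact: integrableZl.
rewrite !RintegralZl// => h0.
by rewrite /gauss_cos; lra.
Qed.

Lemma is_derive_gauss_cos (a xi : R) :
  is_derive xi (1 : R) (gauss_cos a) (- (xi / 2) * gauss_cos a xi).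
Proof.
pose f (xi x : R) : R := cos (xi * x + a) * g x.
have df (x y : R) : is_derive x (1 : R) (f ^~ y) (- (y * sin (x * y + a) * g y)).
  have daff : is_derive x (1 : R) (fun x : R => x * y + a) y.
    have := is_derive_affine a y x.
    by under eq_fun do rewrite mulrC.
  have dcos : is_derive x (1 : R) (fun x : R => cos (x * y + a)) (- sin (x * y + a) * y).
    exact: (@is_derive1_comp _ cos (fun x : R => x * y + a) x _ _ (is_derive_cos _) daff).
  have h := is_deriveM dcos (is_derive_cst (g y) x 1).
  by apply: (is_derive_eq h); rewrite scaler0 add0r /GRing.scale/=; ring.
have pE x y : partial1of2 f x y = - (y * sin (x * y + a) * g y).
  by rewrite partial1of2E; have [_ ->] := df x y.
have Ia : [set` `]xi - 1, xi + 1[] xi by rewrite /= in_itv/= ltrDl ltrBlDr ltrDl ltr01.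
have i1 : forall x, [set` `]xi - 1, xi + 1[] x -> leb.-integrable setT (EFin \o f x).
  by move=> x _; exact: integrable_cos_gauss.
have d1 : forall x y, [set` `]xi - 1, xi + 1[] x -> setT y -> derivable (f ^~ y) x 1.
  by move=> x y _ _; have [] := df x y.
have G0 y : 0 <= `|y| * g y by rewrite mulr_ge0// gauss_fun_ge0.
have Gub : forall x y, [set` `]xi - 1, xi + 1[] x -> setT y ->
    `|partial1of2 f x y| <= `|y| * g y.
  move=> x y _ _; rewrite pE normrN !normrM -mulrA ler_wpM2l//.
  by rewrite [X in _ * X <= _]ger0_norm ?gauss_fun_ge0// ler_piMl ?gauss_fun_ge0// sin_max.
have D1 := @derivable_under_integral R _ (measurableTypeR R) leb f setT measurableT xi
  (xi - 1) (xi + 1) Ia i1 d1 _ G0 integrable_coord_gauss Gub.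
have D2 := @differentiation_under_integral R _ (measurableTypeR R) leb f setT measurableT xi
  (xi - 1) (xi + 1) Ia i1 d1 _ G0 integrable_coord_gauss Gub.
apply: DeriveDef; first exact: D1.
rewrite -derive1E D2.
transitivity (\int[leb]_x (- 1 * (x * sin (xi * x + a) * g x))).
  by apply: eq_Rintegral => x _; rewrite pE mulN1r.
rewrite RintegralZl//; last exact: integrable_sin_gauss.
by rewrite gauss_parts mulN1r mulNr.
Qed.

(** The transform G solves G' = - (xi / 2) G, so G times e^(xi^2 / 4) is constant; its value at 0 is
    cos a times the Gaussian integral. *)
Lemma gauss_cosE (a xi : R) :
  gauss_cos a xi = cos a * Num.sqrt pi * expR (- (xi ^+ 2 / 4)).
Proof.
pose F (x : R) : R := gauss_cos a x * expR (x ^+ 2 / 4).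
have dF x : is_derive x (1 : R) F 0.
  have d1 : is_derive x (1 : R) (fun x : R => x ^+ 2 / 4) (x / 2).
    have h := is_deriveM (is_deriveX 2 (is_derive_id x (1 : R))) (is_derive_cst (4^-1 : R) x 1).
    by apply: (is_derive_eq h); rewrite scaler0 add0r /GRing.scale/= expr1 mulr1; lra.
  have d2 := @is_derive1_comp _ expR (fun x : R => x ^+ 2 / 4) x _ _ (is_derive_expR _) d1.
  have h := is_deriveM (is_derive_gauss_cos a x) d2.
  by apply: (is_derive_eq h); rewrite /GRing.scale/=; ring.
have := is_derive_0_is_cst 0 xi dF.
rewrite /F expr0n/= mul0r expR0 mulr1 => E0.
have : gauss_cos a 0 = cos a * Num.sqrt pi.
  rewrite /gauss_cos.
  transitivity (\int[leb]_x (cos a * g x)).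
    by apply: eq_Rintegral => x _; rewrite mul0r add0r.
  rewrite RintegralZl//; last exact: integrableT_gauss.
  by rewrite /Rintegral integralT_gauss.
by move=> <-; rewrite E0 -mulrA -expRD subrr expR0 mulr1.
Qed.

Lemma gauss_cexpi_int (xi : R) :
  cintegrable leb setT (fun x => cexpi (xi * x) * (g x)%:C).
Proof.
split => /=.
  apply: eq_integrable (integrable_cos_gauss 0 xi) => //.
  by move=> x _ /=; rewrite mulr0 subr0 addr0.
apply: eq_integrable (integrable_cos_gauss (- (pi / 2)) xi) => //.
by move=> x _ /=; rewrite mulr0 add0r cosBpihalf.
Qed.

Lemma gauss_fourier1 (xi : R) :
  cintegral leb setT (fun x => cexpi (xi * x) * (g x)%:C) =
  (Num.sqrt pi * expR (- (xi ^+ 2 / 4)))%:C.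
Proof.
apply: complex_ext => /=.
  transitivity (gauss_cos 0 xi); last by rewrite gauss_cosE cos0 mul1r.
  by apply: eq_Rintegral => x _; rewrite mulr0 subr0 addr0.
transitivity (gauss_cos (- (pi / 2)) xi); last first.
  by rewrite gauss_cosE cosN cos_pihalf !mul0r.
by apply: eq_Rintegral => x _; rewrite mulr0 add0r cosBpihalf.
Qed.

End gaussian1.

Section gaussian_schwartz.
Context {R : realType} {d : nat}.
Local Notation E := (Euc R d).
Local Notation mu := (lebesgue R d).

Definition gaussd (x : E) : R := expR (- dotp x x).

(** Polynomials times the Gaussian, described by closure rules instead of coefficients. Closure
    under partial derivatives and rapid decay follow by induction, and together they make every
    member a Schwartz function. *)
Inductive poly_gauss : (E -> R) -> Prop :=
| poly_gauss_base : poly_gauss gaussd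
| poly_gauss_mul (i : 'I_d) f : poly_gauss f -> poly_gauss (fun x => tnth x i * f x)
| poly_gauss_scale (c : R) f : poly_gauss f -> poly_gauss (fun x => c * f x)
| poly_gauss_add f g : poly_gauss f -> poly_gauss g -> poly_gauss (fun x => f x + g x).

Lemma dotp_shift (i : 'I_d) (h : R) (x : E) :
  dotp (Defs.shift i h x) (Defs.shift i h x) = dotp x x + 2 * tnth x i * h + h ^+ 2.
Proof.
rewrite /dotp (bigD1 i)//= [in RHS](bigD1 i)//= tnth_coord_shift eqxx.
rewrite (eq_bigr (fun k => tnth x k * tnth x k)); last first.
  by move=> k ki; rewrite tnth_coord_shift (negbTE ki).
by move: (\sum_(i0 < d | _) _) (tnth x i) => S y; ring.
Qed.

Lemma poly_gauss_partial f (i : 'I_d) : poly_gauss f -> exists2 f', poly_gauss f' &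
  forall x, is_derive (0 : R) (1 : R) (fun h : R => f (Defs.shift i h x)) (f' x).
Proof.
elim => [|k {}f pf [f' pf' df]|c {}f _ [f' pf' df]|{}f g _ [f' pf' df] _ [g' pg' dg]].
- exists (fun x => -2 * (tnth x i * gaussd x)).
    by apply: poly_gauss_scale; apply: poly_gauss_mul; exact: poly_gauss_base.
  move=> x.
  have d1 : is_derive (0 : R) (1 : R) (fun h : R => - (dotp x x + 2 * tnth x i * h + h ^+ 2)) (- (2 * tnth x i)).
    have h := is_deriveN (is_deriveD (is_deriveD (is_derive_cst (dotp x x) (0 : R) (1 : R))
      (is_deriveM (is_derive_cst (2 * tnth x i) (0 : R) (1 : R)) (is_derive_id (0 : R) (1 : R))))
      (is_deriveX 2 (is_derive_id (0 : R) (1 : R)))).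
    by apply: (is_derive_eq h); rewrite /GRing.scale/=; ring.
  have d2 := @is_derive1_comp _ expR _ 0 _ _ (is_derive_expR _) d1.
  rewrite (_ : (fun h => _) = expR \o (fun h : R => - (dotp x x + 2 * tnth x i * h + h ^+ 2))).
    by apply: (is_derive_eq d2); rewrite /gaussd mulr0 expr0n/= !addr0; ring.
  by apply/funext => h; rewrite /gaussd dotp_shift.
- case: (eqVneq k i) => [->|ki].
    exists (fun x => f x + tnth x i * f' x) => [|x].
      by apply: poly_gauss_add => //; exact: poly_gauss_mul.
    have h := is_deriveM (is_deriveD (is_derive_cst (tnth x i) (0 : R) (1 : R))
      (is_derive_id (0 : R) (1 : R))) (df x).
    rewrite (_ : (fun h => _) = (cst (tnth x i) + id) * (fun h : R => f (Defs.shift i h x))).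
      apply: (is_derive_eq h); rewrite /GRing.scale/= coord_shift0 fctE /= addr0 add0r.
      by rewrite mulr1 addrC.
    by apply/funext => z; rewrite tnth_coord_shift eqxx.
  exists (fun x => tnth x k * f' x) => [|x]; first exact: poly_gauss_mul.
  have h := is_deriveM (is_derive_cst (tnth x k) (0 : R) (1 : R)) (df x).
  rewrite (_ : (fun h => _) = cst (tnth x k) * (fun h : R => f (Defs.shift i h x))).
    by apply: (is_derive_eq h); rewrite scaler0 addr0.
  by apply/funext => z; rewrite tnth_coord_shift (negbTE ki).
- exists (fun x => c * f' x) => [|x]; first exact: poly_gauss_scale.
  have h := is_deriveM (is_derive_cst c (0 : R) (1 : R)) (df x).
  by apply: (is_derive_eq h); rewrite scaler0 addr0.
- exists (fun x => f' x + g' x) => [|x]; first exact: poly_gauss_add.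
  exact: is_deriveD (df x) (dg x).
Qed.

Lemma expr_le_expR (N : nat) (y : R) : 0 <= y -> y ^+ N <= N`!%:R * expR y.
Proof.
move=> y0; case: N => [|N].
  by rewrite expr0 fact0 mul1r; have := expR_ge1Dx y; lra.
have := @expR_ge1Dxn R y N y0 => h.
have f0 : (0 : R) < N.+1`!%:R by rewrite ltr0n fact_gt0.
rewrite mulrC -ler_pdivrMr//; lra.
Qed.

(** Put y = c times the square of [japanese x]. As [japanese] is at least 1, its N-th power is at
    most (y / c)^N; moreover y^N <= N! e^y, and the Gaussian cancels e^y up to the factor e^c. *)
Lemma expR_enorm_decay (c : R) (N : nat) : 0 < c -> exists2 K : R, 0 <= K &
  forall x : E, japanese x ^+ N * expR (- (c * enorm x ^+ 2)) <= K.
Proof.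
move=> c0; exists (c^-1 ^+ N * (N`!%:R * expR c)) => [|x].
  by rewrite !mulr_ge0 ?expR_ge0// exprn_ge0// invr_ge0 ltW.
have j1 := japanese_ge1 x; set y := c * japanese x ^+ 2.
have y0 : 0 <= y by rewrite mulr_ge0 ?sqr_ge0// ltW.
apply: (@le_trans _ _ ((c^-1 * y) ^+ N * expR (- (c * enorm x ^+ 2)))).
  rewrite /y mulKf ?gt_eqF// ler_wpM2r ?expR_ge0// lerXn2r ?nnegrE//; nra.
rewrite exprMn -mulrA ler_wpM2l ?exprn_ge0 ?invr_ge0 ?(ltW c0)//.
apply: (@le_trans _ _ (N`!%:R * expR y * expR (- (c * enorm x ^+ 2)))).
  by rewrite ler_wpM2r ?expR_ge0// expr_le_expR.
by rewrite -mulrA -expRD /y sqr_japanese mulrDr mulr1 addrK.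
Qed.

Lemma poly_gauss_decay f : poly_gauss f -> forall N : nat,
  exists K : R, forall x, japanese x ^+ N * `|f x| <= K.
Proof.
have J0 N (x : E) : 0 <= japanese x ^+ N by rewrite exprn_ge0// ltW// japanese_gt0.
elim => [|k {}f _ IH|c {}f _ IH|{}f g _ IHf _ IHg] N.
- have [K _ HK] := expR_enorm_decay N ltr01; exists K => x; apply: le_trans (HK x).
  by rewrite ger0_norm ?expR_ge0// mul1r sqr_sqrtr// dotp_ge0.
- have [K HK] := IH N.+1; exists K => x; apply: le_trans (HK x).
  rewrite normrM mulrA exprSr ler_wpM2r// ler_wpM2l//.
  exact: coord_le_japanese.
- have [K HK] := IH N; exists (`|c| * K) => x.
  by rewrite normrM mulrCA ler_wpM2l.
- have [K HK] := IHf N; have [L HL] := IHg N; exists (K + L) => x.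
  by apply: le_trans (lerD (HK x) (HL x)); rewrite -mulrDr ler_wpM2l// ler_normD.
Qed.

Lemma pderive_poly_gauss f (i : 'I_d) : poly_gauss f -> exists f', [/\ poly_gauss f',
  forall x, pderivable i (fun x => (f x)%:C) x &
  pderive i (fun x => (f x)%:C) = (fun x => (f' x)%:C)].
Proof.
move=> pf; have [f' pf' df] := poly_gauss_partial i pf.
exists f'; split => //.
  move=> x; split; first by have [] := df x.
  exact: derivable_cst.
apply/funext => x; rewrite /pderive /=; apply: complex_ext => /=.
  by rewrite derive1E; have [_ ->] := df x.
by rewrite derive1_cst.
Qed.

Lemma pderives_poly_gauss f (a : seq 'I_d) : poly_gauss f ->
  exists2 f', poly_gauss f' & pderives a (fun x => (f x)%:C) = (fun x => (f' x)%:C).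
Proof.
move=> pf; elim: a => [|i a [f' pf' E1]]; first by exists f.
have [f2 [pf2 _ E2]] := pderive_poly_gauss i pf'.
by exists f2 => //; rewrite /= -/(pderives a _) E1 E2.
Qed.

Lemma schwartz_poly_gauss f : poly_gauss f -> schwartz (fun x => (f x)%:C).
Proof.
move=> pf; split.
  move=> a i x; have [f' pf' ->] := pderives_poly_gauss a pf.
  by have [f2 [_ + _]] := pderive_poly_gauss i pf'; exact.
move=> a N; have [f' pf' ->] := pderives_poly_gauss a pf.
have [K HK] := poly_gauss_decay pf' N; exists K => x.
by rewrite /Normc.normc /= expr0n/= addr0 sqrtr_sqr.
Qed.

Definition gaussian (x : E) : R[i] := (gaussd x)%:C.

Lemma schwartz_gaussian : schwartz gaussian.
Proof. by apply: schwartz_poly_gauss; exact: poly_gauss_base. Qed.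

Definition gauss_hat (xi : E) : R :=
  Num.sqrt pi ^+ d * expR (- (enorm xi ^+ 2 / 4)).

Lemma cexpi_sum n (F : 'I_n -> R) : cexpi (\sum_(i < n) F i) = \prod_(i < n) cexpi (F i).
Proof.
have c0 : cexpi 0 = 1 :> R[i] by apply: complex_ext; rewrite /= ?cos0 ?sin0.
by elim/big_rec2: _ => [//|i y x _ <-]; rewrite cexpiD.
Qed.

Lemma inv_fourier_gaussian (xi : E) : inv_fourier gaussian xi = (gauss_hat xi)%:C.
Proof.
rewrite /inv_fourier.
transitivity (cintegral mu setT (fun x => \prod_(i < d)
    (cexpi (tnth xi i * tnth x i) * (gauss_fun (tnth x i))%:C))).
  apply: eq_cintegral => x _; rewrite big_split/= -cexpi_sum; congr (_ * _).
  rewrite -rmorph_prod /gaussian /gaussd; congr (_%:C).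
  rewrite /gauss_fun -expR_sum /dotp -sumrN; congr expR.
rewrite (cintegral_prod (c := fun i x => cexpi (tnth xi i * x) * (gauss_fun x)%:C)); last first.
  by move=> i; exact: gauss_cexpi_int.
under eq_bigr do rewrite gauss_fourier1.
rewrite -rmorph_prod big_split/= prodr_const card_ord -expR_sum /gauss_hat.
by rewrite sumrN -mulr_suml sqr_enorm.
Qed.

Lemma gauss_hat_gt0 (xi : E) : 0 < gauss_hat xi.
Proof. by rewrite mulr_gt0 ?expR_gt0// exprn_gt0// sqrtr_gt0 pi_gt0. Qed.

Lemma measurable_gauss_hat : measT gauss_hat.
Proof.
apply: measurable_funM => //; apply: (measurableT_comp (@measurable_expR R)).
apply: measurable_funN; apply: measurable_funM => //.
by apply: measurable_funX; exact: measurable_enorm.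
Qed.

Lemma gauss_hat_le (xi : E) : gauss_hat xi <= Num.sqrt pi ^+ d.
Proof.
rewrite ler_piMr ?exprn_ge0// -[leRHS]expR0 ler_expR oppr_le0.
by rewrite divr_ge0// sqr_ge0.
Qed.

Lemma gauss_hat_decay (N : nat) : exists2 K : R, 0 <= K &
  forall xi, japanese xi ^+ N * gauss_hat xi <= K.
Proof.
have [|K K0 HK] := @expR_enorm_decay 4^-1 N; first by rewrite invr_gt0.
exists (Num.sqrt pi ^+ d * K) => [|xi]; first by rewrite mulr_ge0// exprn_ge0.
by rewrite /gauss_hat mulrCA ler_wpM2l ?exprn_ge0// [_ / 4]mulrC.
Qed.

End gaussian_schwartz.

(** * Sobolev norms *)

Section Lnorm2.
Context d (T : measurableType d) {R : realType}.
Variable mu : {measure set T -> \bar R}.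
Implicit Types (f : T -> R).

Lemma poweR2_abse (x : R) : (`|x%:E| `^ 2 = (x ^+ 2)%:E)%E.
Proof. by rewrite /= powR_mulrn// real_normK ?num_real. Qed.

Lemma Lnorm2_le f (B : R) : 0 <= B ->
  (\int[mu]_x (f x ^+ 2)%:E <= (B ^+ 2)%:E)%E -> ('N[mu]_2%:E[(fun x => (f x)%:E)] <= B%:E)%E.
Proof.
move=> B0 fB; rewrite unlock.
under eq_integral do rewrite poweR2_abse.
have -> : B%:E = ((B ^+ 2)%:E `^ (2^-1))%E.
  by rewrite poweR_EFin -powR_mulrn// -powRrM mulfV// powRr1.
apply: gt0_ler_poweR => //; rewrite ?invr_ge0// in_itv/= leey andbT.
  by apply: integral_ge0 => x _; rewrite lee_fin sqr_ge0.
by rewrite lee_fin sqr_ge0.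
Qed.

Lemma Lnorm2_fin f : ('N[mu]_2%:E[(fun x => (f x)%:E)] < +oo)%E ->
  (\int[mu]_x (f x ^+ 2)%:E < +oo)%E.
Proof.
move=> fN; have := poweR_lty 2 fN; rewrite poweR_Lnorm//.
by under eq_integral do rewrite poweR2_abse.
Qed.

End Lnorm2.

Section sobolev_bounds.
Context {R : realType} {d : nat}.
Local Notation E := (Euc R d).
Local Notation mu := (lebesgue R d).
Local Notation ghat := (@gauss_hat R d).

Lemma measurable_japanese_powR (s : R) : measT (fun xi : E => japanese xi `^ s).
Proof. exact: (measurableT_comp (measurable_powR s) (@measurable_japanese R d)). Qed.

Lemma japanese_powR_le (s : R) : exists m : nat, forall xi : E,
  japanese xi `^ s <= japanese xi ^+ m.
Proof.
exists (Num.truncn `|s|).+1 => xi.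
rewrite -powR_mulrn ?(ltW (japanese_gt0 xi))//.
apply: ler_powR; first exact: japanese_ge1.
by rewrite (le_trans (ler_norm s))// ltW// truncnS_gt.
Qed.

(* The Gaussian is a Schwartz function: pairing with it is bounded in every
   H^sigma, however negative sigma is. *)
Lemma sobolev_norm_lower (sigma : R) : exists2 D : R, 0 < D &
  forall (U : E -> R[i]) (K c : R), nice K U ->
    c * D < `|\int[mu]_xi (cRe (U xi) * ghat xi)| ->
    (c%:E < sobolev_norm sigma (distr_of (inv_fourier U)))%E.
Proof.
have [m Hm] := japanese_powR_le (- sigma).
have [K K0 HK] := @gauss_hat_decay R d (m + d).
pose h (xi : E) : R := japanese xi `^ (- sigma) * ghat xi.
have g0 (xi : E) : 0 <= ghat xi by rewrite ltW// gauss_hat_gt0.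
have J0 N (xi : E) : 0 <= japanese xi ^+ N by rewrite exprn_ge0// ltW// japanese_gt0.
have mh : measT h.
  by apply: measurable_funM; [exact: measurable_japanese_powR|exact: measurable_gauss_hat].
have h2 xi : h xi ^+ 2 <= K ^+ 2 * cauchy_weight xi.
  apply: (@le_trans _ _ ((japanese xi ^+ m * ghat xi) ^+ 2)).
    rewrite lerXn2r ?nnegrE ?mulr_ge0 ?powR_ge0//.
    by rewrite ler_wpM2r.
  apply: (@le_trans _ _ ((japanese xi ^+ m * ghat xi) ^+ 2 * (japanese xi ^+ (2 * d) * cauchy_weight xi))).
    by rewrite ler_peMr ?sqr_ge0// japanese_cauchy_weight.
  rewrite mulrA ler_wpM2r ?cauchy_weight_ge0// mulnC exprM -exprMn mulrAC -exprD.
  by rewrite lerXn2r ?nnegrE ?mulr_ge0.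
have W0 : (0 <= \int[mu]_x (cauchy_weight x)%:E)%E.
  by apply: integral_ge0 => x _; rewrite lee_fin cauchy_weight_ge0.
have [W HW] : exists W : R, (\int[mu]_x (cauchy_weight x)%:E = W%:E)%E.
  exists (fine (\int[mu]_x (cauchy_weight x)%:E)%E).
  by rewrite fineK// ge0_fin_numE// integral_cauchy_weight.
have W0' : 0 <= W by rewrite -lee_fin -HW.
(* The 1 makes D positive and lets D^2 dominate K^2 W, which avoids a square root. *)
set D := K ^+ 2 * W + 1.
have D0 : 0 < D by rewrite ltr_wpDl// mulr_ge0// sqr_ge0.
have hD : ('N[mu]_2%:E[(fun x => (h x)%:E)] <= D%:E)%E.
  apply: Lnorm2_le; first exact: ltW.
  apply: (@le_trans _ _ (\int[mu]_x (K ^+ 2 * cauchy_weight x)%:E)%E).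
    apply: le_integral_ge0 => //; first exact: measurable_funX.
      by apply: measurable_funM => //; exact: measurable_cauchy_weight.
    by move=> x; exact: sqr_ge0.
  under eq_integral do rewrite EFinM.
  rewrite ge0_integralZl_EFin ?sqr_ge0//; last 2 first.
  - by move=> x _; rewrite lee_fin cauchy_weight_ge0.
  - by apply/measurable_EFinP; exact: measurable_cauchy_weight.
  rewrite HW -EFinM lee_fin /D.
  have : 0 <= K ^+ 2 * W by rewrite mulr_ge0// sqr_ge0.
  by move: (K ^+ 2 * W) => y y0; nra.
exists D => // U L c nU cD.
pose A := `|\int[mu]_xi (cRe (U xi) * ghat xi)|.
apply: (@lt_le_trans _ _ (A / D)%:E); first by rewrite lte_fin ltr_pdivlMr.
apply: le_ereal_inf_tmp => _ [g [mg Tg] <-].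
have [ig eg] := Tg _ (@schwartz_gaussian R d).
have [KG nG] := schwartz_nice (@schwartz_gaussian R d).
(* The infimum ranges over all transforms g of the distribution; each has the same Gaussian pairing
   as [U], both being the value of the distribution at [gaussian]. *)
have eU : cintegral mu setT (fun xi => U xi * inv_fourier gaussian xi) =
    cintegral mu setT (fun xi => g xi * inv_fourier gaussian xi).
  by rewrite -eg -(cintegral_inv_fourierC nU nG).
have ReE (V : E -> R[i]) : cRe (cintegral mu setT (fun xi => V xi * inv_fourier gaussian xi)) =
    \int[mu]_xi (cRe (V xi) * ghat xi).
  by apply: eq_Rintegral => xi _; rewrite inv_fourier_gaussian mulrC cReMr mulrC.
pose G (xi : E) : R := japanese xi `^ sigma * Normc.normc (g xi).
have mG : measT G.
  by apply: measurable_funM; [exact: measurable_japanese_powR|exact: measurable_normc].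
have Gh xi : `|cRe (g xi) * ghat xi| <= `|G xi * h xi|.
  rewrite normrM [X in _ * X <= _]ger0_norm// [leRHS]ger0_norm; last first.
    by rewrite !mulr_ge0 ?powR_ge0 ?normc_ge0.
  rewrite /G /h mulrACA -powRD; last by apply/implyP => _; rewrite gt_eqF ?japanese_gt0.
  by rewrite subrr powRr0 mul1r ler_wpM2r// Re_le_normc.
have Ireg : mu.-integrable setT (EFin \o (fun xi => cRe (g xi) * ghat xi)).
  have := ig.1; apply: eq_integrable => // xi _.
  by rewrite /comp inv_fourier_gaussian [_ * (_)%:C]mulrC cReMr mulrC.
have A1 : (A%:E <= 'N[mu]_1[(fun xi => (G xi * h xi)%:E)])%E.
  rewrite /A -ReE eU ReE EFin_normr_Rintegral// Lnorm1.
  apply: le_trans (le_abse_integral _ _ _) _ => //.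
    by have /integrableP[] := Ireg.
  apply: ge0_le_integral => //.
  - by apply: measurableT_comp => //; have /integrableP[] := Ireg.
  - apply: measurableT_comp => //; apply/measurable_EFinP.
    exact: measurable_funM.
  - by move=> xi _; rewrite lee_fin.
have A2 : (A%:E <= 'N[mu]_2%:E[(fun xi => (G xi)%:E)] * 'N[mu]_2%:E[(fun xi => (h xi)%:E)])%E.
  apply: le_trans A1 _.
  by apply: (@hoelder _ _ _ mu G h 2 2) => //; rewrite -[X in _ = X](@mulfV R 2)// mulr_natl mulr2n.
rewrite EFinM lee_pdivrMr//.
by apply: le_trans A2 _; apply: lee_wpmul2l => //; exact: Lnorm_ge0.
Qed.

Lemma sobolev_fourier (s : R) (T : distr R d) : (sobolev_norm s T < +oo)%E ->
  exists2 g, has_fourier T g &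
    (\int[mu]_xi ((japanese xi `^ s * Normc.normc (g xi)) ^+ 2)%:E < +oo)%E.
Proof.
by move=> /ereal_inf_lt[_ [g Tg <-]] /Lnorm2_fin; exists g.
Qed.

Lemma sobolev_norm_upper (s B : R) (T : distr R d) (g g0 : E -> R[i]) K : 0 <= B ->
  nice K g -> has_fourier T g0 ->
  (\int[mu]_xi ((japanese xi `^ s * Normc.normc (g xi - g0 xi)) ^+ 2)%:E <= (B ^+ 2)%:E)%E ->
  (sobolev_norm s (distr_sub (distr_of (inv_fourier g)) T) <= B%:E)%E.
Proof.
move=> B0 ng Tg0 hB.
apply: le_trans (Lnorm2_le B0 hB).
apply: ereal_inf_lbound; exists (fun xi => g xi - g0 xi) => //.
exact: has_fourier_sub ng Tg0.
Qed.

(** An H^s datum only has a weighted L^2 transform. Truncation in frequency together with truncation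
    in size yields a bounded function on a bounded set, hence a [nice] one. *)
Definition cutoff (n : nat) (g : E -> R[i]) (xi : E) : R[i] :=
  if (japanese xi <= n%:R) && (Normc.normc (g xi) <= n%:R) then g xi else 0.

Lemma measurable_cutoff_set n (g : E -> R[i]) : cmeas g ->
  measT (fun xi => (japanese xi <= n%:R) && (Normc.normc (g xi) <= n%:R)).
Proof.
move=> mg; apply: measurable_and.
  by apply: measurable_fun_ler => //; exact: measurable_japanese.
by apply: measurable_fun_ler => //; exact: measurable_normc.
Qed.

Lemma nice_cutoff n (g : E -> R[i]) : cmeas g -> exists K, nice K (cutoff n g).
Proof.
move=> mg.
have mc : cmeas (cutoff n g).
  have mb := measurable_cutoff_set n mg.
  split; under eq_fun do rewrite (fun_if (fun z : R[i] => _ z)) /=.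
    by apply: measurable_fun_ifT => //; exact: mg.1.
  by apply: measurable_fun_ifT => //; exact: mg.2.
apply: (@rapid_decay_nice _ _ _ n%:R (n%:R ^+ (2 * d) * n%:R)) => // xi; rewrite /cutoff.
  by case: ifP => [/andP[]//|_]; rewrite Normc.normc0.
have j0 : 0 <= japanese xi by rewrite ltW// japanese_gt0.
case: ifP => [/andP[jn gn]|_]; last by rewrite Normc.normc0 mulr0 mulr_ge0// exprn_ge0.
apply: ler_pM => //; rewrite ?exprn_ge0 ?normc_ge0//.
by rewrite lerXn2r ?nnegrE.
Qed.

(** At each frequency the error is either 0 or the full integrand, and it is 0 for n large:
    dominated convergence. *)
Lemma cutoff_approx (s e : R) (g : E -> R[i]) : cmeas g -> 0 < e ->
  (\int[mu]_xi ((japanese xi `^ s * Normc.normc (g xi)) ^+ 2)%:E < +oo)%E ->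
  exists n, (\int[mu]_xi ((japanese xi `^ s * Normc.normc (cutoff n g xi - g xi)) ^+ 2)%:E <= e%:E)%E.
Proof.
move=> mg e0 goo.
have mc n : cmeas (cutoff n g).
  by have [K nK] := nice_cutoff n mg; exact: nice_meas nK.
pose F (f : E -> R[i]) xi := (japanese xi `^ s * Normc.normc (f xi)) ^+ 2.
have mF f : cmeas f -> measT (F f).
  move=> mf; apply: measurable_funX; apply: measurable_funM.
    exact: measurable_japanese_powR.
  exact: measurable_normc.
have cN n xi : F (fun x => cutoff n g x - g x) xi =
    if (japanese xi <= n%:R) && (Normc.normc (g xi) <= n%:R) then 0 else F g xi.
  rewrite /F /cutoff; case: ifP => _; first by rewrite subrr Normc.normc0 mulr0 expr0n.
  by rewrite sub0r; case: (g xi) => a b; rewrite /Normc.normc /= !sqrrN.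
have [|||||_ _ h] := @dominated_convergence _ _ R mu setT measurableT
  (fun n x => (F (fun x => cutoff n g x - g x) x)%:E) (cst 0%E) (fun x => (F g x)%:E).
- by move=> n; apply/measurable_EFinP; apply: mF; exact: cmeasB.
- exact: measurable_cst.
- apply: aeW => xi _; apply: cvg_near_cst.
  exists (maxn (Num.truncn (japanese xi)).+1 (Num.truncn (Normc.normc (g xi))).+1) => // n /=.
  rewrite geq_max => /andP[n1 n2]; rewrite cN ifT//.
  by apply/andP; split; [apply: le_trans (ltW (truncnS_gt (japanese xi))) _|
    apply: le_trans (ltW (truncnS_gt (Normc.normc (g xi)))) _]; rewrite ler_nat.
- apply/integrableP; split; first by apply/measurable_EFinP; exact: mF.
  by under eq_integral do rewrite gee0_abs ?lee_fin ?sqr_ge0//.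
- apply: aeW => xi n _; rewrite gee0_abs ?lee_fin ?sqr_ge0// cN.
  by case: ifP => // _; exact: sqr_ge0.
move: h; rewrite integral_cst// mul0e => h.
have /fine_cvgP[[N1 _ H1] hr] := h.
have [N2 _ H2] := cvgr_lt _ hr _ e0.
exists (maxn N1 N2).
have := H1 _ (leq_maxl N1 N2); have := H2 _ (leq_maxr N1 N2); rewrite /=.
move=> lt_e fin; apply: ltW; rewrite -(fineK fin) lte_fin; exact: lt_e.
Qed.

End sobolev_bounds.

(** * Resonant data and norm inflation *)

Section boxes.
Context {R : realType} {d : nat}.
Local Notation E := (Euc R d).
Local Notation mu := (lebesgue R d).
Local Notation leb := (@lebesgue_measure R).
Variable i0 : 'I_d.

(** The cube [lo, hi]^d moved by a along the axis i0. The product form makes its integral a product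
    of lengths. *)
Definition box (a lo hi : R) (x : E) : R :=
  \prod_(i < d) \1_`[lo + a * (i == i0)%:R, hi + a * (i == i0)%:R] (tnth x i).

Lemma boxE a lo hi x : box a lo hi x =
  if [forall i, (lo + a * (i == i0)%:R <= tnth x i <= hi + a * (i == i0)%:R)] then 1 else 0.
Proof.
rewrite /box; case: ifPn => [/forallP h|].
  by rewrite big1// => i _; rewrite indicE mem_set//= in_itv/=; exact: h.
rewrite negb_forall => /existsP[i hni].
rewrite (bigD1 i)//= indicE memNset ?mul0r//= in_itv/=; exact/negP.
Qed.

Lemma box_ge0 a lo hi x : 0 <= box a lo hi x. Proof. by rewrite boxE; case: ifP. Qed.
Lemma box_le1 a lo hi x : box a lo hi x <= 1. Proof. by rewrite boxE; case: ifP. Qed.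

Lemma measurable_box a lo hi : measT (box a lo hi).
Proof.
apply: measurable_prod => i _.
have mi : measT (fun x : measurableTypeR R =>
    (\1_`[lo + a * (i == i0)%:R, hi + a * (i == i0)%:R] x : R)).
  by apply: measurable_indic; exact: measurable_itv.
exact: (measurableT_comp mi (measurable_tnth i)).
Qed.

Lemma integral_box a lo hi : lo <= hi ->
  (\int[mu]_x (box a lo hi x)%:E = ((hi - lo) ^+ d)%:E)%E.
Proof.
move=> lh.
rewrite (ge0_integral_prod (p := fun i x => \1_`[lo + a * (i == i0)%:R, hi + a * (i == i0)%:R] x)
  (m := fun _ => hi - lo)).
- by rewrite prodr_const card_ord.
- by move=> i; apply: measurable_indic; exact: measurable_itv.
- by move=> i x; rewrite indicE.
move=> i; rewrite integral_indic// ?setIT ?setTI /= lebesgue_measure_itv/= lte_fin.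
case: ltP => h; first by rewrite -EFinB opprD addrACA subrr addr0.
by congr (_%:E); rewrite lerD2r in h; apply/esym/eqP; rewrite subr_eq0 eq_le h lh.
Qed.

Lemma box_tadd a b lo lo' hi hi' x y :
  box a lo hi x * box b lo' hi' y <= box (a + b) (lo + lo') (hi + hi') (tadd x y).
Proof.
rewrite !boxE; case: ifPn => [/forallP h1|_]; last by rewrite mul0r; case: ifP.
case: ifPn => [/forallP h2|_]; last by rewrite mulr0; case: ifP.
rewrite mul1r ifT//; apply/forallP => i; rewrite tnth_mktuple mulrDl.
have /andP[a1 a2] := h1 i; have /andP[b1 b2] := h2 i.
by rewrite addrACA lerD// addrACA lerD.
Qed.

(** Positivity excludes cancellation in convolutions, so lower bounds on masses can be
    multiplied. *)
Definition nnreal (F : E -> R[i]) := forall x, cIm (F x) = 0 /\ 0 <= cRe (F x).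

Lemma nnreal_fconv F G K L : nice K F -> nice L G -> nnreal F -> nnreal G ->
  nnreal (fconv F G) /\ forall xi, ((cRe (fconv F G xi))%:E =
    \int[mu]_eta (cRe (F (tsub xi eta)) * cRe (G eta))%:E)%E.
Proof.
move=> nF nG F0 G0.
have Rk xi eta : cRe (F (tsub xi eta) * G eta) =
    cRe (F (tsub xi eta)) * cRe (G eta).
  by rewrite cReM; have [-> _] := F0 (tsub xi eta); rewrite mul0r subr0.
split=> xi.
  split.
    rewrite /fconv /cintegral /= /Rintegral integral0_eq//= => eta _.
    have [] := F0 (tsub xi eta); have [] := G0 eta.
    by move: (F _) (G _) => [a b] [a' b'] /= -> _ -> _; rewrite mulr0 mul0r addr0.
  rewrite /fconv /cintegral /=; apply: Rintegral_ge0 => eta _.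
  by rewrite Rk mulr_ge0//; [have [] := F0 (tsub xi eta)|have [] := G0 eta].
rewrite /fconv /cintegral /Rintegral fineK; last first.
  by apply: integrable_fin_num => //; exact: (cint_conv xi nF nG).1.
by apply: eq_integral => eta _; rewrite Rk.
Qed.

Definition mass (F : E -> R[i]) a lo hi : \bar R :=
  (\int[mu]_x (box a lo hi x * cRe (F x))%:E)%E.

Lemma mass_ge0 F a lo hi : nnreal F -> (0 <= mass F a lo hi)%E.
Proof.
move=> F0; apply: integral_ge0 => x _; rewrite lee_fin mulr_ge0 ?box_ge0//.
by have [] := F0 x.
Qed.

(** The sum of a point of each box lies in the sum of the boxes. By Tonelli and a translation, the
    mass of the convolution there bounds from above the product of the masses. *)
Lemma mass_fconv F G K L a b lo lo' hi hi' : nice K F -> nice L G -> nnreal F -> nnreal G ->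
  (mass F a lo hi * mass G b lo' hi' <= mass (fconv F G) (a + b) (lo + lo') (hi + hi'))%E.
Proof.
move=> nF nG F0 G0; have [C0 CE] := nnreal_fconv nF nG F0 G0.
have F0' x : 0 <= cRe (F x) by have [] := F0 x.
have G0' x : 0 <= cRe (G x) by have [] := G0 x.
have [mF _ _] := nF; have [mG _ _] := nG.
set B := box (a + b) (lo + lo') (hi + hi').
pose k (z : E * E) : R := B z.1 * (cRe (F (tsub z.1 z.2)) * cRe (G z.2)).
have k0 z : 0 <= k z by rewrite mulr_ge0 ?box_ge0// mulr_ge0.
have mk : measT k.
  apply: measurable_funM.
    exact: (measurableT_comp (measurable_box _ _ _) measurable_fst).
  apply: measurable_funM.
    exact: (measurableT_comp mF.1 (@measurable_tsub R d)).
  exact: (measurableT_comp mG.1 measurable_snd).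
have mEk : measT (fun z => (k z)%:E) by exact/measurable_EFinP.
have mFb : measT (fun x => (box a lo hi x * cRe (F x))%:E).
  apply/measurable_EFinP; apply: measurable_funM mF.1; exact: measurable_box.
have mGb : measT (fun x => (box b lo' hi' x * cRe (G x))%:E).
  apply/measurable_EFinP; apply: measurable_funM mG.1; exact: measurable_box.
have -> : mass (fconv F G) (a + b) (lo + lo') (hi + hi') =
    (\int[mu]_xi \int[mu]_eta (k (xi, eta))%:E)%E.
  apply: eq_integral => xi _; rewrite EFinM CE -ge0_integralZl_EFin ?box_ge0//.
  - by move=> eta _; rewrite lee_fin mulr_ge0.
  - apply/measurable_EFinP; apply: measurable_funM mG.1.
    have [+ _] := cmeas_shift xi mF; exact.
rewrite (fubini_tonelli (fun z => (k z)%:E))//.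
rewrite muleC /mass -ge0_integralZr//; last 2 first.
- by move=> x _; rewrite lee_fin mulr_ge0// box_ge0.
- exact: mass_ge0.
apply: ge0_le_integral => //.
- by move=> x _; apply: mule_ge0; rewrite ?lee_fin ?mulr_ge0 ?box_ge0//; exact: mass_ge0.
- by apply: emeasurable_funM => //; exact: measurable_cst.
- by apply: (measurable_fun_fubini_tonelli_G (fun z => (k z)%:E)).
move=> eta _; rewrite -ge0_integralZl_EFin//; last 2 first.
- by move=> x _; rewrite lee_fin mulr_ge0// box_ge0.
- by rewrite mulr_ge0// box_ge0.
have mE2 : measT (fun xi => (k (xi, eta))%:E).
  exact: (measurableT_comp mEk (pair2_measurable eta)).
rewrite -(ge0_integral_shift eta (f := fun xi => (k (xi, eta))%:E))//; last first.
  by move=> x; rewrite lee_fin.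
apply: ge0_le_integral => //.
- by move=> x _; rewrite -EFinM lee_fin !mulr_ge0 ?box_ge0.
- exact: measurable_funeM.
- exact: (measurableT_comp mE2 (measurable_taddr eta)).
move=> xi _; rewrite -EFinM lee_fin /k /= taddK /B.
rewrite (_ : _ * _ * _ = box a lo hi xi * box b lo' hi' eta * (cRe (F xi) * cRe (G eta))); last by ring.
by rewrite ler_wpM2r ?mulr_ge0// box_tadd.
Qed.

(* The product of [n.+1] factors. *)
Definition conv_pow (n : nat) (f : E -> R[i]) : E -> R[i] :=
  iter n (fun g => fconv g f) f.

Lemma cauchy_pow0 n (A : nat -> E -> R[i]) : cauchy_pow n A 0 = conv_pow n (A 0%N).
Proof.
elim: n => [//|n IH] /=; apply/funext => xi.
by rewrite big_ord1 subn0 IH.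
Qed.

Lemma nice_conv_pow n f K : nice K f -> nice (K ^+ n.+1) (conv_pow n f).
Proof.
by move=> nf; elim: n => [|n IH]; [rewrite expr1|rewrite exprSr; exact: nice_conv].
Qed.

(** Telescoping: each convolution with one more factor splits as (V - F) convolved with v plus F
    convolved with v - f. One factor A is traded for b, which is why general data only produce
    lower-order errors. *)
Lemma conv_pow_diff n (v f : E -> R[i]) A b : nice A v -> nice A f ->
  nice b (fun x => v x - f x) ->
  nice (n.+1%:R * A ^+ n * b) (fun x => conv_pow n v x - conv_pow n f x).
Proof.
move=> nv nf nb; elim: n => [|n IH]; first by rewrite expr0 !mul1r.
have nvn := nice_conv_pow n nv; have nfn := nice_conv_pow n nf.
have n1 := nice_conv IH nv; have n2 := nice_conv nfn nb.
have := niceD n1 n2.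
rewrite (_ : _ + _ = n.+2%:R * A ^+ n.+1 * b); last first.
  by rewrite -[n.+2%:R]natr1 exprSr; move: (n.+1%:R) (A ^+ n) => x y; ring.
apply: eq_nice => xi.
rewrite (fconvBl nvn nfn nv) (fconvBr nfn nv nf) /=.
by rewrite addrA subrK.
Qed.

Variables (A N : R) (j : nat).
Hypothesis A0 : 0 <= A.

(* The resonance: j frequencies near N e and one near - j N e add up to a low
   frequency. *)
Definition bump_real (x : E) : R := A * (box N 1 2 x + box (- (j%:R * N)) 1 2 x).
Definition cbump (x : E) : R[i] := (bump_real x)%:C.

Lemma bump_real_ge0 x : 0 <= bump_real x.
Proof. by rewrite mulr_ge0// addr_ge0// box_ge0. Qed.

Lemma bump_real_le x : bump_real x <= 2 * A.
Proof. by rewrite [leRHS]mulrC /bump_real ler_wpM2l//; have := box_le1 N 1 2 x; have := box_le1 (- (j%:R * N)) 1 2 x; lra. Qed.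

Lemma measurable_bump_real : measT bump_real.
Proof. by apply: measurable_funM => //; apply: measurable_funD; exact: measurable_box. Qed.

Lemma integral_bump_real : (\int[mu]_x (bump_real x)%:E = (2 * A)%:E)%E.
Proof.
rewrite /bump_real; under eq_integral do rewrite EFinM EFinD.
rewrite ge0_integralZl_EFin//; last 2 first.
- by move=> x _; rewrite -EFinD lee_fin addr_ge0// box_ge0.
- by apply: emeasurable_funD; apply/measurable_EFinP; exact: measurable_box.
rewrite ge0_integralD//; last 4 first.
- by move=> x _; rewrite lee_fin box_ge0.
- by apply/measurable_EFinP; exact: measurable_box.
- by move=> x _; rewrite lee_fin box_ge0.
- by apply/measurable_EFinP; exact: measurable_box.
have h12 : 1 <= 2 :> R by rewrite ler1n.
rewrite !integral_box// (_ : 2 - 1 = 1 :> R); last by lra.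
by rewrite expr1n -EFinD -EFinM mulrC.
Qed.

Lemma integral_bump_realZ c : 0 <= c ->
  (\int[mu]_x (c * bump_real x)%:E = (c * (2 * A))%:E)%E.
Proof.
move=> c0; under eq_integral do rewrite EFinM.
rewrite ge0_integralZl_EFin//; first by rewrite integral_bump_real -EFinM.
  by move=> x _; rewrite lee_fin bump_real_ge0.
by apply/measurable_EFinP; exact: measurable_bump_real.
Qed.

Lemma nice_bump : nice (2 * A) cbump.
Proof.
apply: (@nice_dominated _ _ _ bump_real).
- by apply: cmeas_real; exact: measurable_bump_real.
- exact: measurable_bump_real.
- by move=> x; rewrite /l1n /= normr0 addr0 ger0_norm ?bump_real_ge0.
- exact: bump_real_le.
- by rewrite integral_bump_real.
Qed.

Lemma nnreal_bump : nnreal cbump.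
Proof. by move=> x; split => //; exact: bump_real_ge0. Qed.

Lemma nnreal_conv_pow n : nnreal (conv_pow n cbump).
Proof.
elim: n => [|n IH]; first exact: nnreal_bump.
exact: (nnreal_fconv (nice_conv_pow n nice_bump) nice_bump IH nnreal_bump).1.
Qed.

Lemma mass_bump a : (a == N) || (a == - (j%:R * N)) -> (A%:E <= mass cbump a 1 2)%E.
Proof.
move=> aN; have h12 : 1 <= 2 :> R by rewrite ler1n.
apply: (@le_trans _ _ (\int[mu]_x (A%:E * (box a 1 2 x)%:E))%E).
  rewrite ge0_integralZl_EFin//; last 2 first.
  - by move=> x _; rewrite lee_fin box_ge0.
  - by apply/measurable_EFinP; exact: measurable_box.
  by rewrite integral_box// (_ : 2 - 1 = 1 :> R) ?expr1n ?mule1//; lra.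
apply: ge0_le_integral => //.
- by move=> x _; rewrite -EFinM lee_fin mulr_ge0// box_ge0.
- by apply: measurable_funeM; apply/measurable_EFinP; exact: measurable_box.
- by apply/measurable_EFinP; apply: measurable_funM; [exact: measurable_box|exact: measurable_bump_real].
move=> x _; rewrite -EFinM lee_fin /bump_real mulrCA ler_wpM2l//.
have b1 := box_ge0 N 1 2 x; have b2 := box_ge0 (- (j%:R * N)) 1 2 x.
have sq c : box c 1 2 x * box c 1 2 x = box c 1 2 x by rewrite boxE; case: ifP; rewrite ?mulr1 ?mulr0.
have b3 := box_ge0 a 1 2 x.
case/orP: aN => /eqP E1; rewrite -E1 in b1 b2 *.
  by rewrite mulrDr sq lerDl mulr_ge0.
by rewrite mulrDr sq lerDr mulr_ge0.
Qed.

Let mul2Sn n : 2 * n.+1%:R + 2 = 2 * n.+2%:R :> R.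
Proof. by rewrite -[n.+2%:R]natr1 mulrDr mulr1. Qed.

Lemma mass_conv_pow n :
  ((A ^+ n.+1)%:E <= mass (conv_pow n cbump) (n.+1%:R * N) n.+1%:R (2 * n.+1%:R))%E.
Proof.
elim: n => [|n IH]; first by rewrite expr1 mul1r mulr1; apply: mass_bump; rewrite eqxx.
have := mass_fconv (n.+1%:R * N) N n.+1%:R 1 (2 * n.+1%:R) 2
  (nice_conv_pow n nice_bump) nice_bump (nnreal_conv_pow n) nnreal_bump.
have e1 : n.+1%:R * N + N = n.+2%:R * N by rewrite -[n.+2%:R]natr1 mulrDl mul1r.
rewrite e1 natr1 mul2Sn.
apply: le_trans; rewrite exprSr EFinM; apply: lee_pmul; rewrite ?lee_fin ?exprn_ge0//.
by apply: mass_bump; rewrite eqxx.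
Qed.

Lemma mass_resonance : (0 < j)%N ->
  ((A ^+ j.+1)%:E <= mass (conv_pow j cbump) 0 j.+1%:R (2 * j.+1%:R))%E.
Proof.
case: {-2}j (erefl j) => [//|n] jn _.
have := mass_fconv (n.+1%:R * N) (- (n.+1%:R * N)) n.+1%:R 1 (2 * n.+1%:R) 2
  (nice_conv_pow n nice_bump) nice_bump (nnreal_conv_pow n) nnreal_bump.
rewrite subrr natr1 mul2Sn.
apply: le_trans; rewrite exprSr EFinM; apply: lee_pmul; rewrite ?lee_fin ?exprn_ge0//.
  exact: mass_conv_pow.
by apply: mass_bump; rewrite jn eqxx orbT.
Qed.

(** The coordinate along i0 is at least N + 1 on the first cube and at most 2 - j N on the
    second. *)
Lemma bump_support x : (0 < j)%N -> 2 <= N -> bump_real x != 0 -> N - 2 <= japanese x.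
Proof.
move=> j0 N2 bx.
have key a : box a 1 2 x != 0 -> 1 + a <= tnth x i0 <= 2 + a.
  rewrite boxE; case: ifP => [/forallP/(_ i0)|]; last by rewrite eqxx.
  by rewrite eqxx mulr1.
apply: le_trans (coord_le_japanese x i0).
have [/eqP b1|/key/andP[h1 h2]] := boolP (box N 1 2 x == 0).
  have : box (- (j%:R * N)) 1 2 x != 0.
    by move: bx; rewrite /bump_real b1 add0r mulf_eq0 negb_or => /andP[].
  move=> /key/andP[h1 h2].
  have jN : N <= j%:R * N.
    by rewrite ler_peMl ?ler1n//; lra.
  by rewrite -normrN; apply: le_trans (ler_norm _); lra.
by apply: le_trans (ler_norm _); lra.
Qed.

End boxes.

Section gaussian_pairing.
Context {R : realType} {d : nat}.
Local Notation E := (Euc R d).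
Local Notation mu := (lebesgue R d).
Local Notation ghat := (@gauss_hat R d).
Local Notation cg := (Num.sqrt (pi : R) ^+ d).

(** The real part of the value at [gaussian] of the distribution with Fourier transform f. *)
Definition gpair (f : E -> R[i]) : R := \int[mu]_xi (cRe (f xi) * ghat xi).

Lemma integrable_gpair K (f : E -> R[i]) : nice K f ->
  mu.-integrable setT (fun xi => (cRe (f xi) * ghat xi)%:E).
Proof.
move=> nf; have nm : nice (cg * K) (fun xi => (ghat xi)%:C * f xi).
  apply: niceMr nf; first exact: measurable_gauss_hat.
  by move=> x; rewrite ger0_norm ?gauss_hat_le// ltW// gauss_hat_gt0.
have := (nice_int nm).1; apply: eq_integrable => // x _.
by rewrite cReMr mulrC.
Qed.

Lemma gpairD K L (f g : E -> R[i]) : nice K f -> nice L g ->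
  gpair (fun xi => f xi + g xi) = gpair f + gpair g.
Proof.
move=> nf ng; rewrite /gpair -RintegralD//; last 2 first.
- exact: integrable_gpair nf.
- exact: integrable_gpair ng.
by apply: eq_Rintegral => x _; rewrite cReD mulrDl.
Qed.

Lemma gpairZ (a : R) K (f : E -> R[i]) : nice K f ->
  gpair (fun xi => a%:C * f xi) = a * gpair f.
Proof.
move=> nf; rewrite /gpair -RintegralZl//; last exact: integrable_gpair nf.
by apply: eq_Rintegral => x _; rewrite cReMr mulrA.
Qed.

Lemma gpair_le K (f : E -> R[i]) : nice K f -> `|gpair f| <= cg * K.
Proof.
move=> nf; have [mf _ f1] := nf; have ig := integrable_gpair nf.
apply: le_trans (le_normr_Rintegral _ ig) _ => //.
rewrite -lee_fin fineK; last first.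
  by apply: integrable_fin_num => //; exact: (integrable_abse ig).
apply: (@le_trans _ _ (cg%:E * \int[mu]_x (l1n (f x))%:E)%E); last first.
  by rewrite EFinM lee_wpmul2l// lee_fin exprn_ge0.
rewrite -ge0_integralZl_EFin ?exprn_ge0//; last 2 first.
- by move=> x _; rewrite lee_fin l1n_ge0.
- by apply/measurable_EFinP; exact: measurable_l1n.
apply: le_integral_ge0.
- apply: measurableT_comp => //; apply: measurable_funM mf.1 _; exact: measurable_gauss_hat.
- by apply: measurable_funM => //; exact: measurable_l1n.
- by move=> x; rewrite normr_ge0.
move=> x; rewrite normrM mulrC [`|ghat _|]ger0_norm ?(ltW (gauss_hat_gt0 _))//.
apply: ler_pM; rewrite ?(ltW (gauss_hat_gt0 _))// ?gauss_hat_le//.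
exact: Re_le_l1n.
Qed.

End gaussian_pairing.

Section resonance.
Context {R : realType} {d : nat}.
Local Notation E := (Euc R d).
Local Notation mu := (lebesgue R d).
Local Notation ghat := (@gauss_hat R d).
Local Notation cg := (Num.sqrt (pi : R) ^+ d).
Variables (i0 : 'I_d) (j : nat).
Hypothesis j0 : (0 < j)%N.

(** A lower bound for lambda^2 [gauss_hat] on the cube [j + 1, 2 (j + 1)]^d: there |x| >= 1 gives
    lambda^2 >= 1/2, and |x|^2 <= d (2 (j + 1))^2 bounds the Gaussian from below. *)
Let m0 : R := 2^-1 * (cg * expR (- (d%:R * (2 * j.+1%:R) ^+ 2 / 4))).

Let m0_gt0 : 0 < m0.
Proof. by rewrite !mulr_gt0// ?exprn_gt0 ?sqrtr_gt0 ?pi_gt0// expR_gt0. Qed.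

Lemma box_symbol_lower (x : E) :
  box i0 0 j.+1%:R (2 * j.+1%:R) x * m0 <= lambda x ^+ 2 * ghat x.
Proof.
have g0 := gauss_hat_gt0 x.
rewrite boxE; case: ifP => [/forallP h|_]; last first.
  by rewrite mul0r mulr_ge0 ?sqr_ge0// ltW.
have {}h i : 1 <= tnth x i ^+ 2 <= (2 * j.+1%:R) ^+ 2.
  have /andP[h1 h2] := h i; rewrite mul0r !addr0 in h1 h2.
  have j1 : 1 <= j.+1%:R :> R by rewrite ler1n.
  have x1 := le_trans j1 h1.
  by rewrite exprn_ege1//= lerXn2r// nnegrE; lra.
have e1 : 1 <= enorm x ^+ 2.
  rewrite sqr_enorm (bigD1 i0)//=; have /andP[+ _] := h i0.
  by move=> /le_trans; apply; rewrite lerDl sumr_ge0// => i _; rewrite sqr_ge0.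
have e2 : enorm x ^+ 2 <= d%:R * (2 * j.+1%:R) ^+ 2.
  rewrite sqr_enorm; apply: (@le_trans _ _ (\sum_(i < d) (2 * j.+1%:R) ^+ 2)).
    by apply: ler_sum => i _; have /andP[] := h i.
  by rewrite sumr_const card_ord -[leLHS]mulr_natl.
rewrite mul1r; apply: ler_pM; rewrite ?invr_ge0 ?mulr_ge0 ?exprn_ge0 ?expR_ge0//.
  by rewrite /lambda expr_div_n sqr_japanese ler_pdivlMr; lra.
by rewrite ler_wpM2l ?exprn_ge0// ler_expR lerN2 ler_wpM2r.
Qed.

(** The constant m depends on d and j only: the translations by N cancel in the resonance, which
    [mass_resonance] then bounds from below on a fixed cube. *)
Lemma gpair_resonance : exists2 m : R, 0 < m & forall A N : R, 0 <= A ->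
  m * A ^+ j.+1 <= gpair (fun xi : E => (lambda xi ^+ 2)%:C * conv_pow j (cbump i0 A N j) xi).
Proof.
exists m0 => // A N A0; set f := conv_pow j _.
have nf : nice ((2 * A) ^+ j.+1) f by apply: nice_conv_pow; exact: nice_bump.
have f0 x : 0 <= cRe (f x) by have [] := nnreal_conv_pow i0 N j A0 j x.
have ml : measT (fun xi : E => lambda xi ^+ 2).
  by apply: measurable_funX; exact: measurable_lambda.
have nlf : nice (1 * (2 * A) ^+ j.+1) (fun xi : E => (lambda xi ^+ 2)%:C * f xi).
  apply: niceMr nf => // x; rewrite ger0_norm ?sqr_ge0//.
  by rewrite exprn_ile1 ?lambda_ge0 ?lambda_le1.
rewrite -lee_fin /gpair fineK; last first.
  by apply: integrable_fin_num => //; exact: integrable_gpair nlf.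
rewrite EFinM; apply: le_trans (lee_wpmul2l _ (mass_resonance i0 N A0 j0)) _.
  by rewrite lee_fin ltW.
have [mf _ _] := nf.
have mb : measT (fun x => box i0 0 j.+1%:R (2 * j.+1%:R) x * cRe (f x)).
  by apply: measurable_funM mf.1; exact: measurable_box.
rewrite /mass -ge0_integralZl_EFin ?(ltW m0_gt0)//; last 2 first.
- by move=> x _; rewrite lee_fin mulr_ge0// box_ge0.
- exact/measurable_EFinP.
apply: le_integral_ge0.
- by apply: measurable_funM.
- apply: measurable_funM; last exact: measurable_gauss_hat.
  by have [[]] := nlf.
- by move=> x; rewrite !mulr_ge0 ?(ltW m0_gt0)// box_ge0.
move=> x; rewrite cReMr [leRHS]mulrAC mulrA.
by rewrite ler_wpM2r// mulrC box_symbol_lower.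
Qed.

(** The bumps live at frequencies at least N - 2, where [gauss_hat] is at most K / (N - 2), and
    their total integral is 2 A. For N - 2 >= 2 A the bound K no longer depends on A. *)
Lemma gpair_bump : exists2 K : R, 0 <= K & forall A N : R, 0 <= A -> 2 <= N ->
  2 * A <= N - 2 -> `|gpair (cbump i0 A N j)| <= K.
Proof.
have [K K0 HK] := @gauss_hat_decay R d 1; exists K => // A N A0 N2 AN.
have nb : nice (2 * A) (cbump i0 A N j) by exact: nice_bump.
have ig := integrable_gpair nb.
apply: le_trans (le_normr_Rintegral _ ig) _ => //.
rewrite -lee_fin fineK; last first.
  by apply: integrable_fin_num => //; exact: (integrable_abse ig).
(* For A = 0 the value N = 2 is allowed and the division by N - 2 below would fail; the bump is then
   zero. *)
have [A00|Apos] := leP A 0.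
  rewrite integral0_eq ?lee_fin// => x _ /=.
  by rewrite /bump_real (_ : A = 0) ?mul0r ?normr0//; apply/eqP; rewrite eq_le A00.
have Np : 0 < N - 2 by lra.
apply: (@le_trans _ _ (\int[mu]_x ((K / (N - 2)) * bump_real i0 A N j x)%:E)%E).
  apply: le_integral_ge0.
  - apply: measurableT_comp => //; apply: measurable_funM; last exact: measurable_gauss_hat.
    exact: measurable_bump_real.
  - by apply: measurable_funM => //; exact: measurable_bump_real.
  - by move=> x; rewrite normr_ge0.
  move=> x; rewrite -[cRe _]/(bump_real i0 A N j x).
  have b0 := bump_real_ge0 i0 N j A0 x.
  have g0 := gauss_hat_gt0 x.
  rewrite normrM (ger0_norm b0) (gtr0_norm g0) [leLHS]mulrC.
  have [->|bx] := eqVneq (bump_real i0 A N j x) 0; first by rewrite !mulr0.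
  rewrite ler_wpM2r// ler_pdivlMr// mulrC; apply: le_trans (HK x).
  by rewrite expr1 ler_wpM2r ?(ltW g0)// (bump_support j0 N2 bx).
rewrite integral_bump_realZ//; last by rewrite divr_ge0// ltW.
rewrite lee_fin mulrAC ler_pdivrMr//.
by rewrite ler_wpM2l.
Qed.

Lemma bump_sobolev_small (s A e : R) : s < 0 -> 0 <= A -> 0 < e ->
  exists2 N0 : R, 0 <= N0 & forall N, 2 <= N -> N0 <= N - 2 ->
  (\int[mu]_x ((japanese x `^ s * bump_real i0 A N j x) ^+ 2)%:E <= (e ^+ 2)%:E)%E.
Proof.
(* y solves 2 A y^s = e when A > 0; since s < 0, frequencies beyond y suffice. The added 1 keeps N -
   2 positive. *)
move=> s0 A0 e0; pose y : R := (2 * A / e) `^ ((- s)^-1).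
exists (1 + y); first by rewrite addr_ge0// powR_ge0.
move=> N N2 Ny.
have y0 : 0 <= y by exact: powR_ge0.
have Np : 0 < N - 2 by lra.
have key : 2 * A * (N - 2) `^ s <= e.
  rewrite -[s]opprK powRN ler_pdivrMr ?powR_gt0//.
  rewrite [leRHS]mulrC -ler_pdivrMr//.
  rewrite (_ : 2 * A / e = y `^ (- s)); last first.
    by rewrite /y -powRrM mulVf ?powRr1 ?divr_ge0 ?mulr_ge0// ?(ltW e0)//; lra.
  by apply: ge0_ler_powR; rewrite ?nnegrE; lra.
have w0 : 0 <= (N - 2) `^ s by exact: powR_ge0.
apply: (@le_trans _ _ (\int[mu]_x (((N - 2) `^ s) ^+ 2 * (2 * A) * bump_real i0 A N j x)%:E)%E).
  apply: le_integral_ge0.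
  - apply: measurable_funX; apply: measurable_funM; first exact: measurable_japanese_powR.
    exact: measurable_bump_real.
  - by apply: measurable_funM => //; exact: measurable_bump_real.
  - by move=> x; rewrite sqr_ge0.
  move=> x; have b0 := bump_real_ge0 i0 N j A0 x.
  have [->|bx] := eqVneq (bump_real i0 A N j x) 0; first by rewrite !mulr0 expr0n.
  rewrite exprMn -mulrA; apply: ler_pM; rewrite ?sqr_ge0//.
    rewrite lerXn2r ?nnegrE ?powR_ge0//.
    have sN z : z `^ s = (z `^ (- s))^-1 by rewrite -powRN opprK.
    rewrite !sN lef_pV2 ?posrE ?powR_gt0// ?japanese_gt0//.
    apply: ge0_ler_powR; rewrite ?nnegrE ?(ltW (japanese_gt0 x))//; try lra.
    exact: bump_support bx.
  by rewrite expr2 ler_wpM2r// bump_real_le.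
rewrite integral_bump_realZ//; last by rewrite mulr_ge0 ?sqr_ge0// mulr_ge0.
rewrite lee_fin -mulrA -expr2 -exprMn mulrC.
by rewrite lerXn2r ?nnegrE ?mulr_ge0// (ltW e0).
Qed.

End resonance.

Section second_order_growth.
Context {R : realType} {d : nat}.
Local Notation E := (Euc R d).
Local Notation cg := (Num.sqrt (pi : R) ^+ d).
Variables (j : nat) (v0 v1 f : E -> R[i]) (M b rho t : R).
Hypotheses (nv0 : nice M v0) (nv1 : nice M v1) (nf : nice M f)
  (nvf : nice b (fun x => v0 x - f x)) (nv1b : nice b v1)
  (rho4 : 4 <= rho) (rhoM : 5 * (1 + (8 * M) ^+ j) <= rho ^+ 2)
  (t0 : 0 <= t) (trho : t * rho <= 16^-1).

Let lam2 (xi : E) : R := lambda xi ^+ 2.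

Let nice_lam2 K (g : E -> R[i]) : nice K g -> nice K (fun xi => (lam2 xi)%:C * g xi).
Proof.
move=> ng; rewrite -[K]mul1r; apply: niceMr ng.
  by apply: measurable_funX; exact: measurable_lambda.
move=> x; rewrite ger0_norm ?sqr_ge0//.
by rewrite exprn_ile1 ?lambda_ge0 ?lambda_le1.
Qed.

(** The series is expanded to second order and v0 is split into the bump f and the truncated datum
    v0 - f. Only the second-order term built from f alone is kept; the other terms are bounded by
    [gpair_le], except the pairing of f itself, which stays as it is because its bound would be of
    order A. *)
Lemma gpair_evolution_lower :
  t ^+ 2 / 2 * gpair (fun xi => (lam2 xi)%:C * conv_pow j f xi)
  - t ^+ 2 / 2 * (cg * (j.+1%:R * M ^+ j * b)) - t ^+ 2 / 2 * (cg * M)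
  - (cg * b + `|gpair f|) - t * (cg * b) - cg * (2 * M * (t * rho) ^+ 3)
  <= `|gpair (evolution j v0 v1 t)|.
Proof.
set tail := fun xi => evolution j v0 v1 t xi - \sum_(i < 3) (t ^+ i)%:C * taylor j v0 v1 i xi.
have ntail : nice (2 * M * (t * rho) ^+ 3) tail.
  exact: (nice_evolution_tail nv0 nv1 rho4 rhoM t0 trho 3).
have nB := nice_lam2 (nice_conv_pow j nf).
have nD := nice_lam2 (conv_pow_diff j nv0 nf nvf).
have nL := nice_lam2 nv0.
set B := fun xi => (lam2 xi)%:C * conv_pow j f xi in nB *.
set D := fun xi => (lam2 xi)%:C * (conv_pow j v0 xi - conv_pow j f xi) in nD *.
set L := fun xi => (lam2 xi)%:C * v0 xi in nL *.
pose a := - (t ^+ 2 / 2).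
have UE : evolution j v0 v1 t = (fun xi => (v0 xi - f xi) + (f xi + (t%:C * v1 xi +
    (a%:C * B xi + (a%:C * D xi + (a%:C * L xi + tail xi)))))).
  apply/funext => xi; rewrite /tail !big_ord_recl big_ord0 /=.
  rewrite !taylorE /= cauchy_pow0 !taylorE /=.
  rewrite /B /D /L /a /lam2.
  have -> : (- (lambda xi ^+ 2 / (1 * 2)))%:C = (- (2^-1))%:C * (lambda xi ^+ 2)%:C :> R[i].
    by rewrite -rmorphM /=; congr (_%:C); rewrite mul1r; ring.
  have -> : (- (t ^+ 2 / 2))%:C = (t ^+ 2)%:C * (- (2^-1))%:C :> R[i].
    by rewrite -rmorphM /=; congr (_%:C); ring.
  rewrite expr0 expr1.
  move: (evolution _ _ _ _ _) ((lambda xi ^+ 2)%:C) ((- 2^-1)%:C) (t%:C) ((t ^+ 2)%:C) => u l h t1 t2.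
  move: (conv_pow j v0 xi) (conv_pow j f xi) (v0 xi) (v1 xi) (f xi) => x1 x2 x3 x4 x5.
  ring.
have naL := niceD (niceZ a nL) ntail.
have naD := niceD (niceZ a nD) naL.
have naB := niceD (niceZ a nB) naD.
have n1 := niceD (niceZ t nv1b) naB.
have n2 := niceD nf n1.
have -> : gpair (evolution j v0 v1 t) = gpair (fun x => v0 x - f x) + (gpair f +
    (t * gpair v1 + (a * gpair B + (a * gpair D + (a * gpair L + gpair tail))))).
  rewrite UE (gpairD nvf n2) (gpairD nf n1) (gpairD (niceZ t nv1b) naB).
  rewrite (gpairD (niceZ a nB) naD) (gpairD (niceZ a nD) naL) (gpairD (niceZ a nL) ntail).
  by rewrite (gpairZ t nv1b) (gpairZ a nB) (gpairZ a nD) (gpairZ a nL).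
have l1 := gpair_le nvf; have l2 := gpair_le nv1b; have l3 := gpair_le nD.
have l4 := gpair_le nL; have l5 := gpair_le ntail.
have t2 : 0 <= t ^+ 2 / 2 by rewrite divr_ge0// sqr_ge0.
move: l1 l2 l3 l4 l5; rewrite /a.
move: (gpair (fun x => v0 x - f x)) (gpair v1) (gpair B) (gpair D) (gpair L) (gpair tail) (gpair f).
move: (cg * b) (cg * (j.+1%:R * M ^+ j * b)) (cg * M) (cg * (2 * M * (t * rho) ^+ 3)) (t ^+ 2 / 2) t2.
move=> k1 k2 k3 k4 s s0 x y z w p q u l1 l2 l3 l4 l5.
have h1 : t * y <= t * k1 by rewrite ler_wpM2l// (le_trans (ler_norm _)).
have h2 : s * `|w| <= s * k2 by rewrite ler_wpM2l.
have h3 : s * `|p| <= s * k3 by rewrite ler_wpM2l.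
have h4 : s * - `|w| <= s * - w by rewrite ler_wpM2l// lerN2 ler_norm.
have h5 : s * - `|p| <= s * - p by rewrite ler_wpM2l// lerN2 ler_norm.
have h6 : s * - w <= s * `|w| by rewrite ler_wpM2l// -normrN ler_norm.
have h7 : s * - p <= s * `|p| by rewrite ler_wpM2l// -normrN ler_norm.
(* The resonant term enters the series with a minus sign, so it is the opposite of the pairing that
   is bounded from below. *)
rewrite -[leRHS]normrN; apply: le_trans (ler_norm _).
have := ler_norm x; have := ler_norm u; have := ler_norm q.
lra.
Qed.

End second_order_growth.

(** * The choice of size and time *)

Section parameters.
Context {R : realType}.

Lemma parameter_choice (j : nat) (b c m K X eps : R) : (0 < j)%N ->
  0 <= b -> 0 <= c -> 0 < m -> 0 <= K -> 0 <= X -> 0 < eps ->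
  exists A M rho t : R, [/\ 0 <= A, b <= M - 2 * A, 4 <= rho, 5 * (1 + (8 * M) ^+ j) <= rho ^+ 2 &
   [/\ 0 < t, t < eps, t * rho <= 16^-1 & X <
     t ^+ 2 / 2 * (m * A ^+ j.+1) - t ^+ 2 / 2 * (c * (j.+1%:R * M ^+ j * b)) - t ^+ 2 / 2 * (c * M)
     - (c * b + K) - t * (c * b) - c * (2 * M * (t * rho) ^+ 3)]].
Proof.
move=> j0 b0 c0 m0 K0 X0 e0.
(* With M = 3 A one has (8 M)^j = 24^j A^j; this C ensures 5 (1 + 24^j A^j) <= C^2 A^j = rho^2. *)
have [C CE] : exists C : R, C = 10 * 24 ^+ j by exists (10 * 24 ^+ j).
have C1 : 10 <= C by rewrite CE ler_peMr// exprn_ege1// ler1n.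
pose c1 := m / (512 * C ^+ 2).
have C2 : 0 < 512 * C ^+ 2 by apply: mulr_gt0; [lra|apply: exprn_gt0; lra].
have c1p : 0 < c1 by exact: divr_gt0 m0 C2.
pose c2 := c * (j.+1%:R * 3 ^+ j * b) + c * 3 + (c * b + K) + c * b.
have c2p : 0 <= c2 by rewrite !addr_ge0// !mulr_ge0// ?exprn_ge0// mulr_ge0.
(* One large parameter collects all demands: 1 makes powers of r increase, b gives b <= A, eps^-1
   gives t < eps, and the quotient makes c1 r^2 exceed (c + c2 + X + 1) r. Here c1 r^2 is the
   resonant term, c2 bounds the errors uniformly in r, and c r bounds the remainder. *)
pose r := 1 + b + eps^-1 + (c + c2 + X + 1) / c1.
have ei : 0 < eps^-1 by rewrite invr_gt0.
have q0 : 0 <= (c + c2 + X + 1) / c1 by rewrite divr_ge0 ?(ltW c1p)//; lra.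
have r1 : 1 <= r by rewrite /r; lra.
have rb : b <= r by rewrite /r; lra.
have re : eps^-1 < r by rewrite /r; lra.
have rc : c + c2 + X + 1 <= c1 * r.
  by rewrite mulrC -ler_pdivrMr// /r; lra.
have r0 : 0 < r by lra.
have rn n : 1 <= r ^+ n by rewrite exprn_ege1.
have r4b : r <= r ^+ 4 by rewrite -[leLHS]expr1 ler_weXn2l.
(* M = 3 A covers the bump, of size 2 A, and the truncated data, of size b <= A. As rho is of order
   A^(j/2) and t rho = 1 / (16 r), the remainder M (t rho)^3 is of order r^4 r^-3 = r, against r^2
   for the resonant term. *)
pose A := r ^+ 4; pose M := 3 * A; pose rho := C * r ^+ (2 * j).
pose t := (16 * C * r ^+ (2 * j).+1)^-1.
have tp : 0 < t by rewrite invr_gt0 !mulr_gt0// ?exprn_gt0//; lra.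
have trho : t * rho = (16 * r)^-1.
  rewrite /t /rho exprS.
  have : r ^+ (2 * j) != 0 by rewrite gt_eqF// exprn_gt0.
  move: (r ^+ _) => z z0; field.
  by rewrite z0 /=; apply/andP; split; apply/negP => /eqP; lra.
have t1 : t * r <= 10^-1.
  rewrite /t mulrC ler_pdivrMr; last by rewrite -invr_gt0.
  rewrite exprS.
  have ry : r <= r * r ^+ (2 * j) by rewrite ler_peMr// ltW.
  have : 10 * (r * r ^+ (2 * j)) <= C * (r * r ^+ (2 * j)) by rewrite ler_wpM2r//; lra.
  lra.
have A1 : 1 <= A by exact: rn.
(* t^2 A^(j+1) is of order r^2 while the error terms are at most of order r. *)
exists A, M, rho, t; split.
- by rewrite /A exprn_ge0// ltW.
- by rewrite /M /A; lra.
- by rewrite /rho; have := rn (2 * j)%N; nra.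
- rewrite /M mulrA (_ : 8 * 3 = 24 :> R); last by lra.
  have AE : A ^+ j = r ^+ (2 * j * 2) by rewrite /A -exprM; congr (_ ^+ _); clear; lia.
  rewrite exprMn AE /rho exprMn -exprM.
  have h24 : 1 <= 24 ^+ j :> R by rewrite exprn_ege1// ler1n.
  have := rn (2 * j * 2)%N; rewrite CE; move: (r ^+ _) (24 ^+ j) h24 => x y y1 x1.
  have xy : 1 <= y * x by nra.
  have : y * x <= y ^+ 2 * x by rewrite ler_wpM2r//; nra.
  rewrite exprMn; lra.
split => //.
- have : t * r < eps * r.
    apply: le_lt_trans t1 _; apply: (@lt_trans _ _ 1); first by rewrite invf_lt1//; lra.
    by rewrite -ltr_pdivrMl// mulr1.
  by rewrite ltr_pM2r.
- rewrite trho lef_pV2 ?posrE//; lra.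
have tA : t ^+ 2 / 2 * (m * A ^+ j.+1) = c1 * r ^+ 2.
  rewrite /t /c1 /A -exprM (_ : (4 * j.+1 = ((2 * j).+1 * 2) + 2)%N); last by clear; lia.
  rewrite exprD exprM; have : r ^+ (2 * j).+1 != 0 by rewrite gt_eqF// exprn_gt0.
  move: (r ^+ (2 * j).+1) => z z0; field.
  by rewrite z0 andbT gt_eqF//; lra.
(* Used for n = j, the error of replacing v0 by the bump in the convolution power, and for n = 1,
   the linear term of second order. *)
have tM n : (n <= j)%N -> t ^+ 2 * A ^+ n <= 1.
  move=> nj; rewrite /t /A -exprM exprVn -ler_pdivlMl; last first.
    by rewrite invr_gt0 exprn_gt0// -invr_gt0.
  rewrite invrK mulr1 (@le_trans _ _ (r ^+ ((2 * j).+1 * 2)))//.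
    by rewrite ler_weXn2l//; clear - nj; lia.
  rewrite exprMn [leRHS]mulrC exprM ler_peMr ?sqr_ge0//.
  by rewrite exprn_ege1//; lra.
have tM1 := tM 1%N j0; have tMj := tM j (leqnn j); rewrite expr1 in tM1.
have e1 : t ^+ 2 / 2 * (c * (j.+1%:R * M ^+ j * b)) <= c * (j.+1%:R * 3 ^+ j * b).
  rewrite /M exprMn [leLHS](_ : _ = (c * (j.+1%:R * 3 ^+ j * b)) * (t ^+ 2 * A ^+ j) / 2); last by ring.
  have h : 0 <= c * (j.+1%:R * 3 ^+ j * b) by rewrite !mulr_ge0// ?exprn_ge0.
  have : c * (j.+1%:R * 3 ^+ j * b) * (t ^+ 2 * A ^+ j) <= c * (j.+1%:R * 3 ^+ j * b) by rewrite ler_piMr.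
  lra.
have e2 : t ^+ 2 / 2 * (c * M) <= c * 3.
  rewrite /M [leLHS](_ : _ = c * 3 * (t ^+ 2 * A) / 2); last by ring.
  have : c * 3 * (t ^+ 2 * A) <= c * 3 by rewrite ler_piMr// mulr_ge0.
  have : 0 <= c * 3 by rewrite mulr_ge0.
  lra.
have e3 : t * (c * b) <= c * b.
  rewrite ler_piMl ?mulr_ge0//; nra.
have e4 : c * (2 * M * (t * rho) ^+ 3) <= c * r.
  rewrite ler_wpM2l// trho /M /A [leLHS](_ : _ = r * (6 / 4096)); last first.
    by field; lra.
  lra.
have e5 : (c + c2 + X + 1) * r <= c1 * r ^+ 2.
  by rewrite expr2 mulrA ler_wpM2r// ltW.
have e6 : (c2 + X + 1) * 1 <= (c2 + X + 1) * r by rewrite ler_wpM2l//; lra.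
have c2E : c2 = c * (j.+1%:R * 3 ^+ j * b) + c * 3 + (c * b + K) + c * b by [].
rewrite tA; lra.
Qed.

End parameters.

Section perturbed_data.
Context {R : realType} {d : nat}.
Local Notation E := (Euc R d).
Local Notation mu := (lebesgue R d).

(** By (q + y)^2 <= 2 q^2 + 2 y^2, two contributions of B^2 / 4 each add up to B^2. *)
Lemma sobolev_norm_perturbed (s B : R) (T : distr R d) (w g0 : E -> R[i]) (f : E -> R) K L :
  0 <= B -> nice K w -> nice L (fun x => (f x)%:C) -> has_fourier T g0 ->
  (\int[mu]_x ((japanese x `^ s * Normc.normc (w x - g0 x)) ^+ 2)%:E <= (B ^+ 2 / 4)%:E)%E ->
  (\int[mu]_x ((japanese x `^ s * f x) ^+ 2)%:E <= ((B / 2) ^+ 2)%:E)%E ->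
  (sobolev_norm s (distr_sub (distr_of (inv_fourier (fun x => (w x + (f x)%:C)%R))) T) <= B%:E)%E.
Proof.
move=> B0 nw nf Tg h1 h2.
apply: (sobolev_norm_upper B0 (niceD nw nf) Tg).
have mg := Tg.1; have [mw _ _] := nw; have [mf _ _] := nf.
have mJ := @measurable_japanese_powR R d s.
pose F1 x := (japanese x `^ s * Normc.normc (w x - g0 x)) ^+ 2.
pose F2 x := (japanese x `^ s * f x) ^+ 2.
have mF1 : measT F1.
  apply: measurable_funX; apply: measurable_funM => //.
  by apply: measurable_normc; exact: cmeasB.
have mF2 : measT F2.
  by apply: measurable_funX; apply: measurable_funM => //; exact: mf.1.
have -> : (B ^+ 2)%:E = (2%:E * (B ^+ 2 / 4)%:E + 2%:E * ((B / 2) ^+ 2)%:E)%E.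
  by rewrite -!EFinM -EFinD; congr (_%:E); field.
apply: le_trans (leeD (lee_wpmul2l _ h1) (lee_wpmul2l _ h2)) => //.
rewrite -!ge0_integralZl_EFin//; first last.
- exact/measurable_EFinP.
- by move=> x _; rewrite lee_fin sqr_ge0.
- exact/measurable_EFinP.
- by move=> x _; rewrite lee_fin sqr_ge0.
rewrite -ge0_integralD//; first last.
- by apply: measurable_funeM; exact/measurable_EFinP.
- by move=> x _; rewrite -EFinM lee_fin mulr_ge0 ?sqr_ge0.
- by apply: measurable_funeM; exact/measurable_EFinP.
- by move=> x _; rewrite -EFinM lee_fin mulr_ge0 ?sqr_ge0.
apply: le_integral_ge0.
- apply: measurable_funX; apply: measurable_funM => //.
  by apply: measurable_normc; apply: cmeasB => //; exact: cmeasD.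
- by apply: measurable_funD; apply: measurable_funM => //; exact: measurable_cst.
- by move=> x; rewrite sqr_ge0.
move=> x; have J0 : 0 <= japanese x `^ s by exact: powR_ge0.
have hn : Normc.normc (w x + (f x)%:C - g0 x) <= Normc.normc (w x - g0 x) + `|f x|.
  rewrite addrAC; apply: le_trans (le_normcD _ _) _.
  by rewrite lerD2l /Normc.normc /= expr0n/= addr0 sqrtr_sqr.
have n0 : 0 <= Normc.normc (w x + (f x)%:C - g0 x) by exact: normc_ge0.
rewrite !exprMn -[f x ^+ 2]real_normK ?num_real//.
move: (Normc.normc _) (Normc.normc _) (`|f x|) (japanese x `^ s ^+ 2) (sqr_ge0 (japanese x `^ s)) hn n0.
move=> q p y J J2 pq p0.
have pq2 : p ^+ 2 <= (q + y) ^+ 2 by rewrite lerXn2r// nnegrE; lra.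
have : p ^+ 2 <= 2 * q ^+ 2 + 2 * y ^+ 2 by have := sqr_ge0 (q - y); lra.
by move=> /(ler_wpM2l J2) /le_trans; apply; rewrite le_eqVlt; apply/orP; left; apply/eqP; ring.
Qed.

End perturbed_data.

(** The order of choices matters: truncations of the data, which fix b; then D, m and K, which are
    independent of size and frequency; then A, M, rho and t; and only then N. *)
Theorem mainTheorem4 (R : realType) (d k : nat) (hd : (1 <= d)%N)
    (hk : (2 <= k)%N) (sigma s : R) (hs : s < 0)
    (u0 u1 : distr R d) (hu0 : sobolev s u0) (hu1 : sobolev s u1)
    (eps : R) (heps : 0 < eps) :
  exists (T t_eps : R) (v0 v1 : Euc R d -> R[i]) (u : R -> Euc R d -> R[i]),
    [/\ solution k T v0 v1 u,
        0 < t_eps < eps,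
        t_eps <= T,
        (sobolev_norm s (distr_sub (distr_of v0) u0) +
         sobolev_norm s (distr_sub (distr_of v1) u1) < eps%:E)%E &
        (eps^-1%:E < sobolev_norm sigma (distr_of (u t_eps)))%E].
Proof.
case: k hk => [//|j] j0; rewrite ltnS in j0.
pose i0 : 'I_d := Ordinal hd.
(* Each of the two data is approximated to within eps / 4, so the sum of the norms is strictly below
   eps. *)
pose B := eps / 4.
have B0 : 0 < B by rewrite divr_gt0.
have B24 : 0 < B ^+ 2 / 4 by rewrite divr_gt0// exprn_gt0.
have [g0 Tg0 g0s] := sobolev_fourier hu0.2.
have [g1 Tg1 g1s] := sobolev_fourier hu1.2.
have [n0 hn0] := cutoff_approx Tg0.1 B24 g0s.
have [n1 hn1] := cutoff_approx Tg1.1 B24 g1s.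
have [b0 nw0] := nice_cutoff n0 Tg0.1.
have [b1 nw1] := nice_cutoff n1 Tg1.1.
have b00 := nice_ge0 nw0; have b10 := nice_ge0 nw1.
pose b := b0 + b1.
have bp : 0 <= b by rewrite addr_ge0.
have {}nw0 : nice b (cutoff n0 g0) by apply: nice_le nw0 _; rewrite lerDl.
have {}nw1 : nice b (cutoff n1 g1) by apply: nice_le nw1 _; rewrite lerDr.
have [D D0 HD] := @sobolev_norm_lower R d sigma.
have [m m0 Hm] := @gpair_resonance R d i0 j j0.
have [K K0 HK] := @gpair_bump R d i0 j j0.
have X0 : 0 <= eps^-1 * D by rewrite mulr_ge0 ?invr_ge0 ?ltW.
have c0 : 0 <= Num.sqrt (pi : R) ^+ d by rewrite exprn_ge0.
have [A [M [rho [t [A0 bM rho4 rhoM [t0 teps trho HX]]]]]] :=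
  parameter_choice j0 bp c0 m0 K0 X0 heps.
have B20 : 0 < B / 2 by rewrite divr_gt0.
have [N0 N00 HN] := @bump_sobolev_small R d i0 j j0 s A (B / 2) hs A0 B20.
(* N - 2 = N0 + 2 A meets both demands: smallness of the bumps in H^s and the hypothesis of
   [gpair_bump]. *)
pose N := 2 + N0 + 2 * A.
have N2 : 2 <= N by rewrite /N; lra.
have nf := nice_bump i0 N j A0.
set f := cbump i0 A N j in nf.
pose v0 x := cutoff n0 g0 x + f x.
pose v1 := cutoff n1 g1.
have nv0 : nice M v0 by apply: nice_le (niceD nw0 nf) _; lra.
have nv1 : nice M v1 by apply: nice_le nw1 _; lra.
have nfM : nice M f by apply: nice_le nf _; lra.
have nvf : nice b (fun x => v0 x - f x) by apply: eq_nice nw0 => x; rewrite /v0 addrK.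
(* The solution is only claimed up to the inflation time: the final time and [t_eps] coincide. *)
exists t, t, (inv_fourier v0), (inv_fourier v1), (fun t => inv_fourier (evolution j v0 v1 t)).
split.
- exact: (evolution_solution nv0 nv1 rho4 rhoM t0 trho).
- by rewrite t0.
- by [].
- have h0 : (sobolev_norm s (distr_sub (distr_of (inv_fourier v0)) u0) <= B%:E)%E.
    apply: (sobolev_norm_perturbed (ltW B0) nw0 nf Tg0 hn0).
    by apply: HN => //; rewrite /N; lra.
  have h1 : (sobolev_norm s (distr_sub (distr_of (inv_fourier v1)) u1) <= B%:E)%E.
    apply: (sobolev_norm_upper (ltW B0) nw1 Tg1); apply: le_trans hn1 _.
    rewrite lee_fin; have := sqr_ge0 B; lra.
  apply: le_lt_trans (leeD h0 h1) _; rewrite -EFinD lte_fin /B; lra.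
have nU := nice_evolution nv0 nv1 rho4 rhoM (ltW t0) trho.
(* The target X = eps^-1 D of the parameter choice is what converts the pairing bound into an
   H^sigma norm above eps^-1. *)
apply: (HD _ _ _ nU); apply: lt_le_trans HX _.
apply: le_trans (gpair_evolution_lower nv0 nv1 nfM nvf nw1 rho4 rhoM (ltW t0) trho).
have hK : `|gpair f| <= K by apply: HK => //; rewrite /N; lra.
have hm : t ^+ 2 / 2 * (m * A ^+ j.+1) <=
    t ^+ 2 / 2 * gpair (fun x => (lambda x ^+ 2)%:C * conv_pow j f x).
  by rewrite ler_wpM2l ?divr_ge0 ?sqr_ge0//; exact: Hm.
by rewrite !lerB// lerD2l.
Qed.
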